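(* Let $\Omega\subset\mathbb{C}$ be a hyperbolic domain with an isolated boundary point at $z=0$ and let $\lambda_\Omega(z)\,|dz|$ be the hyperbolic metric of $\Omega$ (with curvature $-4$). Let $\lambda(z)\,|dz|$ be a regular conformal Riemannian metric on $\Omega$ which is locally complete (at $z=0$) and whose curvature extends to a Hölder continuous function $\kappa:\Omega\cup\{0\}\to\mathbb{R}$ such that $\kappa(0)=-4$. Then (a) $\displaystyle\lim_{z\to0}\frac{\lambda(z)}{\lambda_\Omega(z)}=1$; (b) $\displaystyle\lim_{z\to0}\frac{\Gamma_\lambda(z)}{\Gamma_{\lambda_\Omega}(z)}=1$; (c) $\displaystyle\lim_{z\to0}\frac{S_\lambda(z)}{S_{\lambda_\Omega}(z)}=1$.
   Context: A conformal Riemannian metric $\lambda(z)\,|dz|$ on a domain $\Omega\subseteq\mathbb{C}$ is regular if its positive density $\lambda$ is of class $C^2$ in $\Omega$. Its (Gaussian) curvature is $\kappa_\lambda(z)=-\frac{(\Delta\log\lambda)(z)}{\lambda(z)^2}$, with $\Delta=\partial_x^2+\partial_y^2$, $z=x+iy$. A domain $\Omega\subset\mathbb{C}$ is hyperbolic if $\mathbb{C}\setminus\Omega$ contains at least two points; its hyperbolic metric is the unique complete regular conformal metric on $\Omega$ with constant curvature $-4$. A conformal metric $\lambda(z)\,|dz|$ on a domain $\Omega$ with an isolated boundary point at $z=0$ is called locally complete (at $z=0$) if $\lim_{z\to0,\,z\in\Omega}\mathrm{d}_\lambda(z_0,z)=+\infty$ for some (and then every) point $z_0\in\Omega$, where $\mathrm{d}_\lambda$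 is the distance function on $\Omega$ induced by $\lambda(z)\,|dz|$ (the infimum of $\int_\gamma\lambda(z)\,|dz|$ over curves $\gamma$ in $\Omega$ joining the two points). With the Wirtinger derivative $\partial/\partial z=\tfrac12(\partial_x-i\partial_y)$, the connection and the Schwarzian of a regular conformal metric $\lambda(z)\,|dz|$ are $$\Gamma_\lambda(z)=2\,\frac{\partial\log\lambda(z)}{\partial z},\qquad S_\lambda(z)=\frac{\partial\Gamma_\lambda(z)}{\partial z}-\frac12\Gamma_\lambda(z)^2=2\left[\frac{\partial^2\log\lambda(z)}{\partial z^2}-\left(\frac{\partial\log\lambda(z)}{\partial z}\right)^2\right].$$ *)

(* Defs.v *)
From Stdlib Require Import Reals.
From Coquelicot Require Import Coquelicot.

Open Scope R_scope.

(** * Domains in the complex plane *)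

Definition connected_set (A : C -> Prop) : Prop :=
  forall U V : C -> Prop,
    open U -> open V ->
    (forall z, A z -> U z \/ V z) ->
    (exists z, A z /\ U z) -> (exists z, A z /\ V z) ->
    exists z, A z /\ U z /\ V z.

Definition domain (Omega : C -> Prop) : Prop :=
  (exists z, Omega z) /\ open Omega /\ connected_set Omega.

Definition hyperbolic_domain (Omega : C -> Prop) : Prop :=
  domain Omega /\ exists a b : C, a <> b /\ ~ Omega a /\ ~ Omega b.

Definition boundary (A : C -> Prop) (z : C) : Prop :=
  forall U : C -> Prop, locally z U ->
    (exists w, U w /\ A w) /\ (exists w, U w /\ ~ A w).

Definition isolated_boundary_point (A : C -> Prop) (z : C) : Prop :=
  boundary A z /\ locally' z (fun w => ~ boundary A w).

(** * Partial derivatives with respect to [z = x + i y] *)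

Definition dx (f : C -> R) (z : C) : R := Derive (fun x => f (x, Im z)) (Re z).
Definition dy (f : C -> R) (z : C) : R := Derive (fun y => f (Re z, y)) (Im z).

Definition laplacian (f : C -> R) (z : C) : R := dx (dx f) z + dy (dy f) z.

Definition Cdx (f : C -> C) (z : C) : C :=
  (dx (fun w => Re (f w)) z, dx (fun w => Im (f w)) z).
Definition Cdy (f : C -> C) (z : C) : C :=
  (dy (fun w => Re (f w)) z, dy (fun w => Im (f w)) z).

Definition wirtinger (f : C -> C) (z : C) : C :=
  (/ 2 * (Cdx f z - Ci * Cdy f z))%C.

(** * Conformal metrics

    A metric [lam(z) |dz|] on [Omega] is a total function [lam : C -> R] of
    which only the values on [Omega] matter. *)

(* [ex_diff_n _ 2] at every point of an open set is exactly the class C^2. *)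
Definition regular_metric (Omega : C -> Prop) (lam : C -> R) : Prop :=
  forall z, Omega z ->
    0 < lam z /\ ex_diff_n (fun x y => lam (x, y)) 2 (Re z) (Im z).

Definition curvature (lam : C -> R) (z : C) : R :=
  - laplacian (fun w => ln (lam w)) z / lam z ^ 2.

Definition connection (lam : C -> R) (z : C) : C :=
  (2 * wirtinger (fun w => RtoC (ln (lam w))) z)%C.

Definition schwarzian (lam : C -> R) (z : C) : C :=
  (wirtinger (connection lam) z - / 2 * (connection lam z * connection lam z))%C.

(** * The induced distance *)

(* A C^1 arc is parametrized by [0, 1].  Asking [gamma] to be C^1 on the whole
   line loses nothing: a C^1 map on [0, 1] extends affinely beyond its ends. *)
Definition C1_arc (gamma dgamma : R -> C) : Prop :=
  forall t : R,
    is_derive (K := R_AbsRing) (V := C_R_NormedModule) gamma t (dgamma t) /\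
    continuous dgamma t.

(* [curve_length Omega lam z w l]: some piecewise C^1 curve (a finite
   concatenation of C^1 arcs) in [Omega] from [z] to [w] has [lam]-length [l]. *)
Inductive curve_length (Omega : C -> Prop) (lam : C -> R) : C -> C -> R -> Prop :=
| curve_arc (gamma dgamma : R -> C) :
    C1_arc gamma dgamma ->
    (forall t, 0 <= t <= 1 -> Omega (gamma t)) ->
    curve_length Omega lam (gamma 0) (gamma 1)
      (RInt (fun t => lam (gamma t) * Cmod (dgamma t)) 0 1)
| curve_concat (z1 z2 z3 : C) (l12 l23 : R) :
    curve_length Omega lam z1 z2 l12 ->
    curve_length Omega lam z2 z3 l23 ->
    curve_length Omega lam z1 z3 (l12 + l23).

Definition metric_dist (Omega : C -> Prop) (lam : C -> R) (z w : C) : Rbar :=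
  Glb_Rbar (curve_length Omega lam z w).

Definition complete_metric (Omega : C -> Prop) (lam : C -> R) : Prop :=
  forall u : nat -> C,
    (forall n, Omega (u n)) ->
    (forall eps : posreal, exists N : nat, forall n m : nat,
       (N <= n)%nat -> (N <= m)%nat ->
       Rbar_lt (metric_dist Omega lam (u n) (u m)) eps) ->
    exists z, Omega z /\
      forall eps : posreal, eventually (fun n =>
        Rbar_lt (metric_dist Omega lam z (u n)) eps).

Definition locally_complete_at (Omega : C -> Prop) (lam : C -> R) (p : C) : Prop :=
  exists z0, Omega z0 /\
    forall M : R, within Omega (locally p) (fun z =>
      Rbar_lt M (metric_dist Omega lam z0 z)).

Definition is_hyperbolic_metric (Omega : C -> Prop) (lam : C -> R) : Prop :=
  regular_metric Omega lam /\ complete_metric Omega lam /\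
  forall z, Omega z -> curvature lam z = - 4.

(** * Hölder continuity *)

(* The case [z = w] is left out because [Rpower 0 alpha] is [1], not [0]. *)
Definition holder_continuous_on (A : C -> Prop) (f : C -> R) : Prop :=
  exists alpha K : R, 0 < alpha <= 1 /\
    forall z w, A z -> A w -> z <> w ->
      Rabs (f z - f w) <= K * Rpower (Cmod (z - w)) alpha.

(* Main.v *)
Require Import Defs.
From Stdlib Require Import ZArith Reals Lra Lia List Classical ClassicalEpsilon.
From Coquelicot Require Import Coquelicot.

(** In the coordinate [w = t + i theta = log z] a metric [lam |dz|] near the
    puncture becomes [exp U |dw|] with [U = ln lam + t], a function that is
    [2 PI]-periodic in [theta] on a half plane [t < T]. The curvature equation
    reads [Delta U = q exp (2 U)] with [q = - kappa], and the hypothesis on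
    the curvature says that [q] tends to [4] as [t] tends to [-oo], with
    Hoelder constants on unit squares that tend to [0]. The theorem follows from
    three assertions, uniform in [theta]: [U + ln (- 2 t)] tends to [0], and so
    do the gradient of [U] and the components of its trace-free Hessian
    ([cylinder_asymptotics], [gradient_vanishes], [hessian_vanishes]). They hold
    for both metrics, [q] being the constant [4] for the hyperbolic one. The
    first assertion makes the quotient of the densities tend to [1]. By the
    others, [z Gamma] tends to [-1] and [z^2 S] to [1/2] for both metrics, so
    that the quotients of the connections and of the Schwarzians tend to [1]
    ([puncture_asymptotics]).

    All estimates come from the maximum principle applied to explicit barriers.

    The upper bound of [U] is Ahlfors' lemma. The lower bound compares [U] with
    the subsolutions [- ln (2 k x) - beta x], where [x] is [- t] up to a shift,
    and then lets [beta] tend to [0]. On remote circles the comparison needs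
    [U >= beta t]. If this failed on all of them, then [- U], a positive function
    with bounded Laplacian, would be large somewhere on every circle, hence
    everywhere on it by Harnack's inequality; the ray [theta = 0] would have
    finite length, contrary to completeness ([circles_of_ray_divergent]).
    Harnack's inequality itself follows from the gradient estimate at a maximum
    point of a weighted function and from a logarithmic barrier ([harnack]).

    Once [U] is known, on unit squares it is nearly constant and its Laplacian is
    small together with its Hoelder seminorm. Interior estimates then give the
    decay of the derivatives. The gradient is bounded by comparing the odd part
    of the function in one variable with a barrier on a half square
    ([reflection_difference_le]). The second derivatives are bounded by comparing
    its odd part in both variables with a barrier that is [O (x y)] on a quarter
    square ([mixed_difference_le]). *)

Open Scope R_scope.

(** * Elementary real inequalities *)

Ltac Rmin_bounds x y := pose proof (Rmin_l x y); pose proof (Rmin_r x y).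

Lemma exp_le (x y : R) : x <= y -> exp x <= exp y.
Proof. intros [H| ->]; [left; apply exp_increasing, H | lra]. Qed.

Lemma exp_double (x : R) : exp (2 * x) = exp x * exp x.
Proof. rewrite <- exp_plus. f_equal. ring. Qed.

Lemma Rabs_le_of_sum_sqr (a b r : R) :
  0 <= r -> a * a + b * b <= r * r -> Rabs a <= r /\ Rabs b <= r.
Proof.
  intros Hr H. pose proof (Rle_0_sqr a); pose proof (Rle_0_sqr b). unfold Rsqr in *.
  split; rewrite <- (Rabs_pos_eq r Hr);
    apply Rsqr_le_abs_0; unfold Rsqr; lra.
Qed.

Lemma ln_ge_1_minus_inv (x : R) : 0 < x -> 1 - / x <= ln x.
Proof.
  intro Hx. pose proof (exp_ineq1_le (- ln x)) as H.
  rewrite exp_Ropp, exp_ln in H; lra.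
Qed.

Lemma ln_le_self (x : R) : 0 < x -> ln x <= x.
Proof.
  intro Hx. pose proof (exp_ineq1_le (ln x)) as H. rewrite exp_ln in H; lra.
Qed.

Lemma Rpower_le_1 (x alpha : R) : 0 < x <= 1 -> 0 <= alpha -> Rpower x alpha <= 1.
Proof.
  intros Hx Ha.
  unfold Rpower. rewrite <- exp_0. apply exp_le.
  assert (ln x <= 0) by (rewrite <- ln_1; apply ln_le; lra). nra.
Qed.

Lemma Rpower_pos (x y : R) : 0 < Rpower x y.
Proof. apply exp_pos. Qed.

Lemma Rpower_pred (x alpha : R) : 0 < x -> x * Rpower x (alpha - 1) = Rpower x alpha.
Proof.
  intro Hx. replace alpha with (1 + (alpha - 1)) at 2 by ring.
  rewrite Rpower_plus, Rpower_1; auto.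
Qed.

Lemma le_Rpower_of_le_2 (x alpha : R) : 0 < x <= 2 -> 0 < alpha <= 1 -> x <= 2 * Rpower x alpha.
Proof.
  intros Hx Ha. replace alpha with (1 + (alpha - 1)) by ring.
  rewrite Rpower_plus, Rpower_1 by lra.
  assert (/ 2 <= Rpower x (alpha - 1)); [|nra].
  unfold Rpower. rewrite <- (exp_ln (/ 2)) by lra. apply exp_le. rewrite ln_Rinv by lra.
  assert (ln x <= ln 2) by (apply ln_le; lra).
  assert (0 < ln 2) by (rewrite <- ln_1; apply ln_increasing; lra). nra.
Qed.

Lemma exp_difference_le (a b m : R) : a <= m -> b <= m -> Rabs (exp a - exp b) <= exp m * Rabs (a - b).
Proof.
  intros Ha Hb.
  assert (H : forall a b, b <= a -> a <= m -> Rabs (exp a - exp b) <= exp m * Rabs (a - b)).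
  { clear. intros a b Hab Ha. rewrite !Rabs_pos_eq by (pose proof (exp_le _ _ Hab); lra).
    pose proof (exp_ineq1_le (b - a)) as H. pose proof (exp_pos a).
    assert (E : exp b = exp a * exp (b - a)) by (rewrite <- exp_plus; f_equal; ring).
    pose proof (exp_le _ _ Ha). rewrite E.
    apply Rle_trans with (exp a * (a - b)); [nra|]. apply Rmult_le_compat_r; lra. }
  destruct (Rle_or_lt b a); [apply H; lra|].
  rewrite Rabs_minus_sym, (Rabs_minus_sym a). apply H; lra.
Qed.

Lemma Rpower_double_le (x alpha : R) : 0 < x -> 0 < alpha <= 1 ->
  Rpower (2 * x) alpha <= 2 * Rpower x alpha.
Proof.
  intros Hx Ha. rewrite <- Rpower_mult_distr by lra.
  apply Rmult_le_compat_r; [left; apply Rpower_pos|].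
  rewrite <- (Rpower_1 2) at 2 by lra. apply Rle_Rpower; lra.
Qed.

Lemma exp_small k B : 0 < k -> forall eps, 0 < eps ->
  exists tau, forall t, t < tau -> exp (k * t + B) / k < eps.
Proof.
  intros Hk eps He. exists ((ln (eps * k) - B) / k). intros t Ht.
  assert (Hek : 0 < eps * k) by nra.
  apply (Rmult_lt_reg_r k); [lra|]. unfold Rdiv. rewrite Rmult_assoc, Rinv_l, Rmult_1_r by lra.
  rewrite <- (exp_ln _ Hek). apply exp_increasing.
  apply (Rmult_lt_compat_l k) in Ht; [|lra].
  replace (k * ((ln (eps * k) - B) / k)) with (ln (eps * k) - B) in Ht by (field; lra). lra.
Qed.

(** * Second derivatives and the maximum principle *)

(** The derivative [g'] is only required near [x]: this is what the second
    derivative test uses, and it can be computed for explicit barriers by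
    differentiating in one variable. *)
Definition second_derivative (g : R -> R) (x a : R) : Prop :=
  exists g' : R -> R,
    locally x (fun u => is_derive g u (g' u)) /\ is_derive g' x a.

(** If [a] were positive, [g'] would be positive just to the right of [x], where
    it vanishes, and the mean value theorem would give [g (x + h) > g x]. *)
Lemma second_derivative_at_max (g : R -> R) (x a : R) :
  second_derivative g x a -> locally x (fun u => g u <= g x) -> a <= 0.
Proof.
  intros [g' [[d1 Hg] Hg']] [d2 Hmax].
  destruct (Rle_or_lt a 0) as [|Ha]; [assumption | exfalso].
  assert (Hnear : forall (d : posreal) k, Rabs k < d -> ball x d (x + k)).
  { intros d k Hk. change (Rabs (x + k - x) < d).
    replace (x + k - x) with k by ring. exact Hk. }
  assert (H0 : g' x = 0).
  { assert (Hd : is_derive g x (g' x)) by apply Hg, ball_center.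
    apply is_derive_Reals in Hd.
    assert (pr : derivable_pt g x) by (exists (g' x); exact Hd).
    rewrite <- (derive_pt_eq_0 g x (g' x) pr Hd).
    pose proof (cond_pos d2).
    apply (deriv_maximum g (x - d2) (x + d2) x pr); try lra.
    intros u Hu1 Hu2; apply Hmax. replace u with (x + (u - x)) by ring.
    apply Hnear, Rabs_def1; lra. }
  apply is_derive_Reals in Hg'.
  destruct (Hg' (a / 2)) as [d3 H3]; [lra|].
  set (h := Rmin d1 (Rmin d2 d3) / 2).
  assert (Hh : 0 < h /\ h < d1 /\ h < d2 /\ h < d3).
  { pose proof (cond_pos d1); pose proof (cond_pos d2); pose proof (cond_pos d3).
    Rmin_bounds d1 (Rmin d2 d3).
    Rmin_bounds d2 d3.
    assert (0 < Rmin d1 (Rmin d2 d3)) by (repeat apply Rmin_glb_lt; assumption).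
    unfold h; lra. }
  destruct Hh as (Hh0 & Hh1 & Hh2 & Hh3).
  assert (Hm : g (x + h) <= g x).
  { apply Hmax, Hnear. rewrite Rabs_pos_eq; lra. }
  assert (Hpos : forall k, 0 < k <= h -> 0 < g' (x + k)).
  { intros k Hk.
    assert (Hk3 : Rabs k < d3) by (rewrite Rabs_pos_eq; lra).
    specialize (H3 k ltac:(lra) Hk3). rewrite H0, Rminus_0_r in H3.
    apply Rabs_def2 in H3.
    replace (g' (x + k)) with (g' (x + k) / k * k) by (field; lra).
    apply Rmult_lt_0_compat; lra. }
  destruct (MVT_cor2 g g' x (x + h)) as [e [He1 He2]]; [lra| |].
  - intros u Hu. apply is_derive_Reals, Hg. replace u with (x + (u - x)) by ring.
    apply Hnear, Rabs_def1; lra.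
  - specialize (Hpos (e - x) ltac:(lra)).
    replace (x + (e - x)) with e in Hpos by ring. nra.
Qed.

Lemma second_derivative_plus (g h : R -> R) (x a b : R) :
  second_derivative g x a -> second_derivative h x b ->
  second_derivative (fun u => g u + h u) x (a + b).
Proof.
  intros [g' [H1 H2]] [h' [H3 H4]]. exists (fun u => g' u + h' u); split.
  - generalize (filter_and _ _ H1 H3). apply filter_imp. intros u [Hu Hv].
    apply (is_derive_plus g h u _ _ Hu Hv).
  - apply (is_derive_plus g' h' x _ _ H2 H4).
Qed.

Lemma second_derivative_scal (k : R) (g : R -> R) (x a : R) :
  second_derivative g x a -> second_derivative (fun u => k * g u) x (k * a).
Proof.
  intros [g' [H1 H2]]. exists (fun u => k * g' u); split.
  - revert H1. apply filter_imp. intros u Hu.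
    apply (is_derive_scal g u k _ Hu).
  - apply (is_derive_scal g' x k _ H2).
Qed.

Lemma second_derivative_ext (g h : R -> R) (x a : R) :
  (forall u, g u = h u) -> second_derivative g x a -> second_derivative h x a.
Proof.
  intros E (g' & G1 & G2). exists g'; split; [|exact G2].
  revert G1. apply filter_imp. intros u. apply is_derive_ext. exact E.
Qed.

Lemma second_derivative_continuity (g : R -> R) (x a : R) :
  second_derivative g x a -> continuity_pt g x.
Proof.
  intros (g' & H & _). apply locally_singleton in H.
  apply derivable_continuous_pt. exists (g' x). apply is_derive_Reals, H.
Qed.

Lemma second_derivative_intro (g g' : R -> R) (x a : R) :
  (forall u, is_derive g u (g' u)) -> is_derive g' x a -> second_derivative g x a.
Proof. intros H1 H2. exists g'; split; [apply filter_forall; exact H1 | exact H2]. Qed.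

(** Relational and sensitive only to the two axis directions, so that barriers
    and differences of solutions are treated alike. Rotations are out of reach
    of this notion; [jet2] below serves for them. *)
Definition has_laplacian (F : R -> R -> R) (x y L : R) : Prop :=
  exists a d, second_derivative (fun u => F u y) x a /\
    second_derivative (F x) y d /\ L = a + d.

Lemma has_laplacian_plus F G x y L M :
  has_laplacian F x y L -> has_laplacian G x y M ->
  has_laplacian (fun u v => F u v + G u v) x y (L + M).
Proof.
  intros (a & d & H1 & H2 & ->) (a' & d' & H3 & H4 & ->).
  exists (a + a'), (d + d'); repeat split.
  - apply (second_derivative_plus _ _ _ _ _ H1 H3).
  - apply (second_derivative_plus _ _ _ _ _ H2 H4).
  - ring.
Qed.

Lemma has_laplacian_scal k F x y L :
  has_laplacian F x y L -> has_laplacian (fun u v => k * F u v) x y (k * L).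
Proof.
  intros (a & d & H1 & H2 & ->).
  exists (k * a), (k * d); repeat split.
  - apply (second_derivative_scal k _ _ _ H1).
  - apply (second_derivative_scal k _ _ _ H2).
  - ring.
Qed.

Lemma has_laplacian_ext F G x y L :
  (forall u v, F u v = G u v) -> has_laplacian F x y L -> has_laplacian G x y L.
Proof.
  intros E (a & d & H1 & H2 & ->). exists a, d; repeat split.
  - revert H1. apply second_derivative_ext. intro u. apply E.
  - revert H2. apply second_derivative_ext. intro v. apply E.
Qed.

Lemma has_laplacian_fst (g : R -> R) (x y a : R) :
  second_derivative g x a -> has_laplacian (fun u _ => g u) x y a.
Proof.
  intro H. exists a, 0. repeat split; [exact H| |ring].
  apply second_derivative_intro with (fun _ => 0).
  - intro u. auto_derive; auto.
  - auto_derive; auto.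
Qed.

Lemma has_laplacian_at_max F x y L :
  has_laplacian F x y L -> locally_2d (fun u v => F u v <= F x y) x y -> L <= 0.
Proof.
  intros (a & d & H1 & H2 & ->) Hm.
  pose proof (second_derivative_at_max _ _ _ H1 (locally_2d_1d_const_y _ _ _ Hm)).
  pose proof (second_derivative_at_max _ _ _ H2 (locally_2d_1d_const_x _ _ _ Hm)).
  lra.
Qed.

Definition closed_2d (K : R -> R -> Prop) : Prop :=
  forall x y, ~ K x y -> locally_2d (fun u v => ~ K u v) x y.

Definition bounded_2d (K : R -> R -> Prop) : Prop :=
  exists B, forall x y, K x y -> Rabs x <= B /\ Rabs y <= B.

(** If every point of [K] were beaten by another one, it would be beaten on a
    whole neighbourhood by the same point; the best of the finitely many points
    that suffice by compactness could not be beaten. *)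
Lemma extreme_value_2d (K : R -> R -> Prop) (F : R -> R -> R) :
  closed_2d K -> bounded_2d K -> (exists x y, K x y) ->
  (forall x y, K x y -> continuity_2d_pt F x y) ->
  exists x y, K x y /\ forall u v, K u v -> F u v <= F x y.
Proof.
  intros Hc [B HB] [x0 [y0 H0]] HF.
  apply NNPP; intro Hno.
  assert (Hbig : forall x y, K x y -> exists p : R * R,
             K (fst p) (snd p) /\ F x y < F (fst p) (snd p)).
  { intros x y Hxy. apply NNPP; intro H. apply Hno. exists x, y; split; auto.
    intros u v Huv. apply Rnot_lt_le; intro Hlt. apply H. exists (u, v); auto. }
  assert (Hloc : forall x y, exists pd : (R * R) * posreal,
     K (fst (fst pd)) (snd (fst pd)) /\
     forall u v, Rabs (u - x) < snd pd -> Rabs (v - y) < snd pd ->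
       K u v -> F u v < F (fst (fst pd)) (snd (fst pd))).
  { intros x y. destruct (classic (K x y)) as [Hk|Hk].
    - destruct (Hbig x y Hk) as [p [Hp1 Hp2]].
      assert (He : 0 < F (fst p) (snd p) - F x y) by lra.
      destruct (HF x y Hk (mkposreal _ He)) as [d Hd].
      exists (p, d); split; [exact Hp1|]. intros u v Hu Hv _; cbn [fst snd].
      specialize (Hd u v Hu Hv). cbn [pos] in Hd. apply Rabs_def2 in Hd. lra.
    - destruct (Hc x y Hk) as [d Hd]. exists ((x0, y0), d); split; [exact H0|].
      intros u v Hu Hv Huv. elim (Hd u v Hu Hv Huv). }
  set (f := fun t : Compactness.Tn 2 R =>
    proj1_sig (constructive_indefinite_description _ (Hloc (fst t) (fst (snd t))))).
  assert (Hf : forall t,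
     K (fst (fst (f t))) (snd (fst (f t))) /\
     forall u v, Rabs (u - fst t) < snd (f t) -> Rabs (v - fst (snd t)) < snd (f t) ->
       K u v -> F u v < F (fst (fst (f t))) (snd (fst (f t)))).
  { intro t. exact (proj2_sig (constructive_indefinite_description _
      (Hloc (fst t) (fst (snd t))))). }
  apply (compactness_list 2 (- B, (- B, tt)) (B, (B, tt)) (fun t => snd (f t))).
  intros [l Hl].
  assert (Hcov : forall u v, K u v -> exists t, In t l /\
            F u v < F (fst (fst (f t))) (snd (fst (f t)))).
  { intros u v Huv. destruct (HB u v Huv) as [Hu Hv].
    apply Rabs_le_between in Hu; apply Rabs_le_between in Hv.
    destruct (Hl (u, (v, tt))) as [t [Ht1 [_ Ht2]]].
    { simpl; repeat split; lra. }
    exists t; split; [exact Ht1|].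
    destruct t as [t1 [t2 []]]. simpl in Ht2. destruct Ht2 as [Ht2 [Ht3 _]].
    apply (proj2 (Hf (t1, (t2, tt)))); auto. }
  assert (Hmax : forall l' : list (Compactness.Tn 2 R), (forall t, In t l' -> In t l) ->
     exists u v, K u v /\ forall t, In t l' ->
        F (fst (fst (f t))) (snd (fst (f t))) <= F u v).
  { induction l' as [|t l' IH]; intro Hin.
    - exists x0, y0; split; [exact H0|]. intros t [].
    - destruct IH as [u [v [Huv Hle]]]. { intros s Hs; apply Hin; right; exact Hs. }
      destruct (Rle_or_lt (F (fst (fst (f t))) (snd (fst (f t)))) (F u v)).
      + exists u, v; split; [exact Huv|]. intros s [<-|Hs]; auto.
      + exists (fst (fst (f t))), (snd (fst (f t))); split; [apply Hf|].
        intros s [<-|Hs]; [lra|]. specialize (Hle s Hs). lra. }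
  destruct (Hmax l (fun t H => H)) as [u [v [Huv Hle]]].
  destruct (Hcov u v Huv) as [t [Ht1 Ht2]]. specialize (Hle t Ht1). lra.
Qed.

(** Strict subharmonicity contradicts the second derivative test directly. In
    nonlinear applications the sign of the Laplacian is known only where [F] is
    positive, which is what the disjunction allows for. *)
Lemma maximum_principle (K : R -> R -> Prop) (F : R -> R -> R) :
  closed_2d K -> bounded_2d K ->
  (forall x y, K x y -> continuity_2d_pt F x y) ->
  (forall x y, K x y -> F x y <= 0 \/
     (locally_2d K x y /\ exists L, has_laplacian F x y L /\ 0 < L)) ->
  forall x y, K x y -> F x y <= 0.
Proof.
  intros Hc Hb HF Hi x y Hxy.
  destruct (extreme_value_2d K F Hc Hb) as [u [v [Huv Hm]]]; eauto.
  destruct (Hi u v Huv) as [Hle|[HK [L [HL1 HL2]]]].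
  - specialize (Hm x y Hxy); lra.
  - exfalso. apply (Rlt_not_le _ _ HL2).
    apply (has_laplacian_at_max _ _ _ _ HL1).
    revert HK. apply locally_2d_impl, locally_2d_forall. exact Hm.
Qed.

(** * Jets of twice differentiable functions *)

Lemma differentiable_pt_lim_add (f g : R -> R -> R) (x y a b c d : R) :
  differentiable_pt_lim f x y a b -> differentiable_pt_lim g x y c d ->
  differentiable_pt_lim (fun u v => f u v + g u v) x y (a + c) (b + d).
Proof.
  intros Hf Hg.
  replace (a + c) with (1 * a + 1 * c) by ring.
  replace (b + d) with (1 * b + 1 * d) by ring.
  apply (differentiable_pt_lim_comp (fun u v => u + v)); auto.
  intro eps. apply locally_2d_forall. intros u v.
  match goal with |- Rabs ?e <= _ => replace e with 0 by ring end.
  rewrite Rabs_R0. apply Rmult_le_pos; [left; apply cond_pos|].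
  eapply Rle_trans; [apply Rabs_pos | apply Rmax_l].
Qed.

Lemma differentiable_pt_lim_mul (f g : R -> R -> R) (x y a b c d : R) :
  differentiable_pt_lim f x y a b -> differentiable_pt_lim g x y c d ->
  differentiable_pt_lim (fun u v => f u v * g u v) x y
    (a * g x y + f x y * c) (b * g x y + f x y * d).
Proof.
  intros Hf Hg.
  replace (a * g x y) with (g x y * a) by ring.
  replace (b * g x y) with (g x y * b) by ring.
  apply (differentiable_pt_lim_comp (fun u v => u * v)); auto.
  intro eps. exists eps. intros u v Hu Hv.
  match goal with |- Rabs ?e <= _ =>
    replace e with ((u - f x y) * (v - g x y)) by ring end.
  rewrite Rabs_mult. apply Rmult_le_compat; try apply Rabs_pos; [lra|apply Rmax_r].
Qed.

Lemma differentiable_pt_lim_fst (g : R -> R) (x y a : R) :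
  is_derive g x a -> differentiable_pt_lim (fun u _ => g u) x y a 0.
Proof. intro H. apply differentiable_pt_lim_proj1_0, is_derive_Reals, H. Qed.

Lemma differentiable_pt_lim_snd (g : R -> R) (x y a : R) :
  is_derive g y a -> differentiable_pt_lim (fun _ v => g v) x y 0 a.
Proof.
  intros H eps.
  destruct (differentiable_pt_lim_fst g y x a H eps) as [d Hd].
  exists d. intros u v Hu Hv. specialize (Hd v u Hv Hu). cbn beta in Hd.
  rewrite Rmax_comm. replace (0 * (u - x) + a * (v - y))
    with (a * (v - y) + 0 * (u - x)) by ring. exact Hd.
Qed.

Lemma differentiable_pt_lim_partials (f : R -> R -> R) (x y a b : R) :
  differentiable_pt_lim f x y a b ->
  is_derive (fun u => f u y) x a /\ is_derive (fun v => f x v) y b.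
Proof.
  intro H. split; apply is_derive_Reals.
  - replace a with (a * 1 + b * 0) by ring.
    apply (derivable_pt_lim_comp_2d f (fun u => u) (fun _ => y) x a b 1 0 H).
    + apply derivable_pt_lim_id.
    + apply derivable_pt_lim_const.
  - replace b with (a * 0 + b * 1) by ring.
    apply (derivable_pt_lim_comp_2d f (fun _ => x) (fun v => v) y a b 0 1 H).
    + apply derivable_pt_lim_const.
    + apply derivable_pt_lim_id.
Qed.

Lemma continuity_of_differentiable (f : R -> R -> R) (x y a b : R) :
  differentiable_pt_lim f x y a b -> continuity_2d_pt f x y.
Proof. intro H. apply differentiable_continuity_pt. exists a, b; exact H. Qed.

Lemma locally_2d_comp (P : R -> R -> Prop) (X Y : R -> R -> R) (x y : R) :
  continuity_2d_pt X x y -> continuity_2d_pt Y x y ->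
  locally_2d P (X x y) (Y x y) -> locally_2d (fun u v => P (X u v) (Y u v)) x y.
Proof.
  intros HX HY [d Hd].
  generalize (locally_2d_and _ _ _ _ (HX d) (HY d)).
  apply locally_2d_impl, locally_2d_forall. intros u v [H1 H2]. apply Hd; auto.
Qed.

(** The existence of [P] and [Q] keeps gradients out of the statements: [(p, q)]
    is the gradient, and [a], [b] (resp. [c], [d]) are the partial derivatives
    of its first (resp. second) component. Frechet differentiability, unlike the
    existence of partial derivatives, is stable under changes of variables. *)
Definition jet2 (F : R -> R -> R) (x y p q a b c d : R) : Prop :=
  exists P Q : R -> R -> R,
    locally_2d (fun u v => differentiable_pt_lim F u v (P u v) (Q u v)) x y /\
    P x y = p /\ Q x y = q /\
    differentiable_pt_lim P x y a b /\ differentiable_pt_lim Q x y c d.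

Lemma jet2_continuity F x y p q a b c d :
  jet2 F x y p q a b c d -> continuity_2d_pt F x y.
Proof.
  intros (P & Q & H & _). apply locally_2d_singleton in H.
  eapply continuity_of_differentiable, H.
Qed.

Lemma jet2_ext F G x y p q a b c d :
  locally_2d (fun u v => F u v = G u v) x y ->
  jet2 F x y p q a b c d -> jet2 G x y p q a b c d.
Proof.
  intros HE (P & Q & H & H1 & H2 & H3 & H4).
  exists P, Q; repeat split; auto.
  revert H HE. intros [d1 H] [d2 HE].
  assert (Hp : 0 < Rmin d1 d2 / 2).
  { assert (0 < Rmin d1 d2) by (apply Rmin_glb_lt; apply cond_pos). lra. }
  exists (mkposreal _ Hp). intros u v Hu Hv; cbn [pos] in Hu, Hv.
  Rmin_bounds d1 d2.
  apply (differentiable_pt_lim_ext F).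
  - exists (mkposreal _ Hp). intros s t Hs Ht; cbn [pos] in Hs, Ht.
    apply HE.
    + replace (s - x) with ((s - u) + (u - x)) by ring.
      eapply Rle_lt_trans; [apply Rabs_triang|lra].
    + replace (t - y) with ((t - v) + (v - y)) by ring.
      eapply Rle_lt_trans; [apply Rabs_triang|lra].
  - apply H; lra.
Qed.

Lemma jet2_plus F G x y p q a b c d p' q' a' b' c' d' :
  jet2 F x y p q a b c d -> jet2 G x y p' q' a' b' c' d' ->
  jet2 (fun u v => F u v + G u v) x y
    (p + p') (q + q') (a + a') (b + b') (c + c') (d + d').
Proof.
  intros (P & Q & H & H1 & H2 & H3 & H4) (P' & Q' & H' & H1' & H2' & H3' & H4').
  exists (fun u v => P u v + P' u v), (fun u v => Q u v + Q' u v).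
  repeat split; try congruence.
  - generalize (locally_2d_and _ _ _ _ H H').
    apply locally_2d_impl, locally_2d_forall. intros u v [Hu Hv].
    apply differentiable_pt_lim_add; auto.
  - apply differentiable_pt_lim_add; auto.
  - apply differentiable_pt_lim_add; auto.
Qed.

Lemma jet2_opp F x y p q a b c d :
  jet2 F x y p q a b c d ->
  jet2 (fun u v => - F u v) x y (- p) (- q) (- a) (- b) (- c) (- d).
Proof.
  intros (P & Q & L & <- & <- & DP & DQ).
  assert (Dopp : forall f u v l m, differentiable_pt_lim f u v l m ->
             differentiable_pt_lim (fun u v => - f u v) u v (- l) (- m)).
  { intros f u v l m D eps. destruct (D eps) as [del Hdel]. exists del.
    intros s w Hs Hw. specialize (Hdel s w Hs Hw).
    match goal with |- Rabs ?e <= _ => match type of Hdel with Rabs ?e' <= _ =>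
      replace e with (- e') by ring end end.
    rewrite Rabs_Ropp. exact Hdel. }
  exists (fun u v => - P u v), (fun u v => - Q u v). repeat split; auto.
  revert L. apply locally_2d_impl, locally_2d_forall. intros u v. apply Dopp.
Qed.

Lemma jet2_fst (g g' : R -> R) (x y a : R) :
  locally x (fun u => is_derive g u (g' u)) -> is_derive g' x a ->
  jet2 (fun u _ => g u) x y (g' x) 0 a 0 0 0.
Proof.
  intros [d Hd] H.
  exists (fun u _ => g' u), (fun _ _ => 0). repeat split.
  - exists d. intros u v Hu Hv. apply differentiable_pt_lim_fst, Hd. exact Hu.
  - apply (differentiable_pt_lim_fst g'). exact H.
  - apply (differentiable_pt_lim_fst (fun _ => 0)). auto_derive; auto.
Qed.

Lemma jet2_comp F X Y x y p q a b c d x1 x2 x11 x12 x21 x22 y1 y2 y11 y12 y21 y22 :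
  jet2 F (X x y) (Y x y) p q a b c d ->
  jet2 X x y x1 x2 x11 x12 x21 x22 -> jet2 Y x y y1 y2 y11 y12 y21 y22 ->
  jet2 (fun u v => F (X u v) (Y u v)) x y (p * x1 + q * y1) (p * x2 + q * y2)
    ((a * x1 + b * y1) * x1 + p * x11 + ((c * x1 + d * y1) * y1 + q * y11))
    ((a * x2 + b * y2) * x1 + p * x12 + ((c * x2 + d * y2) * y1 + q * y12))
    ((a * x1 + b * y1) * x2 + p * x21 + ((c * x1 + d * y1) * y2 + q * y21))
    ((a * x2 + b * y2) * x2 + p * x22 + ((c * x2 + d * y2) * y2 + q * y22)).
Proof.
  intros HF HX HY.
  pose proof (jet2_continuity _ _ _ _ _ _ _ _ _ HX) as CX.
  pose proof (jet2_continuity _ _ _ _ _ _ _ _ _ HY) as CY.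
  destruct HF as (P & Q & H & <- & <- & HP & HQ).
  destruct HX as (X1 & X2 & HX & <- & <- & HX1 & HX2).
  destruct HY as (Y1 & Y2 & HY & <- & <- & HY1 & HY2).
  exists (fun u v => P (X u v) (Y u v) * X1 u v + Q (X u v) (Y u v) * Y1 u v),
         (fun u v => P (X u v) (Y u v) * X2 u v + Q (X u v) (Y u v) * Y2 u v).
  apply (locally_2d_comp _ X Y) in H; auto.
  pose proof (locally_2d_singleton _ _ _ HX) as DX.
  pose proof (locally_2d_singleton _ _ _ HY) as DY.
  split; [|repeat split].
  - generalize (locally_2d_and _ _ _ _ H (locally_2d_and _ _ _ _ HX HY)).
    apply locally_2d_impl, locally_2d_forall. intros u v (K1 & K2 & K3).
    apply (differentiable_pt_lim_comp F X Y); auto.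
  - apply differentiable_pt_lim_add.
    + apply (differentiable_pt_lim_mul (fun u v => P (X u v) (Y u v)) X1); auto.
      apply (differentiable_pt_lim_comp P X Y); auto.
    + apply (differentiable_pt_lim_mul (fun u v => Q (X u v) (Y u v)) Y1); auto.
      apply (differentiable_pt_lim_comp Q X Y); auto.
  - apply differentiable_pt_lim_add.
    + apply (differentiable_pt_lim_mul (fun u v => P (X u v) (Y u v)) X2); auto.
      apply (differentiable_pt_lim_comp P X Y); auto.
    + apply (differentiable_pt_lim_mul (fun u v => Q (X u v) (Y u v)) Y2); auto.
      apply (differentiable_pt_lim_comp Q X Y); auto.
Qed.

Lemma jet2_affine (a b c x y : R) :
  jet2 (fun u v => a * u + b * v + c) x y a b 0 0 0 0.
Proof.
  exists (fun _ _ => a), (fun _ _ => b). repeat split.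
  - apply locally_2d_forall. intros u v.
    assert (H : differentiable_pt_lim (fun u v => a * u + b * v + c) u v
                  (a + 0 + 0) (0 + b + 0)).
    { apply (differentiable_pt_lim_add (fun u v => a * u + b * v) (fun _ _ => c));
        [apply (differentiable_pt_lim_add (fun u _ => a * u) (fun _ v => b * v))|].
      - apply (differentiable_pt_lim_fst (fun u => a * u)). auto_derive; auto; ring.
      - apply (differentiable_pt_lim_snd (fun u => b * u)). auto_derive; auto; ring.
      - apply (differentiable_pt_lim_fst (fun _ => c)). auto_derive; auto. }
    rewrite !Rplus_0_r, Rplus_0_l in H. exact H.
  - apply (differentiable_pt_lim_fst (fun _ => a)). auto_derive; auto.
  - apply (differentiable_pt_lim_fst (fun _ => b)). auto_derive; auto.
Qed.

Lemma jet2_minus_const F k x y p q a b c d :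
  jet2 F x y p q a b c d -> jet2 (fun u v => F u v - k) x y p q a b c d.
Proof.
  intro J.
  pose proof (jet2_plus _ _ _ _ _ _ _ _ _ _ _ _ _ _ _ _ J (jet2_affine 0 0 (- k) x y)) as JP.
  rewrite !Rplus_0_r in JP. revert JP. apply jet2_ext, locally_2d_forall.
  intros u v. ring.
Qed.

Lemma jet2_comp_affine F a1 b1 c1 a2 b2 c2 x y p q a b c d :
  jet2 F (a1 * x + b1 * y + c1) (a2 * x + b2 * y + c2) p q a b c d ->
  jet2 (fun u v => F (a1 * u + b1 * v + c1) (a2 * u + b2 * v + c2)) x y
    (p * a1 + q * a2) (p * b1 + q * b2)
    ((a * a1 + b * a2) * a1 + (c * a1 + d * a2) * a2)
    ((a * b1 + b * b2) * a1 + (c * b1 + d * b2) * a2)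
    ((a * a1 + b * a2) * b1 + (c * a1 + d * a2) * b2)
    ((a * b1 + b * b2) * b1 + (c * b1 + d * b2) * b2).
Proof.
  intro H.
  pose proof (jet2_comp F _ _ x y _ _ _ _ _ _ _ _ _ _ _ _ _ _ _ _ _ _ H
    (jet2_affine a1 b1 c1 x y) (jet2_affine a2 b2 c2 x y)) as HC.
  rewrite !Rmult_0_r, !Rplus_0_r in HC. exact HC.
Qed.

(** The equations among the arguments leave the shape of the new jet to the
    caller, so that reflections, translations and the rotation of the axes get
    readable jets. *)
Lemma jet2_affine_change F G a1 b1 c1 a2 b2 c2 x y X Y p q a b c d p' q' a' b' c' d' :
  jet2 F X Y p q a b c d ->
  (forall u v, F (a1 * u + b1 * v + c1) (a2 * u + b2 * v + c2) = G u v) ->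
  a1 * x + b1 * y + c1 = X -> a2 * x + b2 * y + c2 = Y ->
  p * a1 + q * a2 = p' -> p * b1 + q * b2 = q' ->
  (a * a1 + b * a2) * a1 + (c * a1 + d * a2) * a2 = a' ->
  (a * b1 + b * b2) * a1 + (c * b1 + d * b2) * a2 = b' ->
  (a * a1 + b * a2) * b1 + (c * a1 + d * a2) * b2 = c' ->
  (a * b1 + b * b2) * b1 + (c * b1 + d * b2) * b2 = d' ->
  jet2 G x y p' q' a' b' c' d'.
Proof.
  intros H HG <- <- <- <- <- <- <- <-.
  eapply jet2_ext; [apply locally_2d_forall, HG|].
  apply jet2_comp_affine, H.
Qed.

Lemma jet2_reflect_fst F x y p q a b c d :
  jet2 F (- x) y p q a b c d ->
  jet2 (fun u v => F (- u) v) x y (- p) q a (- b) (- c) d.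
Proof.
  intro H.
  apply (jet2_affine_change F _ (-1) 0 0 0 1 0 x y _ _ _ _ _ _ _ _ _ _ _ _ _ _ H);
    try ring. intros u v; f_equal; ring.
Qed.

Lemma jet2_swap F x y p q a b c d :
  jet2 F y x p q a b c d -> jet2 (fun u v => F v u) x y q p d c b a.
Proof.
  intro H.
  apply (jet2_affine_change F _ 0 1 0 1 0 0 x y _ _ _ _ _ _ _ _ _ _ _ _ _ _ H);
    try ring. intros u v; f_equal; ring.
Qed.

Lemma jet2_translate F s t x y p q a b c d :
  jet2 F (s + x) (t + y) p q a b c d ->
  jet2 (fun u v => F (s + u) (t + v)) x y p q a b c d.
Proof.
  intro H.
  apply (jet2_affine_change F _ 1 0 s 0 1 t x y _ _ _ _ _ _ _ _ _ _ _ _ _ _ H);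
    try ring. intros u v; f_equal; ring.
Qed.

Lemma jet2_second_derivative_fst F x y p q a b c d :
  jet2 F x y p q a b c d -> second_derivative (fun u => F u y) x a.
Proof.
  intros (P & Q & H & _ & _ & HP & _). exists (fun u => P u y); split.
  - generalize (locally_2d_1d_const_y _ _ _ H). apply filter_imp.
    intros u Hu. exact (proj1 (differentiable_pt_lim_partials F u y _ _ Hu)).
  - exact (proj1 (differentiable_pt_lim_partials P x y a b HP)).
Qed.

Lemma jet2_has_laplacian F x y p q a b c d :
  jet2 F x y p q a b c d -> has_laplacian F x y (a + d).
Proof.
  intro J. exists a, d; repeat split.
  - exact (jet2_second_derivative_fst _ _ _ _ _ _ _ _ _ J).
  - apply jet2_swap, jet2_second_derivative_fst in J. exact J.
Qed.

(** Used along the diagonals, where a mixed second difference has second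
    derivative [4 (b + c)]. *)
Lemma jet2_directional F x y p q a b c d (e1 e2 : R) :
  jet2 F x y p q a b c d ->
  second_derivative (fun t => F (x + t * e1) (y + t * e2)) 0
    (a * e1 * e1 + (b + c) * e1 * e2 + d * e2 * e2).
Proof.
  intro J.
  apply (jet2_second_derivative_fst (fun t _ => F (x + t * e1) (y + t * e2)) 0 0
    (p * e1 + q * e2) 0 (a * e1 * e1 + (b + c) * e1 * e2 + d * e2 * e2) 0 0 0).
  apply (jet2_affine_change F _ e1 0 x e2 0 y 0 0 _ _ _ _ _ _ _ _ _ _ _ _ _ _ J); try ring.
  intros u v. f_equal; ring.
Qed.

(** Continuity of one partial derivative and existence of the other suffice. *)
Lemma differentiable_of_C1 (f : R -> R -> R) (x y : R) :
  locally_2d (fun u v => ex_derive (fun z => f z v) u) x y ->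
  ex_derive (fun z => f x z) y ->
  continuity_2d_pt (fun u v => Derive (fun z => f z v) u) x y ->
  differentiable_pt_lim f x y (Derive (fun z => f z y) x) (Derive (fun z => f x z) y).
Proof.
  intros H1 H2 H3.
  apply filterdiff_differentiable_pt_lim.
  apply (is_derive_filterdiff f x y (fun u v => Derive (fun z => f z v) u)).
  - apply locally_2d_locally in H1. revert H1. apply filter_imp.
    intros [u v] Hu. apply Derive_correct. exact Hu.
  - apply Derive_correct, H2.
  - apply continuity_2d_pt_filterlim in H3. exact H3.
Qed.

Lemma jet2_of_C2 (f : R -> R -> R) (x y : R) :
  locally_2d (fun u v => ex_diff_n f 2 u v) x y ->
  exists p q a b c d, jet2 f x y p q a b c d.
Proof.
  intro H.
  set (P := fun u v => Derive (fun z => f z v) u).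
  set (Q := fun u v => Derive (fun z => f u z) v).
  assert (HL : forall g, locally_2d (fun u v => ex_diff_n g 1 u v) x y ->
     differentiable_pt_lim g x y (Derive (fun z => g z y) x) (Derive (fun z => g x z) y)).
  { intros g Hg. apply differentiable_of_C1.
    - revert Hg. apply locally_2d_impl, locally_2d_forall.
      intros u v Hg. apply Hg.
    - apply locally_2d_singleton in Hg. apply Hg.
    - apply locally_2d_singleton in Hg. destruct Hg as (_ & _ & _ & Hg & _). apply Hg. }
  exists (P x y), (Q x y), (Derive (fun z => P z y) x), (Derive (fun z => P x z) y),
    (Derive (fun z => Q z y) x), (Derive (fun z => Q x z) y).
  exists P, Q; split; [|repeat split].
  - revert H. apply locally_2d_impl_strong, locally_2d_forall. intros u v H.
    apply differentiable_of_C1.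
    + revert H. apply locally_2d_impl, locally_2d_forall. intros s t K. apply K.
    + apply locally_2d_singleton in H. apply H.
    + apply locally_2d_singleton in H. destruct H as (_ & _ & _ & H & _). apply H.
  - apply HL. revert H. apply locally_2d_impl, locally_2d_forall.
    intros u v (_ & _ & _ & H & _). exact H.
  - apply HL. revert H. apply locally_2d_impl, locally_2d_forall.
    intros u v (_ & _ & _ & _ & H). exact H.
Qed.

(** * Closed sets of the plane *)

Ltac continuity_2d :=
  repeat (first [apply continuity_2d_pt_plus | apply continuity_2d_pt_minus
    | apply continuity_2d_pt_mult | apply continuity_2d_pt_opp
    | apply continuity_2d_pt_const
    | apply continuity_2d_pt_id1 | apply continuity_2d_pt_id2]).

Lemma closed_2d_ge0 (g : R -> R -> R) :
  (forall x y, continuity_2d_pt g x y) -> closed_2d (fun x y => 0 <= g x y).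
Proof.
  intros Hg x y Hn. assert (He : 0 < - g x y) by lra.
  generalize (Hg x y (mkposreal _ He)).
  apply locally_2d_impl, locally_2d_forall. intros u v H.
  cbn [pos] in H. apply Rabs_def2 in H. lra.
Qed.

Lemma locally_2d_gt0 (g : R -> R -> R) (x y : R) :
  continuity_2d_pt g x y -> 0 < g x y -> locally_2d (fun u v => 0 < g u v) x y.
Proof.
  intros Hg He. generalize (Hg (mkposreal _ He)).
  apply locally_2d_impl, locally_2d_forall. intros u v H.
  cbn [pos] in H. apply Rabs_def2 in H. lra.
Qed.

Lemma closed_2d_and (K H : R -> R -> Prop) :
  closed_2d K -> closed_2d H -> closed_2d (fun x y => K x y /\ H x y).
Proof.
  intros CK CH x y Hn. destruct (classic (K x y)) as [Hk|Hk].
  - assert (Hh : ~ H x y) by tauto. generalize (CH x y Hh).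
    apply locally_2d_impl, locally_2d_forall. tauto.
  - generalize (CK x y Hk). apply locally_2d_impl, locally_2d_forall. tauto.
Qed.

Definition rectangle (a b c d x y : R) : Prop := (a <= x <= b) /\ (c <= y <= d).

Lemma closed_rectangle a b c d : closed_2d (rectangle a b c d).
Proof.
  intros x y Hn. unfold rectangle in *.
  assert (HC : closed_2d (fun x y => (0 <= x - a /\ 0 <= b - x) /\ 0 <= y - c /\ 0 <= d - y)).
  { repeat apply closed_2d_and; apply closed_2d_ge0; intros; continuity_2d. }
  apply locally_2d_impl with (2 := HC x y ltac:(lra)), locally_2d_forall.
  intros u v H H'. apply H. lra.
Qed.

Lemma bounded_rectangle a b c d : bounded_2d (rectangle a b c d).
Proof.
  exists (Rabs a + Rabs b + Rabs c + Rabs d). intros x y [H1 H2].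
  pose proof (Rle_abs a); pose proof (Rle_abs b); pose proof (Rle_abs c); pose proof (Rle_abs d).
  pose proof (Rle_abs (-a)); pose proof (Rle_abs (-b)); pose proof (Rle_abs (-c)); pose proof (Rle_abs (-d)).
  rewrite Rabs_Ropp in *.
  split; apply Rabs_le; lra.
Qed.

Lemma interior_rectangle a b c d x y :
  a < x < b -> c < y < d -> locally_2d (rectangle a b c d) x y.
Proof.
  intros H1 H2.
  set (e := Rmin (Rmin (x - a) (b - x)) (Rmin (y - c) (d - y))).
  assert (He : 0 < e) by (repeat apply Rmin_glb_lt; lra).
  exists (mkposreal _ He). cbn [pos]. intros u v Hu Hv.
  apply Rabs_def2 in Hu; apply Rabs_def2 in Hv.
  pose proof (Rmin_l (Rmin (x - a) (b - x)) (Rmin (y - c) (d - y))).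
  pose proof (Rmin_r (Rmin (x - a) (b - x)) (Rmin (y - c) (d - y))).
  Rmin_bounds (x - a) (b - x).
  Rmin_bounds (y - c) (d - y).
  unfold rectangle; fold e in H, H0; lra.
Qed.

(** * Gradient estimate *)

Definition laplacian_bounded (F : R -> R -> R) (N x y : R) : Prop :=
  exists p q a b c d, jet2 F x y p q a b c d /\ Rabs (a + d) <= N.

Definition bounded_on_square (F : R -> R -> R) (cx cy r M N : R) : Prop :=
  forall x y, Rabs (x - cx) <= r -> Rabs (y - cy) <= r ->
    Rabs (F x y) <= M /\ laplacian_bounded F N x y.

(** The difference of [F] and its mirror image vanishes on the axis [x = 0] and
    has Laplacian at most [2 N] in absolute value. It lies below the barrier [psi], whose first
    summand is harmonic and takes care of the boundary values, while the second
    one has Laplacian [- 4 N]. The linear growth of [psi] off the axis is the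
    bound. *)
Lemma reflection_difference_le F r M N :
  0 < r -> 0 < N -> bounded_on_square F 0 0 r M N ->
  forall x, 0 <= x <= r -> F x 0 - F (- x) 0 <= (4 * M / r + 2 * N * r) * x.
Proof.
  intros Hr HN HF.
  set (psi := fun x y : R => 2 * M / r ^ 2 * (y ^ 2 + x * (2 * r - x)) + 2 * N * (x * (r - x))).
  assert (HF' : forall x y, rectangle 0 r (- r) r x y ->
     Rabs (F x y) <= M /\ Rabs (F (- x) y) <= M /\
     laplacian_bounded F N x y /\ laplacian_bounded F N (- x) y).
  { intros x y [H1 H2].
    destruct (HF x y) as [A1 A2]; [rewrite Rminus_0_r; apply Rabs_le; lra ..|].
    destruct (HF (- x) y) as [A3 A4]; [rewrite Rminus_0_r; apply Rabs_le; lra ..|].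
    auto. }
  assert (HM : 0 <= M).
  { destruct (HF' 0 0) as [A _]; [split; lra|].
    eapply Rle_trans; [apply Rabs_pos|exact A]. }
  assert (HM2 : 0 <= 2 * M / r ^ 2).
  { apply Rmult_le_pos; [lra|]. left. apply Rinv_0_lt_compat, pow_lt, Hr. }
  assert (EM : 2 * M / r ^ 2 * (r * r) = 2 * M) by (field; lra).
  assert (HK : forall x y, rectangle 0 r (- r) r x y ->
     F x y + (-1) * F (- x) y + (-1) * psi x y <= 0).
  { apply (maximum_principle (rectangle 0 r (- r) r)
      (fun x y => F x y + (-1) * F (- x) y + (-1) * psi x y)).
    - apply closed_rectangle.
    - apply bounded_rectangle.
    - intros x y Hxy.
      destruct (HF' x y Hxy) as (_ & _ & (p & q & a & b & c & d & J & _)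
        & (p' & q' & a' & b' & c' & d' & J' & _)).
      apply jet2_reflect_fst, jet2_continuity in J'. apply jet2_continuity in J.
      apply continuity_2d_pt_plus; [apply continuity_2d_pt_plus|].
      + exact J.
      + apply continuity_2d_pt_mult; [apply continuity_2d_pt_const|exact J'].
      + apply continuity_2d_pt_mult; [apply continuity_2d_pt_const|].
        unfold psi, pow.
        continuity_2d.
    - intros x y Hxy.
      destruct (HF' x y Hxy) as (B1 & B2 & (p & q & a & b & c & d & J & HL)
        & (p' & q' & a' & b' & c' & d' & J' & HL')).
      destruct Hxy as [Hx Hy].
      apply Rabs_le_between in B1, B2, HL, HL'.
      assert (Hx1 : 0 <= N * (x * (r - x))) by (repeat apply Rmult_le_pos; lra).
      destruct (Req_dec x 0) as [->|Hx0].
      { left. unfold psi. rewrite Ropp_0.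
        assert (0 <= 2 * M / r ^ 2 * y ^ 2) by (apply Rmult_le_pos; [lra|apply pow2_ge_0]).
        replace (y ^ 2 + 0 * (2 * r - 0)) with (y ^ 2) by ring. lra. }
      destruct (Req_dec x r) as [->|Hxr].
      { left. unfold psi.
        assert (0 <= 2 * M / r ^ 2 * y ^ 2) by (apply Rmult_le_pos; [lra|apply pow2_ge_0]).
        replace (y ^ 2 + r * (2 * r - r)) with (y ^ 2 + r * r) by ring. lra. }
      assert (Hx2 : 0 <= 2 * M / r ^ 2 * (x * (2 * r - x))) by (apply Rmult_le_pos; [exact HM2 | apply Rmult_le_pos; lra]).
      destruct (Req_dec (y * y) (r * r)) as [Hyr|Hyr].
      { left. unfold psi.
        replace (y ^ 2 + x * (2 * r - x)) with (r * r + x * (2 * r - x)) by (rewrite <- Hyr; ring).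
        lra. }
      right. split.
      { apply interior_rectangle; [lra|].
        assert (y <> r) by (intros ->; apply Hyr; ring).
        assert (y <> - r) by (intros ->; apply Hyr; ring). lra. }
      exists ((a + d) + (-1) * (a' + d') + (-1) * (- 4 * N)). split; [|lra].
      apply has_laplacian_plus; [apply has_laplacian_plus|].
      + eapply jet2_has_laplacian, J.
      + apply has_laplacian_scal.
        apply jet2_reflect_fst, jet2_has_laplacian in J'. exact J'.
      + apply has_laplacian_scal. unfold psi.
        exists (- (4 * M / r ^ 2) - 4 * N), (4 * M / r ^ 2); repeat split.
        * apply second_derivative_intro with
            (fun x => 2 * M / r ^ 2 * (2 * r - 2 * x) + 2 * N * (r - 2 * x)).
          { intro u. auto_derive; [lra|]. field; lra. }
          { auto_derive; [lra|]. field; lra. }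
        * apply second_derivative_intro with (fun y => 2 * M / r ^ 2 * (2 * y)).
          { intro u. auto_derive; [lra|]. field; lra. }
          { auto_derive; [lra|]. field; lra. }
        * field; lra. }
  intros x Hx.
  specialize (HK x 0 ltac:(split; lra)). unfold psi in HK.
  assert (E : 2 * M / r ^ 2 * (0 ^ 2 + x * (2 * r - x)) + 2 * N * (x * (r - x))
     = (4 * M / r + 2 * N * r) * x - (2 * M / r ^ 2 * (x * x) + 2 * N * (x * x)))
    by (field; lra).
  assert (0 <= 2 * M / r ^ 2 * (x * x)) by (apply Rmult_le_pos; nra).
  assert (0 <= 2 * N * (x * x)) by nra.
  lra.
Qed.

Lemma bounded_on_square_translate F cx cy r M N :
  bounded_on_square F cx cy r M N ->
  bounded_on_square (fun u v => F (cx + u) (cy + v)) 0 0 r M N.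
Proof.
  intros H x y Hx Hy. rewrite Rminus_0_r in Hx, Hy.
  destruct (H (cx + x) (cy + y)) as [H1 (p & q & a & b & c & d & J & HL)].
  - replace (cx + x - cx) with x by ring; exact Hx.
  - replace (cy + y - cy) with y by ring; exact Hy.
  - split; [exact H1|]. exists p, q, a, b, c, d. split; [|exact HL].
    apply jet2_translate, J.
Qed.

Lemma bounded_on_square_swap F cx cy r M N :
  bounded_on_square F cx cy r M N -> bounded_on_square (fun u v => F v u) cy cx r M N.
Proof.
  intros H x y Hx Hy.
  destruct (H y x Hy Hx) as [H1 (p & q & a & b & c & d & J & HL)].
  split; [exact H1|]. exists q, p, d, c, b, a. split.
  - apply jet2_swap, J.
  - rewrite Rplus_comm. exact HL.
Qed.

(** An interior gradient estimate stated for differences: it is used both for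
    finite displacements and, in the limit, for derivatives. *)
Lemma horizontal_difference F cx cy r M N :
  0 < r -> 0 < N -> bounded_on_square F cx cy r M N ->
  forall h, Rabs h <= r ->
    Rabs (F (cx + h) cy - F (cx - h) cy) <= (4 * M / r + 2 * N * r) * Rabs h.
Proof.
  intros Hr HN HF.
  assert (HP : forall h, 0 <= h <= r ->
     F (cx + h) cy - F (cx - h) cy <= (4 * M / r + 2 * N * r) * h).
  { intros h Hh.
    pose proof (reflection_difference_le _ r M N Hr HN (bounded_on_square_translate _ _ _ _ _ _ HF) h Hh) as H.
    cbv beta in H. rewrite Rplus_0_r in H. exact H. }
  assert (HQ : forall h, 0 <= h <= r ->
     F (cx - h) cy - F (cx + h) cy <= (4 * M / r + 2 * N * r) * h).
  { intros h Hh.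
    assert (HR : bounded_on_square (fun u v => F (cx + - u) (cy + v)) 0 0 r M N).
    { intros x y Hx Hy. rewrite Rminus_0_r in Hx, Hy.
      destruct (bounded_on_square_translate _ _ _ _ _ _ HF (- x) y) as
        [H1 (p & q & a & b & c & d & J & HL)].
      - rewrite Rminus_0_r, Rabs_Ropp; exact Hx.
      - rewrite Rminus_0_r; exact Hy.
      - split; [exact H1|]. apply jet2_reflect_fst in J.
        do 6 eexists. split; [exact J|exact HL]. }
    pose proof (reflection_difference_le _ r M N Hr HN HR h Hh) as H.
    cbv beta in H. rewrite Rplus_0_r, Ropp_involutive in H. exact H. }
  intros h Hh.
  destruct (Rle_or_lt 0 h) as [H0|H0].
  - rewrite (Rabs_pos_eq h) in * by lra. specialize (HP h ltac:(lra)); specialize (HQ h ltac:(lra)).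
    apply Rabs_le; lra.
  - rewrite (Rabs_left h) in * by lra. specialize (HP (- h) ltac:(lra)); specialize (HQ (- h) ltac:(lra)).
    replace (cx + - h) with (cx - h) in * by ring. replace (cx - - h) with (cx + h) in * by ring.
    apply Rabs_le; lra.
Qed.

Lemma vertical_difference F cx cy r M N :
  0 < r -> 0 < N -> bounded_on_square F cx cy r M N ->
  forall h, Rabs h <= r ->
    Rabs (F cx (cy + h) - F cx (cy - h)) <= (4 * M / r + 2 * N * r) * Rabs h.
Proof.
  intros Hr HN HF.
  apply (horizontal_difference (fun u v => F v u) cy cx r M N Hr HN
    (bounded_on_square_swap _ _ _ _ _ _ HF)).
Qed.

(** * Estimate of the second derivatives *)

(** The product [x * Rpower x alpha] stands for [x^(1 + alpha)]: it vanishes at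
    [0], whereas [Rpower 0 (1 + alpha)] is [1]. *)
Lemma continuity_pt_mul_Rpower (alpha x : R) :
  0 < alpha -> 0 <= x -> continuity_pt (fun x => x * Rpower x alpha) x.
Proof.
  intros Ha Hx. destruct (Rle_lt_or_eq_dec _ _ Hx) as [H|<-].
  - apply derivable_continuous_pt.
    eexists. apply (derivable_pt_lim_mult (fun x => x) (fun x => Rpower x alpha)).
    + apply derivable_pt_lim_id.
    + apply derivable_pt_lim_power, H.
  - intros eps Heps. exists (Rmin eps 1). split; [apply Rmin_glb_lt; lra|].
    intros u [_ Hu]. unfold Rlimit.dist, R_met, Rdist in *; simpl in *.
    rewrite Rminus_0_r in Hu. rewrite Rmult_0_l, Rminus_0_r.
    Rmin_bounds eps 1.
    rewrite Rabs_mult, (Rabs_pos_eq (Rpower u alpha)) by (left; apply Rpower_pos).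
    assert (Hp : Rpower u alpha <= 1).
    { destruct (Rlt_or_le 0 u) as [Hu0|Hu0].
      - rewrite Rabs_pos_eq in Hu by lra. apply Rpower_le_1; lra.
      - unfold Rpower, ln. destruct (Rlt_dec 0 u) as [H'|H']; [exfalso; lra|].
        rewrite Rmult_0_r, exp_0. lra. }
    pose proof (Rabs_pos u). pose proof (Rpower_pos u alpha). nra.
Qed.

Lemma second_derivative_mul_Rpower (alpha x : R) : 0 < x ->
  second_derivative (fun x => x * Rpower x alpha) x
    ((1 + alpha) * (alpha * Rpower x (alpha - 1))).
Proof.
  intro Hx. exists (fun x => (1 + alpha) * Rpower x alpha). split.
  - exists (mkposreal _ Hx). intros u Hu.
    assert (Hu0 : 0 < u).
    { change (Rabs (u - x) < x) in Hu. apply Rabs_def2 in Hu. lra. }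
    apply is_derive_Reals.
    replace ((1 + alpha) * Rpower u alpha) with
      (1 * Rpower u alpha + u * (alpha * Rpower u (alpha - 1)))
      by (rewrite <- (Rpower_pred u alpha Hu0); ring).
    apply (derivable_pt_lim_mult (fun x => x) (fun x => Rpower x alpha)).
    + apply derivable_pt_lim_id.
    + apply derivable_pt_lim_power, Hu0.
  - apply (is_derive_scal (fun x => Rpower x alpha) x (1 + alpha)).
    apply is_derive_Reals, derivable_pt_lim_power, Hx.
Qed.

(** The Hoelder condition on the Laplacian [f] is only imposed between a point
    and its mirror images in the two axes: this is what the second difference of
    [F] sees. *)
Definition holder_controlled (F f : R -> R -> R) (alpha M N H : R) : Prop :=
  forall x y, Rabs x <= 1 -> Rabs y <= 1 ->
    (exists p q a b c d, jet2 F x y p q a b c d /\ a + d = f x y) /\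
    Rabs (F x y) <= M /\ Rabs (f x y) <= N /\
    (0 < x -> Rabs (f x y - f (- x) y) <= H * Rpower x alpha) /\
    (0 < y -> Rabs (f x y - f x (- y)) <= H * Rpower y alpha).

Definition mixed_difference (F : R -> R -> R) (x y : R) : R :=
  F x y - F (- x) y - F x (- y) + F (- x) (- y).

(** On the side [x = 1/2] the mixed difference is a sum of two vertical
    differences, hence at most linear in the distance to the axis by the
    gradient estimate; there it is therefore also bounded by a multiple of [x *
    y]. *)
Lemma mixed_difference_boundary F f alpha M N H : 0 < N ->
  holder_controlled F f alpha M N H ->
  forall y, 0 <= y <= / 2 -> mixed_difference F (/ 2) y <= (16 * M + 2 * N) * y.
Proof.
  intros HN HF y Hy.
  assert (HS : forall c, Rabs c = / 2 -> bounded_on_square F c 0 (/ 2) M N).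
  { intros c Hc u v Hu Hv. rewrite Rminus_0_r in Hv.
    assert (Hu' : Rabs u <= 1).
    { replace u with ((u - c) + c) by ring.
      eapply Rle_trans; [apply Rabs_triang|lra]. }
    destruct (HF u v Hu' ltac:(lra)) as ((p & q & a & b & c' & d & J & E) & B1 & B2 & _).
    split; [exact B1|]. exists p, q, a, b, c', d. split; [exact J|]. rewrite E; exact B2. }
  assert (E1 : Rabs (/ 2) = / 2) by (apply Rabs_pos_eq; lra).
  assert (E2 : Rabs (- / 2) = / 2) by (rewrite Rabs_Ropp; exact E1).
  assert (Hy' : Rabs y = y) by (apply Rabs_pos_eq; lra).
  pose proof (vertical_difference F (/ 2) 0 (/ 2) M N ltac:(lra) HN (HS _ E1) y ltac:(lra)) as V1.
  pose proof (vertical_difference F (- / 2) 0 (/ 2) M N ltac:(lra) HN (HS _ E2) y ltac:(lra)) as V2.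
  rewrite Hy' in V1, V2. rewrite !Rplus_0_l, !Rminus_0_l in V1, V2.
  apply Rabs_le_between in V1, V2. unfold mixed_difference.
  replace (4 * M / / 2) with (8 * M) in V1, V2 by field. lra.
Qed.

Lemma holder_controlled_swap F f alpha M N H :
  holder_controlled F f alpha M N H ->
  holder_controlled (fun u v => F v u) (fun u v => f v u) alpha M N H.
Proof.
  intros HF x y Hx Hy.
  destruct (HF y x Hy Hx) as ((p & q & a & b & c & d & J & E) & B1 & B2 & B3 & B4).
  repeat split; auto.
  exists q, p, d, c, b, a. split; [apply jet2_swap, J|]. rewrite <- E; ring.
Qed.

Lemma holder_controlled_reflect F f alpha M N H :
  holder_controlled F f alpha M N H ->
  holder_controlled (fun u v => F (- u) v) (fun u v => f (- u) v) alpha M N H.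
Proof.
  intros HF x y Hx Hy.
  destruct (HF (- x) y ltac:(rewrite Rabs_Ropp; exact Hx) Hy)
    as ((p & q & a & b & c & d & J & E) & B1 & B2 & _ & B4).
  destruct (HF x y Hx Hy) as (_ & _ & _ & B3 & _).
  repeat split; auto.
  - apply jet2_reflect_fst in J. do 6 eexists. split; [exact J|exact E].
  - intro H0. rewrite Ropp_involutive, Rabs_minus_sym. auto.
Qed.

(** The mixed difference vanishes on both axes, and by the Hoelder condition its
    Laplacian is at most [2 H min (x, y)^alpha]. The barrier [A x y - B (x^(1 +
    alpha) y + x y^(1 + alpha))] has Laplacian [- B alpha (1 + alpha) (x^(alpha
    - 1) y + x y^(alpha - 1))], which dominates this. The bound [x y] is
    quadratic at the corner: this is a Schauder estimate. *)
Lemma mixed_difference_le F f alpha M N H :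
  0 < alpha <= 1 -> 0 < N -> 0 < H -> holder_controlled F f alpha M N H ->
  forall x y, 0 <= x <= / 2 -> 0 <= y <= / 2 ->
    mixed_difference F x y <= (32 * M + 4 * N + 6 * H / alpha) * (x * y).
Proof.
  intros Ha HN HH HF.
  set (B := 3 * H / alpha). set (A0 := 32 * M + 4 * N).
  assert (EB : 6 * H / alpha = 2 * B) by (unfold B; field; lra).
  rewrite EB. fold A0.
  assert (HB : 0 < B).
  { unfold B. apply Rmult_lt_0_compat; [lra|apply Rinv_0_lt_compat; lra]. }
  assert (HBa : B * alpha = 3 * H) by (unfold B; field; lra).
  set (p := fun x => x * Rpower x alpha).
  assert (Hp : forall x, 0 <= x <= / 2 -> 0 <= p x <= x).
  { intros x Hx. unfold p. destruct (Req_dec x 0) as [->|H0]; [rewrite Rmult_0_l; lra|].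
    pose proof (Rpower_pos x alpha).
    pose proof (Rpower_le_1 x alpha ltac:(lra) ltac:(lra)). nra. }
  set (Phi := mixed_difference F).
  assert (HF' : forall x y, rectangle 0 (/ 2) 0 (/ 2) x y ->
    exists L, continuity_2d_pt Phi x y /\ has_laplacian Phi x y L /\
      (0 < x -> - (2 * H * Rpower x alpha) <= L) /\
      (0 < y -> - (2 * H * Rpower y alpha) <= L)).
  { intros x y [H1 H2].
    assert (Bx : Rabs x <= 1) by (apply Rabs_le; lra).
    assert (By : Rabs y <= 1) by (apply Rabs_le; lra).
    assert (Bx' : Rabs (- x) <= 1) by (apply Rabs_le; lra).
    assert (By' : Rabs (- y) <= 1) by (apply Rabs_le; lra).
    destruct (HF x y Bx By) as ((p1 & q1 & a1 & b1 & c1 & d1 & J1 & E1) & _ & _ & X1 & Y1).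
    destruct (HF (-x) y Bx' By) as ((p2 & q2 & a2 & b2 & c2 & d2 & J2 & E2) & _ & _ & _ & Y2).
    destruct (HF x (-y) Bx By') as ((p3 & q3 & a3 & b3 & c3 & d3 & J3 & E3) & _ & _ & X3 & _).
    destruct (HF (-x) (-y) Bx' By') as ((p4 & q4 & a4 & b4 & c4 & d4 & J4 & E4) & _ & _ & _ & _).
    apply jet2_reflect_fst in J2.
    apply (jet2_affine_change F (fun u v => F u (- v)) 1 0 0 0 (-1) 0 x y _ _ _ _ _ _ _ _
             p3 (- q3) a3 (- b3) (- c3) d3) in J3; try ring;
      [|intros; f_equal; ring].
    apply (jet2_affine_change F (fun u v => F (- u) (- v)) (-1) 0 0 0 (-1) 0 x y _ _ _ _ _ _ _ _
             (- p4) (- q4) a4 b4 c4 d4) in J4; try ring;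
      [|intros; f_equal; ring].
    exists (f x y - f (- x) y - f x (- y) + f (- x) (- y)). repeat split.
    - apply jet2_continuity in J1, J2, J3, J4. unfold Phi, mixed_difference.
      apply continuity_2d_pt_plus; auto. repeat apply continuity_2d_pt_minus; auto.
    - apply jet2_has_laplacian in J1, J2, J3, J4.
      rewrite E1 in J1; rewrite E2 in J2; rewrite E3 in J3; rewrite E4 in J4.
      apply has_laplacian_scal with (k := -1) in J2, J3.
      pose proof (has_laplacian_plus _ _ _ _ _ _
        (has_laplacian_plus _ _ _ _ _ _ (has_laplacian_plus _ _ _ _ _ _ J1 J2) J3) J4) as J.
      replace (f x y - f (- x) y - f x (- y) + f (- x) (- y)) with
        (f x y + -1 * f (- x) y + -1 * f x (- y) + f (- x) (- y)) by ring.
      revert J. apply has_laplacian_ext. intros u v. unfold Phi, mixed_difference. ring.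
    - intro Hx. specialize (X1 Hx); specialize (X3 Hx).
      apply Rabs_le_between in X1, X3. lra.
    - intro Hy. specialize (Y1 Hy); specialize (Y2 Hy).
      apply Rabs_le_between in Y1, Y2. lra. }
  set (psi := fun x y => (A0 + 2 * B) * (x * y) - B * (p x * y) - B * (x * p y)).
  assert (HK : forall x y, rectangle 0 (/ 2) 0 (/ 2) x y ->
                 Phi x y + (-1) * psi x y <= 0).
  { apply (maximum_principle (rectangle 0 (/ 2) 0 (/ 2))
             (fun x y => Phi x y + (-1) * psi x y)).
    - apply closed_rectangle.
    - apply bounded_rectangle.
    - intros x y Hxy. destruct (HF' x y Hxy) as (L & HC & _).
      destruct Hxy as [Hx Hy].
      apply continuity_2d_pt_plus; [exact HC|].
      apply continuity_2d_pt_mult; [apply continuity_2d_pt_const|].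
      assert (Cx : continuity_2d_pt (fun u _ => p u) x y).
      { apply (continuity_1d_2d_pt_comp p (fun u _ => u));
          [apply continuity_pt_mul_Rpower; lra|apply continuity_2d_pt_id1]. }
      assert (Cy : continuity_2d_pt (fun _ v => p v) x y).
      { apply (continuity_1d_2d_pt_comp p (fun _ v => v));
          [apply continuity_pt_mul_Rpower; lra|apply continuity_2d_pt_id2]. }
      unfold psi. clearbody p. continuity_2d; assumption.
    - intros x y Hxy. destruct (HF' x y Hxy) as (L & _ & HL & HLx & HLy).
      destruct Hxy as [Hx Hy].
      pose proof (Hp x Hx) as Hpx. pose proof (Hp y Hy) as Hpy.
      assert (Hpsi : A0 * (x * y) <= psi x y).
      { unfold psi.
        assert (p x * y <= x * y) by (apply Rmult_le_compat_r; lra).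
        assert (x * p y <= x * y) by (apply Rmult_le_compat_l; lra).
        nra. }
      destruct (Req_dec x 0) as [->|Hx0].
      { left. unfold Phi, mixed_difference. rewrite Ropp_0. lra. }
      destruct (Req_dec y 0) as [->|Hy0].
      { left. unfold Phi, mixed_difference. rewrite Ropp_0. lra. }
      destruct (Req_dec x (/ 2)) as [->|Hx1].
      { left. pose proof (mixed_difference_boundary F f alpha M N H HN HF y Hy).
        unfold Phi, A0 in *. lra. }
      destruct (Req_dec y (/ 2)) as [->|Hy1].
      { left. pose proof (mixed_difference_boundary _ _ alpha M N H HN
                            (holder_controlled_swap _ _ _ _ _ _ HF) x Hx).
        unfold Phi, mixed_difference, A0 in *. lra. }
      right. split; [apply interior_rectangle; lra|].
      set (p2 := fun x => (1 + alpha) * (alpha * Rpower x (alpha - 1))).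
      exists (L + (-1) * (- B * (p2 x * y + x * p2 y))). split.
      + apply has_laplacian_plus; [exact HL|]. apply has_laplacian_scal.
        assert (Lin : forall k z, second_derivative (fun z => k * z) z 0).
        { intros k z. apply second_derivative_intro with (fun _ => k).
          - intro u. auto_derive; auto; ring.
          - auto_derive; auto. }
        pose proof (second_derivative_mul_Rpower alpha x ltac:(lra)) as Sx. fold (p2 x) in Sx.
        pose proof (second_derivative_mul_Rpower alpha y ltac:(lra)) as Sy. fold (p2 y) in Sy.
        exists (0 + (- B * y) * p2 x), (0 + (- B * x) * p2 y). repeat split.
        * eapply second_derivative_ext; [|exact (second_derivative_plus _ _ _ _ _
             (Lin ((A0 + 2 * B) * y - B * p y) x)
             (second_derivative_scal (- B * y) _ _ _ Sx))].
          intro u. unfold psi, p. ring.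
        * eapply second_derivative_ext; [|exact (second_derivative_plus _ _ _ _ _
             (Lin ((A0 + 2 * B) * x - B * p x) y)
             (second_derivative_scal (- B * x) _ _ _ Sy))].
          intro u. unfold psi, p. ring.
        * ring.
      + pose proof (Rpower_pos x (alpha - 1)). pose proof (Rpower_pos y (alpha - 1)).
        assert (Hp2 : forall z, 0 < Rpower z (alpha - 1) ->
                   alpha * Rpower z (alpha - 1) <= p2 z).
        { intros z Hz. unfold p2. assert (0 < alpha * Rpower z (alpha - 1)) by nra. nra. }
        pose proof (Hp2 x ltac:(assumption)) as P2x.
        pose proof (Hp2 y ltac:(assumption)) as P2y.
        assert (Qx : 0 < alpha * Rpower x (alpha - 1)) by nra.
        assert (Qy : 0 < alpha * Rpower y (alpha - 1)) by nra.
        pose proof (Rpower_pred x alpha ltac:(lra)) as Ex.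
        pose proof (Rpower_pred y alpha ltac:(lra)) as Ey.
        pose proof (Rpower_pos x alpha). pose proof (Rpower_pos y alpha).
        specialize (HLx ltac:(lra)). specialize (HLy ltac:(lra)).
        (* the barrier term belonging to the smaller coordinate suffices *)
        destruct (Rle_or_lt x y) as [Hc|Hc].
        * assert (alpha * Rpower x alpha <= p2 x * y).
          { rewrite <- Ex. apply Rle_trans with (alpha * Rpower x (alpha - 1) * y); nra. }
          assert (0 <= x * p2 y) by nra.
          assert (B * (alpha * Rpower x alpha) <= B * (p2 x * y + x * p2 y)) by nra.
          replace (B * (alpha * Rpower x alpha)) with (3 * H * Rpower x alpha) in *
            by (rewrite <- HBa; ring).
          nra.
        * assert (alpha * Rpower y alpha <= x * p2 y).
          { rewrite <- Ey. apply Rle_trans with (x * (alpha * Rpower y (alpha - 1))); nra. }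
          assert (0 <= p2 x * y) by nra.
          assert (B * (alpha * Rpower y alpha) <= B * (p2 x * y + x * p2 y)) by nra.
          replace (B * (alpha * Rpower y alpha)) with (3 * H * Rpower y alpha) in *
            by (rewrite <- HBa; ring).
          nra. }
  intros x y Hx Hy. specialize (HK x y (conj Hx Hy)). fold Phi.
  assert (psi x y <= (A0 + 2 * B) * (x * y)).
  { unfold psi. pose proof (Hp x Hx). pose proof (Hp y Hy).
    assert (0 <= p x * y) by (apply Rmult_le_pos; lra).
    assert (0 <= x * p y) by (apply Rmult_le_pos; lra). nra. }
  lra.
Qed.

(** The mixed difference along the diagonal is [O (t^2)] with an explicit
    constant and has second derivative [4 (b + c)] at [0]; the second derivative
    test bounds the latter. *)
Lemma mixed_derivative_bound F f alpha M N H p q a b c d :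
  0 < alpha <= 1 -> 0 < N -> 0 < H -> holder_controlled F f alpha M N H ->
  jet2 F 0 0 p q a b c d ->
  Rabs (b + c) <= 16 * M + 2 * N + 3 * H / alpha.
Proof.
  intros Ha HN HH HF J.
  set (A := 32 * M + 4 * N + 6 * H / alpha).
  assert (EA : 16 * M + 2 * N + 3 * H / alpha = A / 2) by (unfold A; field; lra).
  rewrite EA.
  assert (HP := mixed_difference_le F f alpha M N H Ha HN HH HF).
  assert (HM := mixed_difference_le _ _ alpha M N H Ha HN HH
                  (holder_controlled_reflect _ _ _ _ _ _ HF)).
  assert (Hdiag : forall t, Rabs t <= / 2 -> Rabs (mixed_difference F t t) <= A * (t * t)).
  { assert (Hpos : forall t, 0 <= t <= / 2 -> Rabs (mixed_difference F t t) <= A * (t * t)).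
    { intros t Ht. specialize (HP t t Ht Ht); specialize (HM t t Ht Ht).
      fold A in HP, HM. unfold mixed_difference in *. rewrite Ropp_involutive in HM.
      apply Rabs_le; lra. }
    intros t Ht. destruct (Rle_or_lt 0 t) as [H0|H0].
    - rewrite Rabs_pos_eq in Ht by lra. apply Hpos; lra.
    - rewrite Rabs_left in Ht by lra. specialize (Hpos (- t) ltac:(lra)).
      unfold mixed_difference in *. rewrite !Ropp_involutive in Hpos.
      replace (t * t) with (- t * - t) by ring.
      eapply Rle_trans; [|exact Hpos]. right. f_equal. ring. }
  assert (Hsd : forall s, second_derivative
            (fun t => s * mixed_difference F t t + - A * (t * t)) 0
            (s * (4 * (b + c)) + - A * 2)).
  { intro s.
    pose proof (jet2_directional F 0 0 p q a b c d 1 1 J) as S1.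
    pose proof (jet2_directional F 0 0 p q a b c d (-1) 1 J) as S2.
    pose proof (jet2_directional F 0 0 p q a b c d 1 (-1) J) as S3.
    pose proof (jet2_directional F 0 0 p q a b c d (-1) (-1) J) as S4.
    assert (Sq : second_derivative (fun t => t * t) 0 2).
    { apply second_derivative_intro with (fun t => 2 * t).
      - intro u. auto_derive; auto; ring.
      - auto_derive; auto; ring. }
    pose proof (second_derivative_plus _ _ _ _ _
      (second_derivative_plus _ _ _ _ _
        (second_derivative_plus _ _ _ _ _ (second_derivative_scal s _ _ _ S1)
           (second_derivative_scal (- s) _ _ _ S2))
        (second_derivative_plus _ _ _ _ _ (second_derivative_scal (- s) _ _ _ S3)
           (second_derivative_scal s _ _ _ S4)))
      (second_derivative_scal (- A) _ _ _ Sq)) as S.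
    match type of S with second_derivative _ _ ?v =>
      replace (s * (4 * (b + c)) + - A * 2) with v by ring end.
    eapply second_derivative_ext; [|exact S].
    intro t. cbv beta. unfold mixed_difference.
    replace (0 + t * 1) with t by ring. replace (0 + t * -1) with (- t) by ring. ring. }
  assert (Hle : forall s, Rabs s = 1 -> s * (4 * (b + c)) + - A * 2 <= 0).
  { intros s Hs. apply (second_derivative_at_max _ _ _ (Hsd s)).
    assert (H2 : 0 < / 2) by lra. exists (mkposreal _ H2). intros t Ht.
    change (Rabs (t - 0) < / 2) in Ht. rewrite Rminus_0_r in Ht.
    specialize (Hdiag t ltac:(lra)).
    assert (E0 : mixed_difference F 0 0 = 0)
      by (unfold mixed_difference; rewrite Ropp_0; ring).
    rewrite E0.
    assert (s * mixed_difference F t t <= A * (t * t)).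
    { eapply Rle_trans; [apply Rle_abs|]. rewrite Rabs_mult, Hs. lra. }
    lra. }
  pose proof (Hle 1 Rabs_R1). pose proof (Hle (-1) ltac:(rewrite Rabs_left; lra)).
  apply Rabs_le; lra.
Qed.

(** * Harnack inequality *)

Lemma second_derivative_log_radial (s t x : R) : 0 < (x - s) * (x - s) + t * t ->
  second_derivative (fun u => ln ((u - s) * (u - s) + t * t)) x
    (2 * (t * t - (x - s) * (x - s)) / ((x - s) * (x - s) + t * t) ^ 2).
Proof.
  intro Hx.
  exists (fun u => 2 * (u - s) / ((u - s) * (u - s) + t * t)). split.
  - assert (HL : locally_2d (fun u _ => 0 < (u - s) * (u - s) + t * t) x 0).
    { apply (locally_2d_gt0 (fun u _ => (u - s) * (u - s) + t * t)); [continuity_2d|exact Hx]. }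
    generalize (locally_2d_1d_const_y _ _ _ HL). apply filter_imp.
    intros u Hu. auto_derive; [lra|]. field. lra.
  - auto_derive; [lra|]. field. lra.
Qed.

Lemma has_laplacian_log_radial (s t x y : R) : 0 < (x - s) * (x - s) + (y - t) * (y - t) ->
  has_laplacian (fun u v => ln ((u - s) * (u - s) + (v - t) * (v - t))) x y 0.
Proof.
  intro H. do 2 eexists. split; [|split].
  - apply (second_derivative_log_radial s (y - t) x H).
  - assert (H' : 0 < (y - t) * (y - t) + (x - s) * (x - s)) by lra.
    eapply second_derivative_ext; [|exact (second_derivative_log_radial t (x - s) y H')].
    intro v. cbv beta. f_equal. apply Rplus_comm.
  - field. lra.
Qed.

(** The barrier is the logarithmic potential that equals [m] on the small circle
    and vanishes on the circle of radius [8], lowered by [N (64 - r^2)] to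
    absorb the Laplacian of [F]. In the plane the potential decays only
    logarithmically in [sigma], so a loss by a factor [sigma] is a crude bound. *)
Lemma lower_bound_from_disc F N s t sigma m :
  0 < N -> 0 < sigma <= 1 -> 0 < m ->
  (forall x y, Rabs (x - s) <= 8 -> Rabs (y - t) <= 8 ->
     0 <= F x y /\ laplacian_bounded F N x y) ->
  (forall x y, (x - s) * (x - s) + (y - t) * (y - t) <= sigma * sigma -> m <= F x y) ->
  forall x y, sigma * sigma <= (x - s) * (x - s) + (y - t) * (y - t) <= 25 ->
    m * (sigma / 32) - 64 * N <= F x y.
Proof.
  intros HN Hsig Hm HF Hin.
  set (r2 := fun x y => (x - s) * (x - s) + (y - t) * (y - t)).
  set (L := ln 64 - ln (sigma * sigma)).
  assert (Hss : 0 < sigma * sigma) by nra.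
  assert (HL0 : 0 < L).
  { unfold L. assert (ln (sigma * sigma) < ln 64) by (apply ln_increasing; nra). lra. }
  assert (HL1 : L <= 16 / sigma).
  { unfold L. rewrite ln_mult by lra. replace 64 with (8 * 8) by ring.
    rewrite ln_mult by lra.
    assert (E : 8 / sigma = 8 * / sigma) by reflexivity.
    assert (Hi : 0 < / sigma) by (apply Rinv_0_lt_compat; lra).
    pose proof (ln_le_self (8 / sigma) ltac:(rewrite E; lra)) as HB.
    rewrite E, ln_mult, ln_Rinv in HB by lra. unfold Rdiv; lra. }
  assert (Hr2 : forall x y, continuity_2d_pt r2 x y).
  { intros x y. unfold r2. continuity_2d. }
  assert (Hsq : forall z c, (z - c) * (z - c) <= 64 -> Rabs (z - c) <= 8).
  { intros z c H. apply Rabs_le. nra. }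
  set (V := fun x y => m / L * ln 64 + (- (m / L)) * ln (r2 x y)
              + (- (64 * N) + N * r2 x y)).
  assert (HV : forall x y, 0 <= r2 x y - sigma * sigma /\ 0 <= 64 - r2 x y ->
             V x y + (-1) * F x y <= 0).
  { apply (maximum_principle (fun x y => 0 <= r2 x y - sigma * sigma /\ 0 <= 64 - r2 x y)
             (fun x y => V x y + (-1) * F x y)).
    - apply (closed_2d_and (fun x y => 0 <= r2 x y - sigma * sigma) (fun x y => 0 <= 64 - r2 x y));
        apply closed_2d_ge0; intros; apply continuity_2d_pt_minus;
        auto; apply continuity_2d_pt_const.
    - exists (8 + Rabs s + Rabs t). intros x y [_ H]. unfold r2 in H.
      pose proof (Rabs_pos s); pose proof (Rabs_pos t).
      pose proof (Rle_0_sqr (x - s)) as Sx; pose proof (Rle_0_sqr (y - t)) as Sy.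
      unfold Rsqr in Sx, Sy.
      assert (Hx8 : Rabs (x - s) <= 8) by (apply Hsq; lra).
      assert (Hy8 : Rabs (y - t) <= 8) by (apply Hsq; lra).
      pose proof (Rabs_triang (x - s) s) as T1. replace (x - s + s) with x in T1 by ring.
      pose proof (Rabs_triang (y - t) t) as T2. replace (y - t + t) with y in T2 by ring.
      split; lra.
    - intros x y [H1 H2].
      pose proof (Rle_0_sqr (x - s)) as Sx; pose proof (Rle_0_sqr (y - t)) as Sy.
      unfold Rsqr in Sx, Sy.
      destruct (HF x y) as [_ (p & q & a & b & c & d & J & _)];
        [apply Hsq; unfold r2 in *; lra ..|].
      apply jet2_continuity in J.
      assert (CL : continuity_2d_pt (fun u v => ln (r2 u v)) x y).
      { apply continuity_1d_2d_pt_comp; [|apply Hr2].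
        apply derivable_continuous_pt. exists (/ r2 x y). apply derivable_pt_lim_ln. lra. }
      unfold V. clearbody r2. continuity_2d; auto.
    - intros x y [H1 H2].
      pose proof (Rle_0_sqr (x - s)) as Sx; pose proof (Rle_0_sqr (y - t)) as Sy.
      unfold Rsqr in Sx, Sy.
      destruct (HF x y) as [F0 (p & q & a & b & c & d & J & B)];
        [apply Hsq; unfold r2 in *; lra ..|].
      assert (HmL : 0 < m / L) by (apply Rdiv_lt_0_compat; lra).
      destruct (Req_dec (r2 x y) (sigma * sigma)) as [E1|E1].
      { left. pose proof (Hin x y ltac:(fold (r2 x y); lra)) as Hm'.
        unfold V. rewrite E1.
        assert (m / L * ln 64 - m / L * ln (sigma * sigma) = m)
          by (unfold L; field; unfold L in HL0; lra).
        nra. }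
      destruct (Req_dec (r2 x y) 64) as [E2|E2].
      { left. unfold V. rewrite E2. lra. }
      right. split.
      { apply locally_2d_impl with
          (fun u v => 0 < r2 u v - sigma * sigma /\ 0 < 64 - r2 u v).
        - apply locally_2d_forall. intros; lra.
        - apply locally_2d_and; apply locally_2d_gt0; try lra;
            apply continuity_2d_pt_minus; auto; apply continuity_2d_pt_const. }
      exists ((0 + - (m / L) * 0 + (0 + N * 4)) + (-1) * (a + d)). split.
      + assert (LC : forall k, has_laplacian (fun _ _ => k) x y 0).
        { intro k. apply (has_laplacian_fst (fun _ => k)), second_derivative_intro with (fun _ => 0);
            [intro u|]; auto_derive; auto. }
        apply has_laplacian_plus;
          [|apply has_laplacian_scal; eapply jet2_has_laplacian, J].
        unfold V. apply has_laplacian_plus; [|apply has_laplacian_plus; [apply LC|]].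
        * apply has_laplacian_plus; [apply LC|]. apply has_laplacian_scal.
          apply has_laplacian_log_radial. fold (r2 x y). lra.
        * apply has_laplacian_scal. exists 2, 2. repeat split; try ring.
          { apply second_derivative_intro with (fun u => 2 * (u - s)).
            - intro u. unfold r2. auto_derive; auto; ring.
            - auto_derive; auto; ring. }
          { apply second_derivative_intro with (fun v => 2 * (v - t)).
            - intro u. unfold r2. auto_derive; auto; ring.
            - auto_derive; auto; ring. }
      + apply Rabs_le_between in B. lra. }
  intros x y [H1 H2]. fold (r2 x y) in H1, H2.
  specialize (HV x y ltac:(lra)). unfold V in HV.
  assert (Hln : / 2 <= ln 64 - ln (r2 x y)).
  { assert (Hi : 0 < / r2 x y) by (apply Rinv_0_lt_compat; lra).
    assert (HP : 0 < 64 * / r2 x y) by lra.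
    replace (ln 64 - ln (r2 x y)) with (ln (64 * / r2 x y))
      by (rewrite ln_mult, ln_Rinv by lra; ring).
    eapply Rle_trans; [|apply (ln_ge_1_minus_inv _ HP)].
    rewrite Rinv_mult, Rinv_inv. lra. }
  assert (Hmf : m * (sigma / 32) <= m / L * (ln 64 - ln (r2 x y))).
  { assert (HmL : m * (sigma / 16) <= m / L).
    { apply Rmult_le_compat_l; [lra|].
      replace (sigma / 16) with (/ (16 / sigma)) by (field; lra).
      apply Rinv_le_contravar; lra. }
    assert (0 < m * (sigma / 16)) by (apply Rmult_lt_0_compat; lra).
    apply Rle_trans with (m / L * / 2); [lra|].
    apply Rmult_le_compat_l; lra. }
  assert (0 <= N * r2 x y) by nra. lra.
Qed.

(** Maximise [w^2 F] over the unit disc, where [w = 1 - x^2 - y^2]. On a disc of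
    radius comparable with the value [w0] of [w] at the maximum point, [F] is at
    most [4] times its value there, so the gradient estimate makes [F]
    comparable with this value on a slightly smaller disc. The logarithmic
    barrier propagates this to all of the disc of radius [4], and the square in
    [w^2 F] compensates the loss by the factor [w0]. The disc of radius [4]
    matters because it contains a full period of length [2 PI]. *)
Lemma harnack F N : 0 < N ->
  (forall x y, Rabs x <= 10 -> Rabs y <= 10 ->
     0 <= F x y /\ laplacian_bounded F N x y) ->
  forall x y, x * x + y * y <= 16 -> / 100000 * F 0 0 - 66 * N <= F x y.
Proof.
  intros HN HF.
  set (w := fun x y => 1 - x * x - y * y).
  assert (Hw : forall x y, continuity_2d_pt w x y) by (intros; unfold w; continuity_2d).
  assert (Hdisc : forall x y, 0 <= w x y -> Rabs x <= 1 /\ Rabs y <= 1).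
  { intros x y H. unfold w in H. split; apply Rabs_le; nra. }
  destruct (extreme_value_2d (fun x y => 0 <= w x y) (fun x y => w x y * w x y * F x y))
    as (s & t & Hst & Hmax).
  { apply closed_2d_ge0, Hw. }
  { exists 1. exact Hdisc. }
  { exists 0, 0. unfold w. lra. }
  { intros x y H. destruct (Hdisc x y H) as [H1 H2].
    destruct (HF x y ltac:(lra) ltac:(lra)) as [_ (p & q & a & b & c & d & J & _)].
    apply jet2_continuity in J.
    apply continuity_2d_pt_mult; [apply continuity_2d_pt_mult; apply Hw | exact J]. }
  destruct (Hdisc s t Hst) as [Hs Ht].
  destruct (HF s t ltac:(lra) ltac:(lra)) as [f0_pos _].
  set (w0 := w s t) in *. set (f0 := F s t) in *.
  assert (HF0 : F 0 0 <= w0 * w0 * f0).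
  { specialize (Hmax 0 0). unfold w in Hmax at 1 2 3. specialize (Hmax ltac:(lra)). lra. }
  assert (Hw1 : w0 <= 1).
  { unfold w0, w. pose proof (Rle_0_sqr s) as S1; pose proof (Rle_0_sqr t) as S2.
    unfold Rsqr in S1, S2. lra. }
  assert (Hw2 : w0 * w0 <= w0).
  { rewrite <- (Rmult_1_r w0) at 3. apply Rmult_le_compat_l; lra. }
  assert (Hwf : w0 * w0 * f0 <= w0 * f0) by (apply Rmult_le_compat_r; lra).
  assert (Hwf' : w0 * f0 <= f0).
  { rewrite <- (Rmult_1_l f0) at 2. apply Rmult_le_compat_r; lra. }
  intros x y Hxy.
  assert (Hxy' : Rabs x <= 4 /\ Rabs y <= 4) by (split; apply Rabs_le; nra).
  destruct (HF x y ltac:(lra) ltac:(lra)) as [Fxy_pos _].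
  destruct (Rle_or_lt (3 / 4 * f0) N) as [Hsmall|Hbig].
  { lra. }
  destruct (Rle_or_lt (F 0 0) 0) as [F00|F00]; [lra|].
  assert (Hw0 : 0 < w0).
  { destruct (Rle_lt_or_eq_dec _ _ Hst) as [|E]; [assumption|exfalso].
    rewrite <- E in HF0. lra. }
  apply Rabs_le_between in Hs, Ht.
  (* near the maximum point the weight has not yet halved *)
  assert (Hnear : forall u v, Rabs (u - s) <= w0 / 16 -> Rabs (v - t) <= w0 / 16 ->
             Rabs (F u v) <= 4 * f0 /\ laplacian_bounded F N u v).
  { intros u v Hu Hv. apply Rabs_le_between in Hu, Hv.
    destruct (HF u v) as [P1 P2]; [apply Rabs_le; lra ..|].
    split; [|exact P2]. rewrite Rabs_pos_eq by exact P1.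
    assert (Hwu : w0 / 2 <= w u v).
    { assert (E : w u v = w0 - (u - s) * (2 * s + (u - s)) - (v - t) * (2 * t + (v - t)))
        by (unfold w0, w; ring).
      rewrite E.
      assert ((u - s) * (2 * s + (u - s)) <= w0 / 16 * 3).
      { eapply Rle_trans; [apply Rle_abs|]. rewrite Rabs_mult.
        apply Rmult_le_compat; try apply Rabs_pos; apply Rabs_le; lra. }
      assert ((v - t) * (2 * t + (v - t)) <= w0 / 16 * 3).
      { eapply Rle_trans; [apply Rle_abs|]. rewrite Rabs_mult.
        apply Rmult_le_compat; try apply Rabs_pos; apply Rabs_le; lra. }
      lra. }
    specialize (Hmax u v ltac:(lra)).
    assert (w0 * w0 / 4 <= w u v * w u v) by nra.
    assert (w0 * w0 / 4 * F u v <= w0 * w0 * f0) by nra.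
    assert (0 < w0 * w0) by nra.
    apply (Rmult_le_reg_l (w0 * w0 / 4)); lra. }
  (* a horizontal and a vertical move with half-lengths at most [w0 / 4096] lower
     [F] by no more than [f0 / 4 + N] *)
  set (sigma := w0 / 2048).
  assert (Hin : forall u v, Rabs (u - s) <= sigma -> Rabs (v - t) <= sigma ->
             3 / 4 * f0 - N <= F u v).
  { intros u v Hu Hv. unfold sigma in *.
    assert (Hr : 0 < w0 / 32) by lra.
    assert (Hsquare : forall cx cy, Rabs (cx - s) <= w0 / 32 -> Rabs (cy - t) <= w0 / 32 ->
               bounded_on_square F cx cy (w0 / 32) (4 * f0) N).
    { intros cx cy Hcx Hcy a b Ha Hb.
      apply Rabs_le_between in Hcx, Hcy, Ha, Hb.
      apply Hnear; apply Rabs_le; lra. }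
    apply Rabs_le_between in Hu, Hv.
    pose proof (horizontal_difference F ((u + s) / 2) t (w0 / 32) (4 * f0) N Hr HN
      (Hsquare ((u + s) / 2) t ltac:(apply Rabs_le; lra) ltac:(apply Rabs_le; lra))
      ((u - s) / 2) ltac:(apply Rabs_le; lra)) as D1.
    pose proof (vertical_difference F u ((v + t) / 2) (w0 / 32) (4 * f0) N Hr HN
      (Hsquare u ((v + t) / 2) ltac:(apply Rabs_le; lra) ltac:(apply Rabs_le; lra))
      ((v - t) / 2) ltac:(apply Rabs_le; lra)) as D2.
    replace ((u + s) / 2 + (u - s) / 2) with u in D1 by field.
    replace ((u + s) / 2 - (u - s) / 2) with s in D1 by field.
    replace ((v + t) / 2 + (v - t) / 2) with v in D2 by field.
    replace ((v + t) / 2 - (v - t) / 2) with t in D2 by field.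
    set (Q := 4 * (4 * f0) / (w0 / 32) + 2 * N * (w0 / 32)) in *.
    assert (HQ : 0 <= Q).
    { unfold Q. assert (0 <= 4 * (4 * f0) / (w0 / 32)).
      { apply Rmult_le_pos; [lra|]. left. apply Rinv_0_lt_compat. lra. }
      nra. }
    assert (HQw : Q * (w0 / 4096) = f0 / 8 + N * (w0 * w0) / 65536).
    { unfold Q. field. lra. }
    assert (A1 : Rabs ((u - s) / 2) <= w0 / 4096) by (apply Rabs_le; lra).
    assert (A2 : Rabs ((v - t) / 2) <= w0 / 4096) by (apply Rabs_le; lra).
    assert (Q * Rabs ((u - s) / 2) <= Q * (w0 / 4096)) by (apply Rmult_le_compat_l; lra).
    assert (Q * Rabs ((v - t) / 2) <= Q * (w0 / 4096)) by (apply Rmult_le_compat_l; lra).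
    apply Rabs_le_between in D1, D2. fold f0 in D1.
    assert (N * (w0 * w0) <= N) by nra.
    lra. }
  assert (Hsig : 0 < sigma <= 1) by (unfold sigma; lra).
  destruct (Rle_or_lt (sigma * sigma) ((x - s) * (x - s) + (y - t) * (y - t))) as [Hout|Hinn].
  - assert (Hb := lower_bound_from_disc F N s t sigma (3 / 4 * f0 - N) HN Hsig ltac:(lra)).
    assert (H25 : (x - s) * (x - s) + (y - t) * (y - t) <= 25).
    { assert (s * s + t * t <= 1) by (unfold w0, w in Hst; lra).
      assert (- 2 * (x * s + y * t) <= 8).
      { pose proof (pow2_ge_0 (x + 4 * s)); pose proof (pow2_ge_0 (y + 4 * t)). lra. }
      lra. }
    assert (Hb' := fun P1 P2 => Hb P1 P2 x y (conj Hout H25)).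
    assert (Hfin : (3 / 4 * f0 - N) * (sigma / 32) - 64 * N <= F x y).
    { apply Hb'.
      - intros u v Hu Hv. apply Rabs_le_between in Hu, Hv.
        apply HF; apply Rabs_le; lra.
      - intros u v Huv. apply Rabs_le_of_sum_sqr in Huv; [apply Hin; apply Huv|lra]. }
    eapply Rle_trans; [|exact Hfin].
    (* [65536 = 32 * 2048], and [3 / 4 / 65536] exceeds [1 / 100000] *)
    assert (E : (3 / 4 * f0 - N) * (sigma / 32) = (3 / 4 * (w0 * f0) - N * w0) / 65536)
      by (unfold sigma; field).
    rewrite E.
    assert (N * w0 <= N) by nra.
    lra.
  - apply Rlt_le, Rabs_le_of_sum_sqr in Hinn; [|lra].
    assert (3 / 4 * f0 - N <= F x y) by (apply Hin; apply Hinn).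
    lra.
Qed.

(** * The curvature equation on a half cylinder *)

Lemma periodic_representative (theta c : R) :
  exists theta', c <= theta' <= c + 2 * PI /\
    forall g : R -> R, (forall s, g (s + 2 * PI) = g s) -> g theta' = g theta.
Proof.
  pose proof PI_RGT_0 as HPI.
  set (n := up ((theta - c) / (2 * PI))).
  destruct (archimed ((theta - c) / (2 * PI))) as [H1 H2]. fold n in H1, H2.
  exists (theta - (IZR n - 1) * (2 * PI)). split.
  - assert (E : theta - c = (theta - c) / (2 * PI) * (2 * PI)) by (field; lra).
    set (r := (theta - c) / (2 * PI)) in *. split; nra.
  - intros g Hg.
    assert (Hn : forall (m : nat) s, g (s + INR m * (2 * PI)) = g s).
    { induction m as [|m IH]; intro s.
      - simpl. f_equal. ring.
      - rewrite S_INR. replace (s + (INR m + 1) * (2 * PI)) with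
          ((s + INR m * (2 * PI)) + 2 * PI) by ring. rewrite Hg. apply IH. }
    destruct (Z.le_gt_cases 0 (n - 1)) as [Hz|Hz].
    + rewrite <- (Hn (Z.to_nat (n - 1)) (theta - _)). f_equal.
      rewrite INR_IZR_INZ, Z2Nat.id by exact Hz. rewrite minus_IZR. ring.
    + rewrite <- (Hn (Z.to_nat (- (n - 1))) theta). f_equal.
      rewrite INR_IZR_INZ, Z2Nat.id by lia. rewrite opp_IZR, minus_IZR. ring.
Qed.

(** Periodicity replaces compactness in [theta]. *)
Lemma strip_maximum_principle (G : R -> R -> R) (a b : R) :
  (forall t theta, a <= t <= b -> continuity_2d_pt G t theta) ->
  (forall t theta, a <= t <= b -> G t (theta + 2 * PI) = G t theta) ->
  (forall theta, G a theta <= 0) -> (forall theta, G b theta <= 0) ->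
  (forall t theta, a < t < b -> 0 < G t theta ->
     exists L, has_laplacian G t theta L /\ 0 < L) ->
  forall t theta, a <= t <= b -> G t theta <= 0.
Proof.
  intros HC HP Ha Hb HL t theta Ht.
  pose proof PI_RGT_0 as HPI.
  destruct (extreme_value_2d (rectangle a b 0 (2 * PI)) G) as (s & phi & [Hs Hphi] & Hmax).
  - apply closed_rectangle.
  - apply bounded_rectangle.
  - exists t, 0. split; lra.
  - intros x y [Hx _]. apply HC, Hx.
  - assert (Hmax' : forall u v, a <= u <= b -> G u v <= G s phi).
    { intros u v Hu. destruct (periodic_representative v 0) as (v' & Hv & E).
      rewrite <- (E (G u)) by (intro; apply HP, Hu). apply Hmax. split; lra. }
    eapply Rle_trans; [apply (Hmax' t theta Ht)|].
    destruct (Req_dec s a) as [->|Hsa]; [apply Ha|].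
    destruct (Req_dec s b) as [->|Hsb]; [apply Hb|].
    apply Rnot_lt_le. intro Hpos.
    destruct (HL s phi ltac:(lra) Hpos) as (L & HL1 & HL2).
    apply (Rlt_not_le _ _ HL2), (has_laplacian_at_max _ _ _ _ HL1).
    apply locally_2d_impl with (rectangle a b (phi - 1) (phi + 1)).
    + apply locally_2d_forall. intros u v [Hu _]. apply Hmax', Hu.
    + apply interior_rectangle; lra.
Qed.

(** The curvature equation for [U = ln lambda + t] in the coordinate [t + i
    theta = log z], in which the punctured disc becomes a half cylinder with the
    puncture at [t = -oo] and [q] is minus the curvature. *)
Definition cylinder_solution (U q : R -> R -> R) (T : R) : Prop :=
  (forall t theta, t < T -> exists p r a b c d,
     jet2 U t theta p r a b c d /\ a + d = q t theta * exp (2 * U t theta)) /\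
  (forall t theta, U t (theta + 2 * PI) = U t theta).

(** As [t] tends to [-oo]. *)
Definition uniform_limit (g : R -> R -> R) (l : R) : Prop :=
  forall eps, 0 < eps -> exists tau, forall t theta, t < tau ->
    Rabs (g t theta - l) <= eps.

Lemma cylinder_continuity U q T t theta :
  cylinder_solution U q T -> t < T -> continuity_2d_pt U t theta.
Proof.
  intros [H _] Ht. destruct (H t theta Ht) as (p & r & a & b & c & d & J & _).
  eapply jet2_continuity, J.
Qed.

Lemma cylinder_laplacian U q T t theta :
  cylinder_solution U q T -> t < T ->
  has_laplacian U t theta (q t theta * exp (2 * U t theta)).
Proof.
  intros [H _] Ht. destruct (H t theta Ht) as (p & r & a & b & c & d & J & <-).
  eapply jet2_has_laplacian, J.
Qed.

Lemma cylinder_bounded U q T a b :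
  cylinder_solution U q T -> a <= b -> b < T ->
  exists B, forall t theta, a <= t <= b -> Rabs (U t theta) <= B.
Proof.
  intros HU Hab Hb. pose proof PI_RGT_0 as HPI.
  assert (HC : forall x y, rectangle a b 0 (2 * PI) x y -> continuity_2d_pt U x y).
  { intros x y [Hx _]. apply (cylinder_continuity U q T); [exact HU|lra]. }
  assert (Hne : exists x y, rectangle a b 0 (2 * PI) x y) by (exists a, 0; split; lra).
  destruct (extreme_value_2d _ U (closed_rectangle _ _ _ _) (bounded_rectangle _ _ _ _) Hne HC)
    as (s & phi & _ & Hmax).
  destruct (extreme_value_2d _ (fun x y => - U x y) (closed_rectangle _ _ _ _)
    (bounded_rectangle _ _ _ _) Hne (fun x y H => continuity_2d_pt_opp _ _ _ (HC x y H)))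
    as (s' & phi' & _ & Hmin).
  exists (Rabs (U s phi) + Rabs (U s' phi')). intros t theta Ht.
  destruct (periodic_representative theta 0) as (v & Hv & E).
  rewrite <- (E (U t)) by (intro; apply HU).
  specialize (Hmax t v ltac:(split; lra)). specialize (Hmin t v ltac:(split; lra)). cbv beta in Hmin.
  pose proof (Rle_abs (U s phi)); pose proof (Rabs_pos (U s phi)).
  pose proof (Rle_abs (- U s' phi')); pose proof (Rabs_pos (U s' phi')).
  rewrite Rabs_Ropp in *. apply Rabs_le. lra.
Qed.

(** Ahlfors' lemma. The barrier [V] has exponential [(1 / (S - t) + 1 / (t - a))
    / (2 k)]; it blows up at both ends of [a < t < S] and satisfies [V'' <= 4
    k^2 exp (2 V)], because the sum of the squares of two positive numbers is at
    most the square of their sum. Where [U] exceeds [V] the difference would be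
    strictly subharmonic, so there is no such point. Then [a] tends to [-oo]. *)
Lemma ahlfors_upper_bound U q T k S :
  cylinder_solution U q T -> 0 < k -> S < T ->
  (forall t theta, t < T -> 4 * (k * k) <= q t theta) ->
  forall t theta, t < S -> U t theta <= - ln (2 * k * (S - t)).
Proof.
  intros HU Hk HS Hq.
  assert (Hfin : forall a t theta, a < t < S ->
    U t theta <= ln (/ (2 * k) * (/ (S - t) + / (t - a)))).
  { intros a t theta Ht.
    destruct (cylinder_bounded U q T a S HU ltac:(lra) HS) as [B HB].
    set (V := fun t => ln (S - a) - ln (S - t) - ln (t - a) - ln (2 * k)).
    assert (EV : forall t, a < t < S -> V t = ln (/ (2 * k) * (/ (S - t) + / (t - a)))).
    { intros s Hs.
      replace (/ (2 * k) * (/ (S - s) + / (s - a))) with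
        ((S - a) * / (S - s) * / (s - a) * / (2 * k)) by (field; lra).
      assert (0 < / (S - s)) by (apply Rinv_0_lt_compat; lra).
      assert (0 < / (s - a)) by (apply Rinv_0_lt_compat; lra).
      assert (0 < / (2 * k)) by (apply Rinv_0_lt_compat; lra).
      rewrite !ln_mult, !ln_Rinv by (repeat apply Rmult_lt_0_compat; lra).
      unfold V. ring. }
    rewrite <- EV by exact Ht.
    set (delta := Rmin (/ (2 * k * exp B)) (Rmin (t - a) (S - t))).
    assert (He : 0 < 2 * k * exp B) by (pose proof (exp_pos B); nra).
    assert (Hd : 0 < delta).
    { repeat apply Rmin_glb_lt; try lra. apply Rinv_0_lt_compat, He. }
    pose proof (Rmin_l (/ (2 * k * exp B)) (Rmin (t - a) (S - t))) as D1.
    pose proof (Rmin_r (/ (2 * k * exp B)) (Rmin (t - a) (S - t))) as D2.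
    pose proof (Rmin_l (t - a) (S - t)) as D3. pose proof (Rmin_r (t - a) (S - t)) as D4.
    fold delta in D1, D2.
    assert (Hend : forall s, a < s < S -> (s - a = delta \/ S - s = delta) -> B <= V s).
    { intros s Hs Hc. rewrite EV by exact Hs. rewrite <- (ln_exp B) at 1.
      assert (I1 : 0 < / (S - s)) by (apply Rinv_0_lt_compat; lra).
      assert (I2 : 0 < / (s - a)) by (apply Rinv_0_lt_compat; lra).
      assert (Hid : 2 * k * exp B <= / delta).
      { rewrite <- (Rinv_inv (2 * k * exp B)). apply Rinv_le_contravar; assumption. }
      assert (Hsum : / delta <= / (S - s) + / (s - a)) by (destruct Hc as [<-|<-]; lra).
      assert (Hx : exp B <= / (2 * k) * (/ (S - s) + / (s - a))).
      { apply (Rmult_le_reg_l (2 * k)); [lra|].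
        replace (2 * k * (/ (2 * k) * (/ (S - s) + / (s - a)))) with
          (/ (S - s) + / (s - a)) by (field; lra). lra. }
      apply ln_le; [apply exp_pos|exact Hx]. }
    assert (HVc : forall s, a < s < S -> second_derivative V s
                (/ ((S - s) * (S - s)) + / ((s - a) * (s - a)))).
    { intros s Hs. exists (fun s => / (S - s) - / (s - a)). split.
      - assert (Hm : 0 < Rmin (s - a) (S - s)) by (apply Rmin_glb_lt; lra).
        exists (mkposreal _ Hm). intros u Hu.
        change (Rabs (u - s) < Rmin (s - a) (S - s)) in Hu. apply Rabs_def2 in Hu.
        Rmin_bounds (s - a) (S - s).
        unfold V. auto_derive; [lra|]. field. lra.
      - auto_derive; [lra|]. field. lra. }
    assert (Hmain : U t theta + (-1) * V t <= 0).
    { apply (strip_maximum_principle (fun t theta => U t theta + (-1) * V t)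
               (a + delta) (S - delta)); try lra.
      - intros s phi Hs. apply continuity_2d_pt_plus.
        + apply (cylinder_continuity U q T); [exact HU|lra].
        + apply continuity_2d_pt_mult; [apply continuity_2d_pt_const|].
          apply (continuity_1d_2d_pt_comp V (fun u _ => u)); [|apply continuity_2d_pt_id1].
          apply (second_derivative_continuity V s _ (HVc s ltac:(lra))).
      - intros s phi Hs. f_equal. apply HU.
      - intro phi. specialize (Hend (a + delta) ltac:(lra) ltac:(left; ring)).
        specialize (HB (a + delta) phi ltac:(lra)). apply Rabs_le_between in HB. lra.
      - intro phi. specialize (Hend (S - delta) ltac:(lra) ltac:(right; ring)).
        specialize (HB (S - delta) phi ltac:(lra)). apply Rabs_le_between in HB. lra.
      - intros s phi Hs Hpos.
        exists (q s phi * exp (2 * U s phi) + (-1) *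
           (/ ((S - s) * (S - s)) + / ((s - a) * (s - a)))). split.
        + apply has_laplacian_plus.
          * apply (cylinder_laplacian U q T); [exact HU|lra].
          * apply has_laplacian_scal, has_laplacian_fst, HVc. lra.
        + specialize (Hq s phi ltac:(lra)).
          assert (HeV : 2 * k * exp (V s) = / (S - s) + / (s - a)).
          { rewrite EV, exp_ln by lra || (apply Rmult_lt_0_compat;
              [apply Rinv_0_lt_compat; lra|
               apply Rplus_lt_0_compat; apply Rinv_0_lt_compat; lra]).
            field. lra. }
          assert (HUV : exp (V s) < exp (U s phi)) by (apply exp_increasing; lra).
          pose proof (exp_pos (V s)) as PV.
          rewrite exp_double.
          set (e := exp (U s phi)) in *. set (v := exp (V s)) in *.
          assert (H1 : 4 * (k * k) * (e * e) <= q s phi * (e * e)) by (apply Rmult_le_compat_r; nra).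
          assert (H2 : (2 * k * v) * (2 * k * v) < 4 * (k * k) * (e * e)).
          { replace ((2 * k * v) * (2 * k * v)) with (4 * (k * k) * (v * v)) by ring.
            apply Rmult_lt_compat_l; nra. }
          rewrite HeV in H2.
          assert (I1 : 0 < / (S - s)) by (apply Rinv_0_lt_compat; lra).
          assert (I2 : 0 < / (s - a)) by (apply Rinv_0_lt_compat; lra).
          rewrite !Rinv_mult. nra. }
    lra. }
  intros t theta Ht.
  rewrite <- ln_Rinv by (repeat apply Rmult_lt_0_compat; lra).
  rewrite <- (ln_exp (U t theta)).
  assert (Hle : exp (U t theta) <= / (2 * k * (S - t))).
  { apply Rnot_lt_le. intro Hlt.
    (* send the left end of the strip to minus infinity *)
    set (gap := exp (U t theta) - / (2 * k * (S - t))).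
    assert (Hgap : 0 < gap * k) by (unfold gap; nra).
    set (a := t - / (gap * k)).
    assert (Ha : a < t) by (unfold a; pose proof (Rinv_0_lt_compat _ Hgap); lra).
    specialize (Hfin a t theta ltac:(lra)).
    assert (Hta : / (t - a) = gap * k).
    { unfold a. replace (t - (t - / (gap * k))) with (/ (gap * k)) by ring.
      apply Rinv_inv. }
    rewrite Hta in Hfin.
    assert (I1 : 0 < / (S - t)) by (apply Rinv_0_lt_compat; lra).
    assert (P : 0 < / (2 * k) * (/ (S - t) + gap * k)).
    { apply Rmult_lt_0_compat; [apply Rinv_0_lt_compat; lra|lra]. }
    assert (Hexp : exp (U t theta) <= / (2 * k) * (/ (S - t) + gap * k)).
    { rewrite <- (exp_ln _ P). apply exp_le, Hfin. }
    assert (E : / (2 * k) * (/ (S - t) + gap * k) = / (2 * k * (S - t)) + gap / 2)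
      by (field; lra).
    unfold gap in *. lra. }
  apply ln_le; [apply exp_pos|exact Hle].
Qed.

(** With [x = A + S - t], the function [- ln (2 k x) - beta x] is a subsolution:
    its second derivative [1 / x^2] dominates [4 k^2] times its squared
    exponential. It is below [U] on [t = S] by the choice of [A], and on remote
    circles because of its slope [beta]. Letting [beta] tend to [0] yields the
    bound. *)
Lemma lower_bound_from_circles U q T k S A :
  cylinder_solution U q T -> 0 < k -> S < T -> 0 < A ->
  (forall t theta, t <= S -> q t theta <= 4 * (k * k)) ->
  (forall theta, - ln (2 * k * A) <= U S theta) ->
  (forall beta tau, 0 < beta -> exists t0, t0 < tau /\ forall theta, beta * t0 <= U t0 theta) ->
  forall t theta, t <= S -> - ln (2 * k * (A + S - t)) <= U t theta.
Proof.
  intros HU Hk HS HA Hq HUS Hcirc.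
  assert (Hbeta : forall beta t theta, 0 < beta -> t <= S ->
     - ln (2 * k * (A + S - t)) - beta * (A + S - t) <= U t theta).
  { intros beta t theta Hb Ht.
    set (V := fun t => - ln (2 * k * (A + S - t)) - beta * (A + S - t)).
    destruct (Hcirc beta (Rmin t (A + S - exp (- (beta * (A + S))) / (2 * k))) Hb)
      as (t0 & Ht0 & Hcirc0).
    pose proof (Rmin_l t (A + S - exp (- (beta * (A + S))) / (2 * k))) as M1.
    pose proof (Rmin_r t (A + S - exp (- (beta * (A + S))) / (2 * k))) as M2.
    assert (HVt0 : V t0 <= beta * t0).
    { unfold V.
      assert (Hx : exp (- (beta * (A + S))) <= 2 * k * (A + S - t0)).
      { replace (exp (- (beta * (A + S)))) with (2 * k * (exp (- (beta * (A + S))) / (2 * k)))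
          by (field; lra). apply Rmult_le_compat_l; lra. }
      apply ln_le in Hx; [|apply exp_pos]. rewrite ln_exp in Hx. lra. }
    assert (HVc : forall s, s <= S -> second_derivative V s (/ ((A + S - s) * (A + S - s)))).
    { intros s Hs. exists (fun s => / (A + S - s) + beta). split.
      - exists (mkposreal _ HA). intros u Hu.
        change (Rabs (u - s) < A) in Hu. apply Rabs_def2 in Hu.
        unfold V. auto_derive; [nra|]. field. lra.
      - auto_derive; [lra|]. field. lra. }
    assert (Hmain : V t + (-1) * U t theta <= 0).
    { apply (strip_maximum_principle (fun t theta => V t + (-1) * U t theta) t0 S); try lra.
      - intros s phi Hs. apply continuity_2d_pt_plus.
        + apply (continuity_1d_2d_pt_comp V (fun u _ => u)); [|apply continuity_2d_pt_id1].
          apply (second_derivative_continuity V s _ (HVc s ltac:(lra))).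
        + apply continuity_2d_pt_mult; [apply continuity_2d_pt_const|].
          apply (cylinder_continuity U q T); [exact HU|lra].
      - intros s phi Hs. do 2 f_equal. apply HU.
      - intro phi. specialize (Hcirc0 phi). lra.
      - intro phi. specialize (HUS phi). unfold V.
        replace (A + S - S) with A by ring. nra.
      - intros s phi Hs Hpos.
        exists (/ ((A + S - s) * (A + S - s)) + (-1) * (q s phi * exp (2 * U s phi))). split.
        + apply has_laplacian_plus.
          * apply has_laplacian_fst, HVc. lra.
          * apply has_laplacian_scal, (cylinder_laplacian U q T); [exact HU|lra].
        + specialize (Hq s phi ltac:(lra)).
          set (x := A + S - s) in *. assert (Hx : 0 < x) by (unfold x; lra).
          assert (HUx : exp (U s phi) < / (2 * k * x)).
          { rewrite <- (exp_ln (/ (2 * k * x))) by (apply Rinv_0_lt_compat; nra).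
            apply exp_increasing. rewrite ln_Rinv by nra. unfold V in Hpos. fold x in Hpos.
            assert (0 < beta * x) by nra. lra. }
          pose proof (exp_pos (U s phi)) as PU. rewrite exp_double.
          set (e := exp (U s phi)) in *.
          assert (H1 : q s phi * (e * e) <= 4 * (k * k) * (e * e)) by (apply Rmult_le_compat_r; nra).
          assert (H2 : 2 * k * e < / x).
          { replace (/ x) with (2 * k * / (2 * k * x)) by (field; lra).
            apply Rmult_lt_compat_l; lra. }
          assert (Hix : 0 < / x) by (apply Rinv_0_lt_compat, Hx).
          assert (H3 : (2 * k * e) * (2 * k * e) < / x * / x) by (assert (0 < 2 * k * e) by nra; nra).
          rewrite Rinv_mult. nra. }
    unfold V in Hmain. lra. }
  intros t theta Ht. apply Rnot_lt_le. intro Hlt.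
  set (gap := - ln (2 * k * (A + S - t)) - U t theta).
  assert (Hg : 0 < gap) by (unfold gap; lra).
  specialize (Hbeta (gap / (2 * (A + S - t))) t theta
    ltac:(apply Rdiv_lt_0_compat; lra) Ht).
  replace (gap / (2 * (A + S - t)) * (A + S - t)) with (gap / 2) in Hbeta by (field; lra).
  unfold gap in *. lra.
Qed.

(** A density [exp (U t 0)] with [U t 0 <= k t + C] would make the length of the
    ray [theta = 0] finite. This is all that is used of completeness. *)
Definition ray_divergent (U : R -> R -> R) : Prop :=
  forall k C tau, 0 < k -> ~ (forall t, t < tau -> U t 0 <= k * t + C).

(** Otherwise the positive function [- U], whose Laplacian is bounded, exceeds
    [beta |t|] somewhere on every remote circle, hence by Harnack exceeds a
    fixed fraction of it at [theta = 0], up to a constant. *)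
Lemma circles_of_ray_divergent U q T :
  cylinder_solution U q T -> ray_divergent U ->
  (forall t theta, t < T -> Rabs (q t theta) <= 5 /\ U t theta <= 0) ->
  forall beta tau, 0 < beta -> exists t0, t0 < tau /\ forall theta, beta * t0 <= U t0 theta.
Proof.
  intros HU Hray Hq beta tau Hb. apply NNPP. intro Hno.
  pose proof PI_RGT_0; pose proof PI_4.
  apply (Hray (/ 100000 * beta) (66 * 5) (Rmin tau (T - 11))); [lra|].
  intros t Ht.
  Rmin_bounds tau (T - 11).
  assert (Hth : exists theta, U t theta < beta * t).
  { apply NNPP. intro Hn. apply Hno. exists t. split; [lra|]. intro theta.
    apply Rnot_lt_le. intro Hlt. apply Hn. exists theta. exact Hlt. }
  destruct Hth as [theta0 Hth].
  destruct (periodic_representative theta0 (- PI)) as (theta & Hr & E).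
  rewrite <- (E (U t)) in Hth by (intro; apply HU).
  assert (HH : / 100000 * - U (t + 0) (theta + 0) - 66 * 5 <= - U (t + 0) (theta + - theta)).
  { apply (harnack (fun x y => - U (t + x) (theta + y)) 5); [lra| |nra].
    intros x y Hx Hy. apply Rabs_le_between in Hx.
    destruct (Hq (t + x) (theta + y) ltac:(lra)) as [Hq5 HU0].
    split; [lra|].
    destruct (proj1 HU (t + x) (theta + y) ltac:(lra)) as (p & r & a & b & c & d & J & Elap).
    apply jet2_translate in J.
    apply jet2_opp in J.
    do 6 eexists. split; [exact J|].
    replace (- a + - d) with (- (a + d)) by ring. rewrite Rabs_Ropp, Elap, Rabs_mult.
    rewrite (Rabs_pos_eq (exp _)) by (left; apply exp_pos).
    assert (exp (2 * U (t + x) (theta + y)) <= 1).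
    { rewrite <- exp_0. apply exp_le. lra. }
    pose proof (exp_pos (2 * U (t + x) (theta + y))).
    pose proof (Rabs_pos (q (t + x) (theta + y))). nra. }
  rewrite !Rplus_0_r in HH. replace (theta + - theta) with 0 in HH by ring. lra.
Qed.

Lemma cylinder_weaken U q T T' : T' <= T -> cylinder_solution U q T -> cylinder_solution U q T'.
Proof. intros HT [H1 H2]. split; [|exact H2]. intros t theta Ht. apply H1. lra. Qed.

(** Both bounds are applied with [k] close to [1], namely [exp (- eta / 2)]
    above and [exp (eta / 2)] below; the shifts [S] and [A + S] are negligible
    against [- t]. *)
Lemma cylinder_asymptotics U q T :
  cylinder_solution U q T -> ray_divergent U -> uniform_limit q 4 ->
  uniform_limit (fun t theta => U t theta + ln (- 2 * t)) 0.
Proof.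
  intros HU Hray Hq eta Heta.
  set (e := exp (- (eta / 2))).
  assert (He : 0 < e < 1).
  { split; [apply exp_pos|]. rewrite <- exp_0. apply exp_increasing. lra. }
  assert (Hie : 1 < / e) by (rewrite <- Rinv_1; apply Rinv_lt_contravar; lra).
  assert (Hlne : ln e = - (eta / 2)) by apply ln_exp.
  set (dq := Rmin 1 (4 * (1 - e))).
  assert (Hdq : 0 < dq) by (apply Rmin_glb_lt; lra).
  destruct (Hq dq Hdq) as [T1 HT1].
  pose proof (Rmin_l 1 (4 * (1 - e))) as D1; pose proof (Rmin_r 1 (4 * (1 - e))) as D2.
  fold dq in D1, D2.
  set (T2 := Rmin T T1).
  pose proof (Rmin_l T T1) as M1; pose proof (Rmin_r T T1) as M2. fold T2 in M1, M2.
  assert (HU2 := cylinder_weaken U q T T2 M1 HU).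
  assert (Hq2 : forall t theta, t < T2 -> 4 - dq <= q t theta <= 4 + dq).
  { intros t theta Ht. specialize (HT1 t theta ltac:(lra)).
    apply Rabs_le_between in HT1. lra. }
  set (S := T2 - 1).
  assert (Hup : forall t theta, t < S -> U t theta <= - ln (2 * e * (S - t))).
  { apply (ahlfors_upper_bound U q T2 e S HU2); [lra|unfold S; lra|].
    intros t theta Ht. specialize (Hq2 t theta Ht). nra. }
  set (T3 := S - / (2 * e)).
  assert (Hi2e : 0 < / (2 * e)) by (apply Rinv_0_lt_compat; lra).
  assert (HT32 : T3 < T2) by (unfold T3, S; lra).
  assert (HU3 := cylinder_weaken U q T2 T3 ltac:(lra) HU2).
  assert (Hcirc := circles_of_ray_divergent U q T3 HU3 Hray).
  assert (Hcirc' : forall beta tau, 0 < beta ->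
             exists t0, t0 < tau /\ forall theta, beta * t0 <= U t0 theta).
  { apply Hcirc. intros t theta Ht. split.
    - specialize (Hq2 t theta ltac:(lra)). apply Rabs_le. lra.
    - eapply Rle_trans; [apply Hup; unfold T3 in Ht; lra|].
      assert (0 <= ln (2 * e * (S - t))); [|lra].
      rewrite <- ln_1. apply ln_le; [lra|].
      replace 1 with (2 * e * / (2 * e)) by (field; lra).
      apply Rmult_le_compat_l; [lra|]. unfold T3 in Ht. lra. }
  destruct (cylinder_bounded U q T2 S S HU2 ltac:(lra) ltac:(unfold S; lra)) as [B HB].
  set (A := exp B).
  assert (HA : 0 < A) by apply exp_pos.
  assert (Hlow : forall t theta, t <= S -> - ln (2 * / e * (A + S - t)) <= U t theta).
  { apply (lower_bound_from_circles U q T2 (/ e) S A HU2); auto; try lra.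
    - unfold S; lra.
    - intros t theta Ht. specialize (Hq2 t theta ltac:(unfold S in Ht; lra)).
      assert (4 * (2 - e) <= 4 * (/ e * / e)); [|nra].
      assert (2 - e <= / e); [|nra].
      apply (Rmult_le_reg_l e); [lra|]. rewrite Rinv_r by lra. nra.
    - intro theta. specialize (HB S theta ltac:(lra)). apply Rabs_le_between in HB.
      rewrite ln_mult by lra. unfold A. rewrite ln_exp.
      assert (0 <= ln (2 * / e)); [|lra]. rewrite <- ln_1. apply ln_le; lra. }
  (* [S - t] and [A + S - t] are both [- t] up to a factor close to 1 *)
  set (tau := - ((Rabs S + A) / (1 - e)) - 1).
  exists (Rmin S tau). intros t theta Ht.
  Rmin_bounds S tau.
  assert (Hsa : Rabs S + A <= (1 - e) * - t).
  { assert (Hx : (Rabs S + A) / (1 - e) <= - t) by (unfold tau in *; lra).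
    replace (Rabs S + A) with ((1 - e) * ((Rabs S + A) / (1 - e))) by (field; lra).
    apply Rmult_le_compat_l; lra. }
  pose proof (Rle_abs S) as S1. pose proof (Rle_abs (- S)) as S2. rewrite Rabs_Ropp in S2.
  assert (Ht0 : 0 < - t).
  { pose proof (Rabs_pos S). apply (Rmult_lt_reg_l (1 - e)); lra. }
  specialize (Hup t theta ltac:(lra)). specialize (Hlow t theta ltac:(lra)).
  assert (E1 : ln (e * - t) <= ln (S - t)) by (apply ln_le; nra).
  assert (E2 : ln (A + S - t) <= ln (/ e * - t)).
  { apply ln_le; [nra|]. apply Rle_trans with ((2 - e) * - t); [lra|].
    apply Rmult_le_compat_r; [lra|].
    apply (Rmult_le_reg_l e); [lra|]. rewrite Rinv_r by lra. nra. }
  rewrite ln_mult in E1 by lra. rewrite ln_mult in E2 by lra.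
  rewrite ln_Rinv in E2 by lra.
  rewrite ln_mult in Hup by nra. rewrite (ln_mult 2 e) in Hup by lra.
  rewrite ln_mult in Hlow by nra. rewrite (ln_mult 2 (/ e)), ln_Rinv in Hlow by lra.
  replace (- 2 * t) with (2 * - t) by ring. rewrite (ln_mult 2 (- t)) by lra.
  rewrite Rminus_0_r. apply Rabs_le. lra.
Qed.

(** * Decay of the derivatives on the half cylinder *)

Definition eventually_left (P : R -> Prop) : Prop :=
  exists tau, forall t, t < tau -> P t.

Lemma eventually_left_and P Q :
  eventually_left P -> eventually_left Q -> eventually_left (fun t => P t /\ Q t).
Proof.
  intros [t1 H1] [t2 H2]. exists (Rmin t1 t2). intros t Ht.
  Rmin_bounds t1 t2.
  split; [apply H1|apply H2]; lra.
Qed.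

(** Smallness of the data in the interior estimates on squares of a fixed size:
    the oscillation of [U], and the right-hand side [f] of its equation. *)
Definition small_on_squares (U : R -> R -> R) (f : R -> R -> R) (r eps t : R) : Prop :=
  forall theta x y, Rabs x <= r ->
    Rabs (U (t + x) (theta + y) - U t theta) <= eps /\
    exp (U (t + x) (theta + y)) <= eps /\ Rabs (f (t + x) (theta + y)) <= eps.

(** [U] is close to [- ln (- 2 t)], a function of [t] which varies little over
    bounded intervals when [t] is very negative, and [exp U] is of order [1 /
    |t|]. *)
Lemma oscillation_vanishes U q r :
  uniform_limit (fun t theta => U t theta + ln (- 2 * t)) 0 -> uniform_limit q 4 ->
  0 < r -> forall eps, 0 < eps ->
  eventually_left (small_on_squares U (fun t theta => q t theta * exp (2 * U t theta)) r eps).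
Proof.
  intros HU Hq Hr eps Heps.
  set (e := Rmin (eps / 5) (/ 5)).
  assert (He : 0 < e) by (apply Rmin_glb_lt; lra).
  pose proof (Rmin_l (eps / 5) (/ 5)) as E1; pose proof (Rmin_r (eps / 5) (/ 5)) as E2.
  fold e in E1, E2.
  destruct (HU e He) as [T1 HT1]. destruct (Hq 1 ltac:(lra)) as [T2 HT2].
  set (big := - r - (r + 1) / e - 1).
  exists (Rmin (Rmin T1 T2 - r) big). intros t Ht theta x y Hx.
  Rmin_bounds (Rmin T1 T2 - r) big.
  Rmin_bounds T1 T2.
  apply Rabs_le_between in Hx.
  assert (Hre : 0 < (r + 1) / e) by (apply Rdiv_lt_0_compat; lra).
  assert (Hbig : r + 1 <= e * (- t - r)).
  { replace (r + 1) with (e * ((r + 1) / e)) by (field; lra).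
    apply Rmult_le_compat_l; unfold big in *; lra. }
  assert (Ht0 : 0 < - t - r) by (unfold big in *; lra).
  assert (Hlnle : forall u v, t - r <= u <= t + r -> t - r <= v <= t + r ->
     Rabs (u - v) <= r -> ln (- 2 * u) <= ln (- 2 * v) + e).
  { intros u v Hu Hv Huv. rewrite <- (ln_exp e), <- ln_mult; [|lra|apply exp_pos].
    apply ln_le; [lra|]. pose proof (exp_ineq1_le e) as Hexp.
    apply Rabs_le_between in Huv.
    apply Rle_trans with (- 2 * v * (1 + e)); [nra|].
    apply Rmult_le_compat_l; lra. }
  pose proof (Hlnle t (t + x) ltac:(lra) ltac:(lra) ltac:(apply Rabs_le; lra)) as L1.
  pose proof (Hlnle (t + x) t ltac:(lra) ltac:(lra) ltac:(apply Rabs_le; lra)) as L2.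
  pose proof (HT1 t theta ltac:(lra)) as A1.
  pose proof (HT1 (t + x) (theta + y) ltac:(lra)) as A2.
  pose proof (HT2 (t + x) (theta + y) ltac:(lra)) as A3.
  rewrite Rminus_0_r in A1, A2. apply Rabs_le_between in A1, A2, A3.
  assert (HE : exp (U (t + x) (theta + y)) <= e).
  { rewrite <- (exp_ln e He). apply exp_le.
    (* [U] is at most [e - ln (- 2 (t + x))]; this is to be at most [ln e] *)
    assert (K : ln (/ e * exp e) <= ln (- 2 * (t + x))).
    { apply ln_le; [apply Rmult_lt_0_compat; [apply Rinv_0_lt_compat, He|apply exp_pos]|].
      apply (Rmult_le_reg_l e); [exact He|].
      rewrite <- Rmult_assoc, Rinv_r, Rmult_1_l by lra.
      assert (2 * (r + 1) <= e * (-2 * (t + x))) by nra.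
      assert (1 <= / e) by (rewrite <- Rinv_1; apply Rinv_le_contravar; lra).
      assert (exp e <= 2).
      { pose proof (exp_ineq1_le (- e)) as Hm. rewrite exp_Ropp in Hm.
        pose proof (exp_pos e). apply (Rmult_le_reg_l (/ exp e)).
        - apply Rinv_0_lt_compat; lra.
        - rewrite Rinv_l by lra. lra. }
      lra. }
    rewrite ln_mult, ln_Rinv, ln_exp in K;
      [|exact He|apply Rinv_0_lt_compat, He|apply exp_pos].
    lra. }
  pose proof (exp_pos (U (t + x) (theta + y))) as HE0.
  split; [apply Rabs_le; lra|split; [lra|]].
  rewrite exp_double. set (z := exp (U (t + x) (theta + y))) in *.
  rewrite Rabs_mult, (Rabs_pos_eq (z * z)) by nra.
  assert (Rabs (q (t + x) (theta + y)) <= 5) by (apply Rabs_le; lra).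
  assert (z * z <= e * / 5) by (apply Rmult_le_compat; lra).
  pose proof (Rabs_pos (q (t + x) (theta + y))).
  apply Rle_trans with (5 * (e * / 5)); [apply Rmult_le_compat; nra|lra].
Qed.

Lemma cylinder_square U q T r eps t theta :
  cylinder_solution U q T -> t + r < T ->
  small_on_squares U (fun t theta => q t theta * exp (2 * U t theta)) r eps t ->
  bounded_on_square (fun u v => U u v - U t theta) t theta r eps eps.
Proof.
  intros HU HT Hs x y Hx Hy.
  destruct (Hs theta (x - t) (y - theta) Hx) as (S1 & _ & S3).
  replace (t + (x - t)) with x in * by ring.
  replace (theta + (y - theta)) with y in * by ring.
  split; [exact S1|]. apply Rabs_le_between in Hx.
  destruct (proj1 HU x y ltac:(lra)) as (p & s & a & b & c & d & J & E).
  exists p, s, a, b, c, d. split; [apply jet2_minus_const, J|rewrite E; exact S3].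
Qed.

Lemma derive_le_of_symmetric_difference (g : R -> R) (x l C : R) :
  is_derive g x l -> (forall h, 0 < h <= 1 -> Rabs (g (x + h) - g (x - h)) <= C * h) ->
  Rabs l <= C / 2.
Proof.
  intros Hg HC. apply is_derive_Reals in Hg. apply Rnot_lt_le. intro Hlt.
  destruct (Hg ((Rabs l - C / 2) / 2) ltac:(lra)) as [d Hd].
  set (h := Rmin (d / 2) 1).
  assert (Hh0 : 0 < h) by (pose proof (cond_pos d); apply Rmin_glb_lt; lra).
  pose proof (Rmin_l (d / 2) 1) as M1; pose proof (Rmin_r (d / 2) 1) as M2. fold h in M1, M2.
  pose proof (cond_pos d).
  pose proof (Hd h ltac:(lra) ltac:(rewrite Rabs_pos_eq; lra)) as D1.
  pose proof (Hd (- h) ltac:(lra) ltac:(rewrite Rabs_Ropp, Rabs_pos_eq; lra)) as D2.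
  specialize (HC h ltac:(lra)). replace (x + - h) with (x - h) in D2 by ring.
  set (e := (Rabs l - C / 2) / 2) in *.
  assert (E : 2 * l = (g (x + h) - g (x - h)) / h - ((g (x + h) - g x) / h - l)
                - ((g (x - h) - g x) / - h - l)) by (field; lra).
  assert (Rabs ((g (x + h) - g (x - h)) / h) <= C).
  { unfold Rdiv. rewrite Rabs_mult, (Rabs_pos_eq (/ h)) by (left; apply Rinv_0_lt_compat; lra).
    apply (Rmult_le_reg_r h); [lra|]. rewrite Rmult_assoc, Rinv_l by lra. lra. }
  assert (Rabs (2 * l) = 2 * Rabs l) by (rewrite Rabs_mult, (Rabs_pos_eq 2); lra).
  assert (Rabs (2 * l) < C + 2 * e).
  { rewrite E. unfold Rminus at 1 2.
    eapply Rle_lt_trans; [apply Rabs_triang|]. rewrite Rabs_Ropp.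
    pose proof (Rabs_triang ((g (x + h) - g (x - h)) / h) (- ((g (x + h) - g x) / h - l))) as T1.
    rewrite Rabs_Ropp in T1. unfold Rminus in *. lra. }
  unfold e in *. lra.
Qed.

Lemma gradient_vanishes U q T :
  cylinder_solution U q T ->
  uniform_limit (fun t theta => U t theta + ln (- 2 * t)) 0 -> uniform_limit q 4 ->
  forall eps, 0 < eps -> eventually_left (fun t => forall theta p r a b c d,
    jet2 U t theta p r a b c d -> Rabs p <= eps /\ Rabs r <= eps).
Proof.
  intros HU HL Hq eps Heps.
  destruct (oscillation_vanishes U q 1 HL Hq ltac:(lra) (eps / 3) ltac:(lra)) as [tau Htau].
  exists (Rmin tau (T - 1)). intros t Ht theta p r a b c d J.
  Rmin_bounds tau (T - 1).
  specialize (Htau t ltac:(lra)).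
  pose proof (cylinder_square U q T 1 (eps / 3) t theta HU ltac:(lra) Htau) as Hb.
  destruct J as (P & Q & JL & <- & <- & _). apply locally_2d_singleton in JL.
  destruct (differentiable_pt_lim_partials _ _ _ _ _ JL) as [Dx Dy].
  replace eps with (2 * eps / 2) by field. split.
  - apply (derive_le_of_symmetric_difference _ _ _ _ Dx). intros h Hh.
    pose proof (horizontal_difference _ t theta 1 (eps / 3) (eps / 3) ltac:(lra) ltac:(lra) Hb h
      ltac:(rewrite Rabs_pos_eq; lra)) as D. rewrite (Rabs_pos_eq h) in D by lra.
    replace (U (t + h) theta - U (t - h) theta) with
      (U (t + h) theta - U t theta - (U (t - h) theta - U t theta)) by ring. lra.
  - apply (derive_le_of_symmetric_difference _ _ _ _ Dy). intros h Hh.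
    pose proof (vertical_difference _ t theta 1 (eps / 3) (eps / 3) ltac:(lra) ltac:(lra) Hb h
      ltac:(rewrite Rabs_pos_eq; lra)) as D. rewrite (Rabs_pos_eq h) in D by lra.
    replace (U t (theta + h) - U t (theta - h)) with
      (U t (theta + h) - U t theta - (U t (theta - h) - U t theta)) by ring. lra.
Qed.

(** Displacements along the axes suffice, since reflections and rotated
    reflections are composed of them. *)
Definition axis_holder (f : R -> R -> R) (alpha eps t : R) : Prop :=
  (forall t1 t2 theta, Rabs (t1 - t) <= 3 -> Rabs (t2 - t) <= 3 -> t1 <> t2 ->
     Rabs (t1 - t2) <= 2 -> Rabs (f t1 theta - f t2 theta) <= eps * Rpower (Rabs (t1 - t2)) alpha) /\
  (forall t1 th1 th2, Rabs (t1 - t) <= 3 -> th1 <> th2 ->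
     Rabs (th1 - th2) <= 2 -> Rabs (f t1 th1 - f t1 th2) <= eps * Rpower (Rabs (th1 - th2)) alpha).

(** The factor [exp (2 U)] is Lipschitz with a small constant by the gradient
    estimate, and on bounded distances a Lipschitz bound is a Hoelder bound. *)
Lemma laplacian_holder_vanishes U q T alpha :
  cylinder_solution U q T -> 0 < alpha <= 1 ->
  uniform_limit (fun t theta => U t theta + ln (- 2 * t)) 0 -> uniform_limit q 4 ->
  (forall eps, 0 < eps -> eventually_left (axis_holder q alpha eps)) ->
  forall eps, 0 < eps ->
    eventually_left (axis_holder (fun t theta => q t theta * exp (2 * U t theta)) alpha eps).
Proof.
  intros HU Ha HL Hq Hqh eps Heps.
  set (e := Rmin (eps / 100) (/ 2)).
  assert (He : 0 < e) by (apply Rmin_glb_lt; lra).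
  pose proof (Rmin_l (eps / 100) (/ 2)) as E1; pose proof (Rmin_r (eps / 100) (/ 2)) as E2.
  fold e in E1, E2.
  destruct (oscillation_vanishes U q 1 HL Hq ltac:(lra) e He) as [T1 HT1].
  destruct (Hq 1 ltac:(lra)) as [T2 HT2].
  destruct (Hqh e He) as [T3 HT3].
  set (m := Rmin (Rmin T T1) (Rmin T2 T3)).
  exists (m - 4). intros t Ht.
  assert (Hm : m <= T /\ m <= T1 /\ m <= T2 /\ m <= T3).
  { Rmin_bounds (Rmin T T1) (Rmin T2 T3).
    Rmin_bounds T T1.
    Rmin_bounds T2 T3. unfold m; lra. }
  destruct Hm as (Hm0 & Hm1 & Hm2 & Hm3).
  assert (Hexp : forall s phi, s < m -> exp (2 * U s phi) <= 1 /\ Rabs (q s phi) <= 5 /\ U s phi <= 0).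
  { intros s phi Hs.
    destruct (HT1 s ltac:(lra) phi 0 0 ltac:(rewrite Rabs_R0; lra)) as (_ & K & _).
    rewrite !Rplus_0_r in K.
    assert (HU0 : U s phi <= 0).
    { apply Rnot_lt_le. intro Hlt. apply exp_increasing in Hlt. rewrite exp_0 in Hlt. lra. }
    split; [rewrite <- exp_0; apply exp_le; lra|split; [|exact HU0]].
    specialize (HT2 s phi ltac:(lra)). apply Rabs_le_between in HT2. apply Rabs_le; lra. }
  assert (Hprod : forall s1 s2 phi1 phi2 D, s1 < m -> s2 < m -> 0 < D <= 2 ->
     Rabs (q s1 phi1 - q s2 phi2) <= e * Rpower D alpha ->
     Rabs (U s1 phi1 - U s2 phi2) <= 3 * e * D ->
     Rabs (q s1 phi1 * exp (2 * U s1 phi1) - q s2 phi2 * exp (2 * U s2 phi2))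
       <= eps * Rpower D alpha).
  { intros s1 s2 phi1 phi2 D Hs1 Hs2 HD Hqd HUd.
    destruct (Hexp s1 phi1 Hs1) as (X1 & X2 & X3). destruct (Hexp s2 phi2 Hs2) as (Y1 & Y2 & Y3).
    pose proof (exp_difference_le (2 * U s1 phi1) (2 * U s2 phi2) 0 ltac:(lra) ltac:(lra)) as X4.
    rewrite exp_0, Rmult_1_l in X4.
    replace (2 * U s1 phi1 - 2 * U s2 phi2) with (2 * (U s1 phi1 - U s2 phi2)) in X4 by ring.
    rewrite Rabs_mult, (Rabs_pos_eq 2) in X4 by lra.
    pose proof (le_Rpower_of_le_2 D alpha HD Ha) as HDp.
    pose proof (Rpower_pos D alpha) as HDpos.
    replace (q s1 phi1 * exp (2 * U s1 phi1) - q s2 phi2 * exp (2 * U s2 phi2)) with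
      ((q s1 phi1 - q s2 phi2) * exp (2 * U s1 phi1)
        + q s2 phi2 * (exp (2 * U s1 phi1) - exp (2 * U s2 phi2))) by ring.
    eapply Rle_trans; [apply Rabs_triang|]. rewrite !Rabs_mult.
    rewrite (Rabs_pos_eq (exp (2 * U s1 phi1))) by (left; apply exp_pos).
    assert (Z1 : Rabs (q s1 phi1 - q s2 phi2) * exp (2 * U s1 phi1) <= e * Rpower D alpha * 1).
    { apply Rmult_le_compat; auto; [apply Rabs_pos|left; apply exp_pos]. }
    assert (Z2 : Rabs (q s2 phi2) * Rabs (exp (2 * U s1 phi1) - exp (2 * U s2 phi2))
              <= 5 * (2 * (3 * e * D))).
    { apply Rmult_le_compat; try apply Rabs_pos; lra. }
    assert (Z3 : 30 * e * D <= 30 * e * (2 * Rpower D alpha)) by (apply Rmult_le_compat_l; lra).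
    assert (Z4 : 61 * e * Rpower D alpha <= eps * Rpower D alpha) by (apply Rmult_le_compat_r; lra).
    lra. }
  destruct (HT3 t ltac:(lra)) as [Hq1 Hq2]. split.
  - intros t1 t2 theta H1 H2 Hne Hd.
    pose proof (Rabs_pos_lt (t1 - t2) ltac:(lra)) as Hpos.
    apply Rabs_le_between in H1, H2.
    apply Hprod; try lra; [apply Hq1; auto; apply Rabs_le; lra|].
    pose proof (horizontal_difference _ ((t1 + t2) / 2) theta 1 e e ltac:(lra) He
      (cylinder_square U q T 1 e ((t1 + t2) / 2) theta HU ltac:(lra) (HT1 ((t1 + t2) / 2) ltac:(lra)))
      ((t1 - t2) / 2)) as K.
    unfold Rdiv in K at 1. rewrite Rabs_mult, (Rabs_pos_eq (/ 2)) in K by lra.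
    specialize (K ltac:(lra)).
    replace ((t1 + t2) / 2 + (t1 - t2) / 2) with t1 in K by field.
    replace ((t1 + t2) / 2 - (t1 - t2) / 2) with t2 in K by field.
    unfold Rdiv in K at 4. rewrite Rabs_mult, (Rabs_pos_eq (/ 2)) in K by lra.
    match type of K with Rabs ?z <= _ => replace z with (U t1 theta - U t2 theta) in K by ring end.
    eapply Rle_trans; [exact K|]. right. field.
  - intros t1 th1 th2 H1 Hne Hd.
    pose proof (Rabs_pos_lt (th1 - th2) ltac:(lra)) as Hpos.
    apply Rabs_le_between in H1.
    apply Hprod; try lra; [apply Hq2; auto; apply Rabs_le; lra|].
    pose proof (vertical_difference _ t1 ((th1 + th2) / 2) 1 e e ltac:(lra) He
      (cylinder_square U q T 1 e t1 ((th1 + th2) / 2) HU ltac:(lra) (HT1 t1 ltac:(lra)))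
      ((th1 - th2) / 2)) as K.
    assert (Eh : Rabs ((th1 - th2) / 2) = Rabs (th1 - th2) / 2).
    { unfold Rdiv. rewrite Rabs_mult, (Rabs_pos_eq (/ 2)) by lra. reflexivity. }
    rewrite Eh in K. specialize (K ltac:(lra)).
    replace ((th1 + th2) / 2 + (th1 - th2) / 2) with th1 in K by field.
    replace ((th1 + th2) / 2 - (th1 - th2) / 2) with th2 in K by field.
    match type of K with Rabs ?z <= _ => replace z with (U t1 th1 - U t1 th2) in K by ring end.
    eapply Rle_trans; [exact K|]. right. field.
Qed.

(** The quantity [b + c] is estimated directly, and [a - d] becomes the mixed
    derivative in coordinates rotated by an eighth of a turn. *)
Lemma hessian_vanishes U q T alpha :
  cylinder_solution U q T -> 0 < alpha <= 1 ->
  uniform_limit (fun t theta => U t theta + ln (- 2 * t)) 0 -> uniform_limit q 4 ->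
  (forall eps, 0 < eps -> eventually_left (axis_holder q alpha eps)) ->
  forall eps, 0 < eps -> eventually_left (fun t => forall theta p r a b c d,
    jet2 U t theta p r a b c d -> Rabs (b + c) <= eps /\ Rabs (a - d) <= eps).
Proof.
  intros HU Ha HL Hq Hqh eps Heps.
  set (f := fun t theta => q t theta * exp (2 * U t theta)).
  set (K := 20 + 24 / alpha).
  assert (HK : 0 < K).
  { unfold K. assert (0 < 24 / alpha) by (apply Rdiv_lt_0_compat; lra). lra. }
  set (e := eps / K).
  assert (He : 0 < e) by (apply Rdiv_lt_0_compat; lra).
  assert (HeK : e * K = eps) by (unfold e; field; lra).
  assert (HeK' : e * (24 / alpha) = eps - 20 * e) by (rewrite <- HeK; unfold K; ring).
  assert (He20 : 0 < e * (24 / alpha)) by (apply Rmult_lt_0_compat; [|apply Rdiv_lt_0_compat]; lra).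
  assert (Hev := eventually_left_and _ _
    (oscillation_vanishes U q 2 HL Hq ltac:(lra) e He)
    (laplacian_holder_vanishes U q T alpha HU Ha HL Hq Hqh e He)).
  destruct Hev as [tau Htau]. fold f in Htau.
  exists (Rmin tau (T - 2)). intros t Ht theta p r a b c d J.
  Rmin_bounds tau (T - 2).
  destruct (Htau t ltac:(lra)) as [Hs [Hh1 Hh2]].
  set (F := fun x y => U (t + x) (theta + y) - U t theta).
  assert (HF : forall x y, Rabs x <= 2 -> (exists p q a b c d, jet2 F x y p q a b c d /\
             a + d = f (t + x) (theta + y))).
  { intros x y Hx. apply Rabs_le_between in Hx.
    destruct (proj1 HU (t + x) (theta + y) ltac:(lra)) as (p' & s & a' & b' & c' & d' & J' & E).
    exists p', s, a', b', c', d'. split; [|exact E].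
    apply (jet2_minus_const (fun u v => U (t + u) (theta + v))), jet2_translate, J'. }
  assert (JF : jet2 F 0 0 p r a b c d).
  { apply (jet2_minus_const (fun u v => U (t + u) (theta + v))), jet2_translate.
    rewrite !Rplus_0_r. exact J. }
  assert (Hmove1 : forall x1 x2 y x, 0 < x <= 1 -> Rabs x1 <= 2 -> Rabs x2 <= 2 ->
     Rabs (x1 - x2) = 2 * x ->
     Rabs (f (t + x1) (theta + y) - f (t + x2) (theta + y)) <= 2 * e * Rpower x alpha).
  { intros x1 x2 y x Hx H1 H2 Hd.
    assert (E12 : t + x1 - (t + x2) = x1 - x2) by ring.
    specialize (Hh1 (t + x1) (t + x2) (theta + y)).
    rewrite E12, Hd in Hh1.
    pose proof (Rpower_double_le x alpha ltac:(lra) Ha).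
    eapply Rle_trans; [apply Hh1; try lra|nra].
    - replace (t + x1 - t) with x1 by ring; lra.
    - replace (t + x2 - t) with x2 by ring; lra.
    - intro E. replace x1 with x2 in Hd by lra. rewrite Rminus_diag, Rabs_R0 in Hd. lra. }
  assert (Hmove2 : forall x1 y1 y2 x, 0 < x <= 1 -> Rabs x1 <= 2 ->
     Rabs (y1 - y2) = 2 * x ->
     Rabs (f (t + x1) (theta + y1) - f (t + x1) (theta + y2)) <= 2 * e * Rpower x alpha).
  { intros x1 y1 y2 x Hx H1 Hd.
    assert (E12 : theta + y1 - (theta + y2) = y1 - y2) by ring.
    specialize (Hh2 (t + x1) (theta + y1) (theta + y2)).
    rewrite E12, Hd in Hh2.
    pose proof (Rpower_double_le x alpha ltac:(lra) Ha).
    eapply Rle_trans; [apply Hh2; try lra|nra].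
    - replace (t + x1 - t) with x1 by ring; lra.
    - intro E. replace y1 with y2 in Hd by lra. rewrite Rminus_diag, Rabs_R0 in Hd. lra. }
  split.
  - assert (Hc : holder_controlled F (fun x y => f (t + x) (theta + y)) alpha e e (2 * e)).
    { intros x y Hx Hy. destruct (Hs theta x y ltac:(lra)) as (S1 & _ & S3).
      split; [apply HF; lra|]. repeat split; [exact S1|exact S3| |]; intro Hpos.
      - rewrite (Rabs_pos_eq x) in Hx by lra.
        apply Hmove1; try lra; try (apply Rabs_le; lra).
        rewrite Rabs_pos_eq by lra. ring.
      - rewrite (Rabs_pos_eq y) in Hy by lra.
        apply Hmove2; try lra. rewrite Rabs_pos_eq by lra. ring. }
    pose proof (mixed_derivative_bound F _ alpha e e (2 * e) p r a b c d Ha He ltac:(lra) Hc JF) as B.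
    assert (3 * (2 * e) / alpha = e * (24 / alpha) / 4) by (field; lra).
    lra.
  - assert (Hsum : forall x y, Rabs x <= 1 -> Rabs y <= 1 -> Rabs (x + y) <= 2 /\ Rabs (x - y) <= 2).
    { intros x y Hx Hy. apply Rabs_le_between in Hx, Hy. split; apply Rabs_le; lra. }
    assert (Hc : holder_controlled (fun x y => F (x + y) (x - y))
        (fun x y => 2 * f (t + (x + y)) (theta + (x - y))) alpha e (2 * e) (8 * e)).
    { intros x y Hx Hy. destruct (Hsum x y Hx Hy) as [Hx2 _].
      destruct (Hs theta (x + y) (x - y) ltac:(lra)) as (S1 & _ & S3). fold f in S3.
      split; [|split; [exact S1|split]].
      - destruct (HF (x + y) (x - y) Hx2) as (p' & s & a' & b' & c' & d' & J' & E).
        do 6 eexists. split.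
        + apply (jet2_affine_change F _ 1 1 0 1 (-1) 0 x y _ _ _ _ _ _ _ _ _ _ _ _ _ _ J');
            try reflexivity; try ring. intros; f_equal; ring.
        + rewrite <- E. ring.
      - rewrite Rabs_mult, (Rabs_pos_eq 2) by lra. lra.
      - assert (Htwo : forall A B C : R, forall z, Rabs (A - B) <= 2 * e * z ->
          Rabs (B - C) <= 2 * e * z -> Rabs (2 * A - 2 * C) <= 8 * e * z).
        { intros A B C z H1 H2.
          replace (2 * A - 2 * C) with (2 * ((A - B) + (B - C))) by ring.
          rewrite Rabs_mult, (Rabs_pos_eq 2) by lra.
          pose proof (Rabs_triang (A - B) (B - C)). lra. }
        split; intro Hpos.
        + rewrite (Rabs_pos_eq x) in Hx by lra. apply Rabs_le_between in Hy.
          apply Htwo with (f (t + (- x + y)) (theta + (x - y))).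
          * apply Hmove1; try lra; try (apply Rabs_le; lra). rewrite Rabs_pos_eq; lra.
          * apply Hmove2; try lra; try (apply Rabs_le; lra). rewrite Rabs_pos_eq; lra.
        + rewrite (Rabs_pos_eq y) in Hy by lra. apply Rabs_le_between in Hx.
          apply Htwo with (f (t + (x + - y)) (theta + (x - y))).
          * apply Hmove1; try lra; try (apply Rabs_le; lra). rewrite Rabs_pos_eq; lra.
          * apply Hmove2; try lra; try (apply Rabs_le; lra). rewrite Rabs_left; lra. }
    assert (JG : jet2 (fun x y => F (x + y) (x - y)) 0 0 (p + r) (p - r)
              (a + b + (c + d)) (a - b + (c - d)) (a + b - (c + d)) (a - b - (c - d))).
    { apply (jet2_affine_change F _ 1 1 0 1 (-1) 0 0 0 _ _ _ _ _ _ _ _ _ _ _ _ _ _ JF); try ring.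
      intros; f_equal; ring. }
    pose proof (mixed_derivative_bound _ _ alpha e (2 * e) (8 * e) _ _ _ _ _ _ Ha ltac:(lra) ltac:(lra) Hc JG) as B.
    replace (a - b + (c - d) + (a + b - (c + d))) with (2 * (a - d)) in B by ring.
    rewrite Rabs_mult, (Rabs_pos_eq 2) in B by lra.
    assert (3 * (8 * e) / alpha = e * (24 / alpha)) by (field; lra).
    lra.
Qed.

(** * Curves and the induced distance *)

Lemma locally_C_square (P : C -> Prop) (z : C) :
  locally z P <-> locally_2d (fun u v => P (u, v)) (Re z) (Im z).
Proof.
  destruct z as [x y]. split.
  - intros [d H]. exists d. intros u v Hu Hv. apply H. split; assumption.
  - intros [d H]. exists d. intros [u v] [Hu Hv]. apply H; assumption.
Qed.

Lemma C_derive_components (g : R -> C) (t : R) (l : C) :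
  is_derive (K := R_AbsRing) (V := C_R_NormedModule) g t l <->
  is_derive (fun s => Re (g s)) t (Re l) /\ is_derive (fun s => Im (g s)) t (Im l).
Proof.
  split.
  - intro H. split.
    + apply (filterdiff_ext_lin _ (fun y : R => fst (scal (V := C_R_NormedModule) y l)));
        [|reflexivity].
      apply (filterdiff_comp (U := R_NormedModule) (V := C_R_NormedModule) (W := R_NormedModule)
        g (fun z : C => fst z) (fun y => scal (V := C_R_NormedModule) y l) fst); [exact H|].
      apply filterdiff_linear, (is_linear_fst (U := R_NormedModule) (V := R_NormedModule)).
    + apply (filterdiff_ext_lin _ (fun y : R => snd (scal (V := C_R_NormedModule) y l)));
        [|reflexivity].
      apply (filterdiff_comp (U := R_NormedModule) (V := C_R_NormedModule) (W := R_NormedModule)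
        g (fun z : C => snd z) (fun y => scal (V := C_R_NormedModule) y l) snd); [exact H|].
      apply filterdiff_linear, (is_linear_snd (U := R_NormedModule) (V := R_NormedModule)).
  - intros [H1 H2].
    apply (filterdiff_ext_locally (V := C_R_NormedModule) (fun s => (Re (g s), Im (g s)))).
    { apply filter_forall. intro s. symmetry. apply surjective_pairing. }
    apply (filterdiff_comp_2 (T := R_NormedModule) (U := R_NormedModule) (V := R_NormedModule)
      (W := C_R_NormedModule) (fun s => Re (g s)) (fun s => Im (g s)) pair
      (fun y : R => scal y (Re l)) (fun y : R => scal y (Im l)) pair H1 H2).
    apply (filterdiff_ext (V := C_R_NormedModule) (fun t : R * R => t)
      (fun t : R * R => (fst t, snd t)) (fun t : R * R => (fst t, snd t)));
      [intro; apply surjective_pairing|].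
    apply (filterdiff_ext_lin (V := C_R_NormedModule) _ (fun t : R * R => t));
      [|intro; apply surjective_pairing].
    apply filterdiff_id.
Qed.

Lemma C_continuous_components (g : R -> C) (t : R) :
  continuous g t <-> continuous (fun s => Re (g s)) t /\ continuous (fun s => Im (g s)) t.
Proof.
  split.
  - intro H. split.
    + apply (continuous_comp g fst); [exact H|]. rewrite (surjective_pairing (g t)).
      apply continuous_fst.
    + apply (continuous_comp g snd); [exact H|]. rewrite (surjective_pairing (g t)).
      apply continuous_snd.
  - intros [H1 H2] P [d Hd]. change (locally t (fun s => P (g s))).
    generalize (filter_and _ _ (proj1 (filterlim_locally _ _) H1 d)
                               (proj1 (filterlim_locally _ _) H2 d)).
    apply filter_imp. intros s [K1 K2]. apply Hd. split; assumption.
Qed.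

Definition continuous_density (lam : C -> R) (z : C) : Prop :=
  continuity_2d_pt (fun x y => lam (x, y)) (Re z) (Im z).

Lemma continuous_along (lam : C -> R) (g : R -> C) (t : R) :
  continuous_density lam (g t) -> continuous g t -> continuous (fun s => lam (g s)) t.
Proof.
  intros Hl Hg. apply (continuous_comp g lam); [exact Hg|].
  apply filterlim_locally. intro eps. specialize (Hl eps).
  apply locally_C_square. revert Hl. apply locally_2d_impl, locally_2d_forall.
  intros u v H. rewrite <- surjective_pairing in H. exact H.
Qed.

Lemma Cmod_continuous_along (g : R -> C) (t : R) :
  continuous g t -> continuous (fun s => Cmod (g s)) t.
Proof.
  intro H. apply C_continuous_components in H. destruct H as [H1 H2]. unfold Cmod.
  apply (continuous_comp (fun s => fst (g s) ^ 2 + snd (g s) ^ 2) sqrt).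
  - simpl. apply (continuous_plus (V := R_NormedModule)
      (fun s => fst (g s) * (fst (g s) * 1)) (fun s => snd (g s) * (snd (g s) * 1)));
      (apply (continuous_mult (K := R_AbsRing)); [assumption|];
       apply (continuous_mult (K := R_AbsRing)); [assumption|apply continuous_const]).
  - apply continuity_pt_filterlim, continuity_pt_sqrt.
    nra.
Qed.

Lemma length_integrand_continuous lam (g dg : R -> C) (t : R) :
  C1_arc g dg -> continuous_density lam (g t) ->
  continuous (fun s => lam (g s) * Cmod (dg s)) t.
Proof.
  intros Hg Hl. destruct (Hg t) as [D1 D2].
  apply (continuous_mult (K := R_AbsRing)).
  - apply continuous_along; [exact Hl|].
    apply (ex_derive_continuous (V := C_R_NormedModule)). exists (dg t). exact D1.
  - apply Cmod_continuous_along, D2.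
Qed.

Lemma C1_arc_of_components (f1 f2 d1 d2 : R -> R) :
  (forall t, is_derive f1 t (d1 t) /\ continuous d1 t) ->
  (forall t, is_derive f2 t (d2 t) /\ continuous d2 t) ->
  C1_arc (fun t => (f1 t, f2 t)) (fun t => (d1 t, d2 t)).
Proof.
  intros H1 H2 t. split.
  - apply C_derive_components. split; [apply H1|apply H2].
  - apply C_continuous_components. split; [apply H1|apply H2].
Qed.

Lemma curve_length_segment Omega lam (z w : C) :
  (forall s, 0 <= s <= 1 ->
     Omega (Re z + s * (Re w - Re z), Im z + s * (Im w - Im z))) ->
  exists l, curve_length Omega lam z w l.
Proof.
  intro H.
  assert (HC := curve_arc Omega lam
    (fun s => (Re z + s * (Re w - Re z), Im z + s * (Im w - Im z)))
    (fun _ => (Re w - Re z, Im w - Im z))).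
  assert (E0 : forall a b, a + 0 * (b - a) = a) by (intros; ring).
  assert (E1 : forall a b, a + 1 * (b - a) = b) by (intros; ring).
  cbv beta in HC. rewrite !E0, !E1 in HC.
  replace (Re z, Im z) with z in HC by apply surjective_pairing.
  replace (Re w, Im w) with w in HC by apply surjective_pairing.
  eexists. apply HC; [|exact H].
  apply C1_arc_of_components; intro t; (split; [auto_derive; auto; ring|apply continuous_const]).
Qed.

Lemma Rabs_convex_lt (x a b s d : R) :
  Rabs (a - x) < d -> Rabs (b - x) < d -> 0 <= s <= 1 -> Rabs (a + s * (b - a) - x) < d.
Proof.
  intros Ha Hb Hs. replace (a + s * (b - a) - x) with ((1 - s) * (a - x) + s * (b - x)) by ring.
  eapply Rle_lt_trans; [apply Rabs_triang|].
  rewrite !Rabs_mult, (Rabs_pos_eq s), (Rabs_pos_eq (1 - s)) by lra.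
  destruct (Req_dec s 1) as [->|H1]; [lra|].
  assert ((1 - s) * Rabs (a - x) < (1 - s) * d) by (apply Rmult_lt_compat_l; lra).
  assert (s * Rabs (b - x) <= s * d) by (apply Rmult_le_compat_l; lra). lra.
Qed.

(** The points that can be reached from [z] form an open set, and so do the
    other points of [Omega]. *)
Lemma curve_connected Omega lam z w :
  Defs.domain Omega -> Omega z -> Omega w -> exists l, curve_length Omega lam z w l.
Proof.
  intros (_ & Hopen & Hconn) Hz Hw.
  (* small squares are convex, so segments join their points *)
  assert (Hball : forall x, Omega x -> exists d : posreal, forall y y',
     Rabs (Re y - Re x) < d -> Rabs (Im y - Im x) < d ->
     Rabs (Re y' - Re x) < d -> Rabs (Im y' - Im x) < d ->
     Omega y' /\ exists l, curve_length Omega lam y y' l).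
  { intros x Hx. destruct (proj1 (locally_C_square Omega x) (Hopen x Hx)) as [d Hd].
    exists d. intros y y' H1 H2 H3 H4. split.
    - rewrite (surjective_pairing y'). apply Hd; assumption.
    - apply curve_length_segment. intros s Hs.
      apply Hd; apply Rabs_convex_lt; assumption. }
  assert (Hself : forall x (d : posreal), Rabs (Re x - Re x) < d /\ Rabs (Im x - Im x) < d).
  { intros x d. rewrite !Rminus_diag, Rabs_R0. split; apply cond_pos. }
  apply NNPP. intro Hno.
  destruct (Hconn (fun x => Omega x /\ exists l, curve_length Omega lam z x l)
    (fun x => Omega x /\ ~ exists l, curve_length Omega lam z x l)) as (x & _ & [_ A] & [_ B]).
  - intros x [Hx [l Hl]]. destruct (Hball x Hx) as [d Hd].
    apply locally_C_square. exists d. intros u v Hu Hv.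
    destruct (Hd x (u, v) (proj1 (Hself x d)) (proj2 (Hself x d)) Hu Hv) as [Ho [l' Hl']].
    split; [exact Ho|]. exists (l + l'). apply (curve_concat _ _ z x (u, v)); assumption.
  - intros x [Hx Hl]. destruct (Hball x Hx) as [d Hd].
    apply locally_C_square. exists d. intros u v Hu Hv.
    destruct (Hd x (u, v) (proj1 (Hself x d)) (proj2 (Hself x d)) Hu Hv) as [Ho _].
    destruct (Hd (u, v) x Hu Hv (proj1 (Hself x d)) (proj2 (Hself x d))) as [_ [l' Hl']].
    split; [exact Ho|]. intros [l Hl2]. apply Hl.
    exists (l + l'). apply (curve_concat _ _ z (u, v) x); assumption.
  - intros x Hx. destruct (classic (exists l, curve_length Omega lam z x l)); [left|right]; auto.
  - exists z. split; [exact Hz|]. split; [exact Hz|].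
    apply curve_length_segment. intros s Hs. rewrite !Rminus_diag, !Rmult_0_r, !Rplus_0_r.
    rewrite <- surjective_pairing. exact Hz.
  - exists w. auto.
  - exact (B A).
Qed.

Lemma metric_dist_le Omega lam z w l :
  curve_length Omega lam z w l -> Rbar_le (metric_dist Omega lam z w) l.
Proof. intro H. apply (proj1 (Glb_Rbar_correct (curve_length Omega lam z w))), H. Qed.

Lemma metric_dist_ge Omega lam z w (c : R) :
  (forall l, curve_length Omega lam z w l -> c <= l) -> Rbar_le c (metric_dist Omega lam z w).
Proof. intro H. apply (proj2 (Glb_Rbar_correct (curve_length Omega lam z w))). exact H. Qed.

Lemma is_derive_Rmax_sqr (x : R) : is_derive (fun x => Rmax 0 x * Rmax 0 x) x (2 * Rmax 0 x).
Proof.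
  apply is_derive_Reals. intros eps Heps. exists (mkposreal _ Heps).
  intros h Hh0 Hh. cbn [pos] in Hh.
  eapply Rle_lt_trans; [|exact Hh].
  assert (K : Rabs (Rmax 0 (x + h) * Rmax 0 (x + h) - Rmax 0 x * Rmax 0 x - 2 * Rmax 0 x * h)
           <= h * h).
  { unfold Rmax. destruct (Rle_dec 0 (x + h)), (Rle_dec 0 x); apply Rabs_le; nra. }
  replace ((Rmax 0 (x + h) * Rmax 0 (x + h) - Rmax 0 x * Rmax 0 x) / h - 2 * Rmax 0 x) with
    ((Rmax 0 (x + h) * Rmax 0 (x + h) - Rmax 0 x * Rmax 0 x - 2 * Rmax 0 x * h) / h)
    by (field; exact Hh0).
  unfold Rdiv. rewrite Rabs_mult, Rabs_inv.
  pose proof (Rabs_pos_lt h Hh0) as Hp.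
  apply (Rmult_le_reg_r (Rabs h)); [exact Hp|].
  rewrite Rmult_assoc, Rinv_l by lra. rewrite Rmult_1_r.
  rewrite <- Rabs_mult, (Rabs_pos_eq (h * h)) by nra. exact K.
Qed.

(** A compactly supported [C^1] function of small gradient: along a curve it
    changes at most by a multiple of the length, which bounds lengths from below
    without following where the curve leaves a disc. *)
Definition bump (z : C) (r : R) (w : C) : R :=
  let m := Rmax 0 (r * r - ((Re w - Re z) * (Re w - Re z) + (Im w - Im z) * (Im w - Im z))) in
  m * m.

(** By induction along the concatenation of arcs, since changes add up. The
    gradient of the bump is at most [4 r^3], and on its support the density is
    at least [m]. *)
Lemma bump_change_le Omega lam (z : C) (r m : R) :
  0 < r -> 0 < m ->
  (forall w, Omega w -> 0 < lam w /\ continuous_density lam w) ->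
  (forall w, Omega w ->
     (Re w - Re z) * (Re w - Re z) + (Im w - Im z) * (Im w - Im z) <= r * r -> m <= lam w) ->
  forall w w' l, curve_length Omega lam w w' l ->
    Rabs (bump z r w' - bump z r w) <= 4 * (r * r * r) / m * l.
Proof.
  intros Hr Hm Hlam Hlow w w' l HC.
  set (K := 4 * (r * r * r) / m).
  assert (Hr3 : 0 < r * r * r) by (repeat apply Rmult_lt_0_compat; lra).
  assert (HK : 0 < K) by (unfold K; apply Rdiv_lt_0_compat; lra).
  assert (HKm : K * m = 4 * (r * r * r)) by (unfold K; field; lra).
  induction HC as [g dg Hg HO|z1 z2 z3 l12 l23 _ IH1 _ IH2].
  - set (h := fun t => lam (g t) * Cmod (dg t)).
    assert (Hh : forall t, 0 <= t <= 1 -> continuous h t).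
    { intros t Ht. apply length_integrand_continuous; [exact Hg|apply Hlam, HO, Ht]. }
    set (rho := fun t => (Re (g t) - Re z) * (Re (g t) - Re z) + (Im (g t) - Im z) * (Im (g t) - Im z)).
    set (drho := fun t => 2 * ((Re (g t) - Re z) * Re (dg t) + (Im (g t) - Im z) * Im (dg t))).
    set (D := fun t => - (2 * Rmax 0 (r * r - rho t) * drho t)).
    assert (HD : forall t, is_derive (fun t => bump z r (g t)) t (D t)).
    { intro t. destruct (proj1 (C_derive_components g t (dg t)) (proj1 (Hg t))) as [D1 D2].
      assert (DR : is_derive (fun t => r * r - rho t) t (- drho t)).
      { assert (Gen : forall (x y : R -> R) dx dy a b,
          is_derive x t dx -> is_derive y t dy ->
          is_derive (fun t => r * r - ((x t - a) * (x t - a) + (y t - b) * (y t - b))) t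
            (- (2 * ((x t - a) * dx + (y t - b) * dy)))).
        { intros x y dx dy a b Dx Dy.
          auto_derive; [repeat split; eexists; eassumption|].
          pose proof (is_derive_unique x t dx Dx) as Ex.
          pose proof (is_derive_unique y t dy Dy) as Ey.
          change (fun s : R => x s) with x. change (fun s : R => y s) with y.
          cbn in *. rewrite Ex, Ey. ring. }
        exact (Gen _ _ _ _ _ _ D1 D2). }
      apply (is_derive_ext (fun t => (fun x => Rmax 0 x * Rmax 0 x) (r * r - rho t))).
      { intro s. reflexivity. }
      replace (D t) with (scal (- drho t) (2 * Rmax 0 (r * r - rho t))).
      2: { unfold D. change (- drho t * (2 * Rmax 0 (r * r - rho t)) =
             - (2 * Rmax 0 (r * r - rho t) * drho t)). ring. }
      apply (is_derive_comp (fun x => Rmax 0 x * Rmax 0 x) (fun t => r * r - rho t));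
        [apply is_derive_Rmax_sqr|exact DR]. }
    assert (HDc : forall t, continuous D t).
    { intro t. destruct (proj1 (C_derive_components g t (dg t)) (proj1 (Hg t))) as [D1 D2].
      destruct (proj1 (C_continuous_components dg t) (proj2 (Hg t))) as [C3 C4].
      assert (C1 : continuous (fun s => Re (g s)) t)
        by (apply (ex_derive_continuous (V := R_NormedModule)); eexists; exact D1).
      assert (C2 : continuous (fun s => Im (g s)) t)
        by (apply (ex_derive_continuous (V := R_NormedModule)); eexists; exact D2).
      apply continuity_pt_filterlim in C1, C2, C3, C4. apply continuity_pt_filterlim.
      assert (Cm : forall x, continuity_pt (fun x => Rmax 0 x) x).
      { intros x eps He. exists eps. split; [exact He|]. intros y [_ Hy].
        eapply Rle_lt_trans; [|exact Hy]. unfold Rlimit.dist, R_met, Rdist; simpl.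
        unfold Rmax. destruct (Rle_dec 0 y), (Rle_dec 0 x); unfold Rabs;
          repeat destruct Rcase_abs; lra. }
      assert (Cr : continuity_pt (fun t => r * r - rho t) t).
      { unfold rho. repeat first [assumption | apply continuity_pt_minus | apply continuity_pt_plus
          | apply continuity_pt_mult | apply continuity_pt_const; intros ? ?; reflexivity]. }
      unfold D, drho.
      apply continuity_pt_opp, continuity_pt_mult.
      - apply continuity_pt_mult; [apply continuity_pt_const; intros ? ?; reflexivity|].
        apply (continuity_pt_comp (fun t => r * r - rho t) (fun x => Rmax 0 x)); [exact Cr|apply Cm].
      - repeat first [assumption | apply continuity_pt_minus | apply continuity_pt_plus
          | apply continuity_pt_mult | apply continuity_pt_const; intros ? ?; reflexivity]. }
    assert (HDb : forall t, 0 <= t <= 1 -> Rabs (D t) <= K * h t).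
    { intros t Ht. destruct (Hlam (g t) (HO t Ht)) as [Hl0 _].
      pose proof (Cmod_ge_0 (dg t)) as Hc0.
      assert (Hh0 : 0 <= h t) by (unfold h; apply Rmult_le_pos; lra).
      unfold D, Rmax. destruct (Rle_dec 0 (r * r - rho t)) as [Hle|Hgt].
      - assert (Hl : m <= lam (g t)) by (apply Hlow; [apply HO, Ht|fold (rho t); lra]).
        rewrite Rabs_Ropp, !Rabs_mult, (Rabs_pos_eq 2), (Rabs_pos_eq (r * r - rho t)) by lra.
        assert (Hdr : Rabs (drho t) <= 2 * (r * Cmod (dg t))).
        { unfold drho. rewrite Rabs_mult, (Rabs_pos_eq 2) by lra.
          apply Rmult_le_compat_l; [lra|].
          apply Rsqr_incr_0_var; [|apply Rmult_le_pos; lra].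
          rewrite <- Rsqr_abs. unfold Rsqr.
          assert (EC : Cmod (dg t) * Cmod (dg t) = Re (dg t) * Re (dg t) + Im (dg t) * Im (dg t)).
          { unfold Cmod. rewrite sqrt_sqrt by nra. unfold Re, Im. ring. }
          replace (r * Cmod (dg t) * (r * Cmod (dg t))) with
            (r * r * (Cmod (dg t) * Cmod (dg t))) by ring.
          rewrite EC. fold (rho t) in *.
          set (a := Re (g t) - Re z) in *. set (b := Im (g t) - Im z) in *.
          set (c := Re (dg t)). set (d := Im (dg t)).
          assert (Hab : a * a + b * b <= r * r) by (unfold rho in Hle; fold a b in Hle; lra).
          apply Rle_trans with ((a * a + b * b) * (c * c + d * d)).
          - pose proof (pow2_ge_0 (a * d - b * c)). nra.
          - apply Rmult_le_compat_r; [nra|exact Hab]. }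
        assert (Hrho0 : 0 <= rho t).
        { unfold rho. apply Rplus_le_le_0_compat; apply Rle_0_sqr. }
        apply Rle_trans with (2 * (r * r) * (2 * (r * Cmod (dg t)))).
        { apply Rmult_le_compat; try apply Rabs_pos; try lra. }
        replace (2 * (r * r) * (2 * (r * Cmod (dg t)))) with (K * (m * Cmod (dg t)))
          by (rewrite <- Rmult_assoc, HKm; ring).
        apply Rmult_le_compat_l; [lra|]. apply Rmult_le_compat_r; lra.
      - rewrite Rmult_0_r, Rmult_0_l, Ropp_0, Rabs_R0. nra. }
    assert (HI : is_RInt D 0 1 (bump z r (g 1) - bump z r (g 0))).
    { apply (is_RInt_derive (V := R_CompleteNormedModule) (fun t => bump z r (g t)) D); intros; auto. }
    assert (Hexh : ex_RInt h 0 1).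
    { apply (ex_RInt_continuous (V := R_CompleteNormedModule)). intros t Ht.
      rewrite Rmin_left, Rmax_right in Ht by lra. apply Hh, Ht. }
    rewrite <- (is_RInt_unique _ _ _ _ HI).
    assert (HexK : ex_RInt (fun t => K * h t) 0 1) by (apply (ex_RInt_scal (V := R_NormedModule)), Hexh).
    assert (EK : RInt (fun t => K * h t) 0 1 = K * RInt h 0 1)
      by (apply (RInt_scal (V := R_CompleteNormedModule)), Hexh).
    assert (HexD : ex_RInt D 0 1) by (eexists; exact HI).
    rewrite <- EK.
    eapply Rle_trans; [apply abs_RInt_le; [lra|exact HexD]|].
    apply RInt_le; [lra| |exact HexK|].
    + apply ex_RInt_norm, HexD.
    + intros t Ht. apply HDb. lra.
  - replace (bump z r z3 - bump z r z1) with
      ((bump z r z2 - bump z r z1) + (bump z r z3 - bump z r z2)) by ring.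
    eapply Rle_trans; [apply Rabs_triang|]. rewrite Rmult_plus_distr_l. lra.
Qed.

(** * The logarithmic coordinate at a puncture *)

Definition cexp (t theta : R) : C := (exp t * cos theta, exp t * sin theta).

Definition log_density (lam : C -> R) (t theta : R) : R := ln (lam (cexp t theta)) + t.

Lemma Cmod_cexp t theta : Cmod (cexp t theta) = exp t.
Proof.
  unfold Cmod, cexp; cbn [fst snd].
  replace ((exp t * cos theta) ^ 2 + (exp t * sin theta) ^ 2) with
    (exp t * exp t * (Rsqr (sin theta) + Rsqr (cos theta))) by (unfold Rsqr; ring).
  rewrite sin2_cos2, Rmult_1_r. apply sqrt_square. left; apply exp_pos.
Qed.

Lemma cexp_zero t : cexp t 0 = (exp t, 0).
Proof. unfold cexp. rewrite cos_0, sin_0. f_equal; ring. Qed.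

Lemma cexp_surjective (z : C) : z <> RtoC 0 -> exists t theta, z = cexp t theta.
Proof.
  intro Hz. assert (Hm : 0 < Cmod z) by (apply Cmod_gt_0, Hz).
  destruct z as [x y]. set (m := Cmod (x, y)) in *.
  assert (Em : m * m = x * x + y * y).
  { unfold m, Cmod; cbn [fst snd]. rewrite sqrt_sqrt by nra. ring. }
  set (c := x / m). set (s := y / m).
  assert (Ecs : c * c + s * s = 1).
  { unfold c, s. replace (x / m * (x / m) + y / m * (y / m)) with ((x * x + y * y) / (m * m))
      by (field; lra). rewrite <- Em. field. lra. }
  assert (Hc : -1 <= c <= 1) by nra.
  exists (ln m). unfold cexp. rewrite exp_ln by exact Hm.
  assert (Hs : exists theta, cos theta = c /\ sin theta = s).
  { assert (Hsq : sqrt (1 - Rsqr c) = Rabs s).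
    { rewrite <- sqrt_Rsqr_abs. f_equal. unfold Rsqr. lra. }
    destruct (Rle_or_lt 0 s) as [H|H].
    - exists (acos c). rewrite cos_acos, sin_acos, Hsq, Rabs_pos_eq by lra. auto.
    - exists (- acos c). rewrite cos_neg, sin_neg, cos_acos, sin_acos, Hsq, Rabs_left by lra.
      split; ring. }
  destruct Hs as (theta & Ec & Es). exists theta. rewrite Ec, Es. unfold c, s. f_equal; field; lra.
Qed.

(** The supremum of the initial segments on which [Q] holds must be [1]. *)
Lemma locally_constant_01 (Q : R -> Prop) :
  (forall s, 0 <= s <= 1 -> locally s Q \/ locally s (fun u => ~ Q u)) -> Q 0 -> Q 1.
Proof.
  intros HL H0.
  set (E := fun s => 0 <= s <= 1 /\ forall u, 0 <= u <= s -> Q u).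
  assert (E0 : E 0).
  { split; [lra|]. intros u Hu. replace u with 0 by lra. exact H0. }
  destruct (completeness E) as [m [Hub Hlub]].
  { exists 1. intros s [Hs _]. lra. }
  { exists 0. exact E0. }
  assert (Hm : 0 <= m <= 1).
  { split; [apply Hub, E0|]. apply Hlub. intros s [Hs _]. lra. }
  assert (Hnear : forall d, 0 < d -> exists s, E s /\ m - d < s <= m).
  { intros d Hd. apply NNPP. intro Hn.
    assert (m <= m - d); [|lra]. apply Hlub. intros s Hs.
    apply Rnot_lt_le. intro Hlt. apply Hn. exists s. split; [exact Hs|]. split; [exact Hlt|apply Hub, Hs]. }
  destruct (HL m Hm) as [[d Hd]|[d Hd]].
  - destruct (Hnear d (cond_pos d)) as (s & [Hs1 Hs2] & Hs3).
    assert (Hext : forall u, 0 <= u -> u < m + d -> Q u).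
    { intros u Hu1 Hu2. destruct (Rle_or_lt u s) as [Hus|Hus]; [apply Hs2; lra|].
      apply Hd. change (Rabs (u - m) < d). apply Rabs_def1; lra. }
    pose proof (cond_pos d).
    destruct (Req_dec m 1) as [->|Hne]; [apply Hext; lra|].
    set (s' := Rmin 1 (m + d / 2)).
    Rmin_bounds 1 (m + d / 2).
    assert (Hms : m < s') by (apply Rmin_glb_lt; lra).
    assert (Hs' : E s').
    { split; [unfold s' in *; lra|]. intros u Hu. apply Hext; unfold s' in *; lra. }
    pose proof (Hub s' Hs'). lra.
  - destruct (Hnear d (cond_pos d)) as (s & [Hs1 Hs2] & Hs3). exfalso.
    apply (Hd s).
    + change (Rabs (s - m) < d). pose proof (cond_pos d). apply Rabs_def1; lra.
    + apply Hs2. lra.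
Qed.

Lemma Rabs_cexp_lt t theta d : exp t < d ->
  Rabs (exp t * cos theta) < d /\ Rabs (exp t * sin theta) < d.
Proof.
  intro H. pose proof (exp_pos t).
  pose proof (COS_bound theta); pose proof (SIN_bound theta).
  split; apply Rabs_def1; nra.
Qed.

(** Membership in [Omega] is locally constant away from the boundary of [Omega].
    A point of [Omega] near [0] is joined to any other point of the punctured
    disc by a segment in the logarithmic coordinate. *)
Lemma punctured_neighbourhood (Omega : C -> Prop) :
  open Omega -> isolated_boundary_point Omega (RtoC 0) ->
  exists T, forall t theta, t < T -> Omega (cexp t theta).
Proof.
  intros Hopen [Hb [d Hd]].
  assert (H0 : ~ Omega (RtoC 0)).
  { intro H0. destruct (Hb Omega (Hopen _ H0)) as [_ (w & H1 & H2)]. exact (H2 H1). }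
  exists (ln d).
  assert (Hd0 := cond_pos d).
  assert (Hexp : forall t, t < ln d -> exp t < d).
  { intros t Ht. rewrite <- (exp_ln d Hd0). apply exp_increasing, Ht. }
  assert (Hnb : forall t theta, t < ln d -> ~ boundary Omega (cexp t theta)).
  { intros t theta Ht. apply Hd.
    - destruct (Rabs_cexp_lt t theta d (Hexp t Ht)) as [H1 H2].
      split; [change (Rabs (exp t * cos theta - 0) < d)|change (Rabs (exp t * sin theta - 0) < d)];
        rewrite Rminus_0_r; assumption.
    - intro E. pose proof (Cmod_cexp t theta) as EM. rewrite E, Cmod_0 in EM.
      pose proof (exp_pos t). lra. }
  assert (Hstart : exists t0 theta0, t0 < ln d /\ Omega (cexp t0 theta0)).
  { assert (Hd2 : 0 < d / 2) by lra.
    destruct (Hb (ball (RtoC 0) (mkposreal _ Hd2))) as [(w & H1 & H2) _]; [apply locally_ball|].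
    destruct (cexp_surjective w) as (t & theta & E); [intros ->; exact (H0 H2)|].
    exists t, theta. split; [|rewrite <- E; exact H2].
    apply exp_lt_inv. rewrite exp_ln by exact Hd0. rewrite <- (Cmod_cexp t theta), <- E.
    destruct H1 as [K1 K2]. change (Rabs (fst w - 0) < d / 2) in K1.
    change (Rabs (snd w - 0) < d / 2) in K2. rewrite Rminus_0_r in K1, K2.
    eapply Rle_lt_trans; [apply Cmod_2Rmax|].
    assert (Hs2 : sqrt 2 < 2).
    { rewrite <- (sqrt_square 2) at 2 by lra. apply sqrt_lt_1; lra. }
    assert (Rmax (Rabs (fst w)) (Rabs (snd w)) < d / 2) by (apply Rmax_lub_lt; assumption).
    pose proof (sqrt_pos 2).
    assert (0 <= Rmax (Rabs (fst w)) (Rabs (snd w))) by (eapply Rle_trans; [apply Rabs_pos|apply Rmax_l]).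
    nra. }
  destruct Hstart as (t0 & theta0 & Ht0 & HO0).
  intros t theta Ht.
  set (X := fun s => exp (t0 + s * (t - t0)) * cos (theta0 + s * (theta - theta0))).
  set (Y := fun s => exp (t0 + s * (t - t0)) * sin (theta0 + s * (theta - theta0))).
  assert (EP0 : (X 0, Y 0) = cexp t0 theta0).
  { unfold X, Y, cexp. rewrite !Rmult_0_l, !Rplus_0_r. reflexivity. }
  assert (EP1 : (X 1, Y 1) = cexp t theta).
  { unfold X, Y, cexp. rewrite !Rmult_1_l.
    replace (t0 + (t - t0)) with t by ring.
    replace (theta0 + (theta - theta0)) with theta by ring. reflexivity. }
  rewrite <- EP1. rewrite <- EP0 in HO0.
  apply (locally_constant_01 (fun s => Omega (X s, Y s))); [|exact HO0]. intros s Hs.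
  assert (Hts : t0 + s * (t - t0) < ln d).
  { destruct (Req_dec s 1) as [->|]; [lra|]. nra. }
  pose proof (Hnb _ (theta0 + s * (theta - theta0)) Hts) as Hn.
  change (~ boundary Omega (X s, Y s)) in Hn.
  assert (HC : continuous (fun s => (X s, Y s) : C) s).
  { apply C_continuous_components. split; apply (ex_derive_continuous (V := R_NormedModule)).
    - change (ex_derive X s). unfold X. auto_derive. auto.
    - change (ex_derive Y s). unfold Y. auto_derive. auto. }
  apply not_all_ex_not in Hn. destruct Hn as [U HU].
  assert (HUl : locally (X s, Y s) U) by (apply NNPP; tauto).
  assert (HUs := HC U HUl). change (locally s (fun u => U (X u, Y u))) in HUs.
  destruct (classic (exists w, U w /\ Omega w)) as [H1|H1].
  - left. revert HUs. apply filter_imp. intros u Hu.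
    apply NNPP. intro Hnu. apply HU. intros _. split; [exact H1|]. exists (X u, Y u). auto.
  - right. revert HUs. apply filter_imp. intros u Hu Hou. apply H1. exists (X u, Y u). auto.
Qed.

(** * Completeness and the length of a ray *)

Lemma density_of_regular Omega lam z :
  regular_metric Omega lam -> Omega z -> 0 < lam z /\ continuous_density lam z.
Proof.
  intros H Hz. destruct (H z Hz) as [H1 [H2 _]]. split; [exact H1|exact H2].
Qed.

(** In the logarithmic coordinate the length of the radial arc is the integral
    of [exp U], at most that of [exp (k t + B)]; the sum of the two boundary
    values bounds it in either direction of travel. *)
Lemma ray_length Omega lam T k B :
  regular_metric Omega lam -> (forall t theta, t < T -> Omega (cexp t theta)) -> 0 < k ->
  (forall t, t < T -> log_density lam t 0 <= k * t + B) ->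
  forall t1 t2, t1 < T -> t2 < T ->
  exists l, curve_length Omega lam (cexp t1 0) (cexp t2 0) l /\
    l <= exp (k * t1 + B) / k + exp (k * t2 + B) / k.
Proof.
  intros Hreg HO Hk HU t1 t2 Ht1 Ht2.
  set (d := t2 - t1). set (tau := fun s => t1 + s * d).
  set (g := fun s => (exp (tau s), 0) : C).
  set (dg := fun s => (d * exp (tau s), 0) : C).
  assert (Etau0 : tau 0 = t1) by (unfold tau; ring).
  assert (Etau1 : tau 1 = t2) by (unfold tau, d; ring).
  assert (Htau : forall s, 0 <= s <= 1 -> tau s < T)
    by (intros s Hs; unfold tau, d; destruct (Req_dec s 1) as [->|]; nra).
  assert (Eg : forall s, g s = cexp (tau s) 0) by (intro s; rewrite cexp_zero; reflexivity).
  assert (Hg : C1_arc g dg).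
  { apply (C1_arc_of_components (fun s => exp (tau s)) (fun _ => 0) (fun s => d * exp (tau s)) (fun _ => 0)).
    - intro s. split; [unfold tau; auto_derive; auto; ring|].
      apply (ex_derive_continuous (V := R_NormedModule)). unfold tau. auto_derive. auto.
    - intro s. split; [auto_derive; auto|apply continuous_const]. }
  assert (HOg : forall s, 0 <= s <= 1 -> Omega (g s)).
  { intros s Hs. rewrite Eg. apply HO, Htau, Hs. }
  exists (RInt (fun s => lam (g s) * Cmod (dg s)) 0 1). split.
  { rewrite <- Etau0, <- Etau1, <- !Eg. apply curve_arc; assumption. }
  set (sg := if Rle_dec 0 d then 1 else -1).
  assert (Hsg : sg * d = Rabs d /\ -1 <= sg <= 1).
  { unfold sg. destruct (Rle_dec 0 d); [rewrite Rabs_pos_eq|rewrite Rabs_left]; lra. }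
  set (D := fun s => Rabs d * exp (k * tau s + B)).
  assert (HI : is_RInt D 0 1 (sg * exp (k * tau 1 + B) / k - sg * exp (k * tau 0 + B) / k)).
  { apply (is_RInt_derive (V := R_CompleteNormedModule) (fun s => sg * exp (k * tau s + B) / k) D).
    - intros s _. unfold D, tau. rewrite <- (proj1 Hsg). auto_derive; [auto|]. field. lra.
    - intros s _. apply (ex_derive_continuous (V := R_NormedModule)).
      unfold D, tau. auto_derive. auto. }
  assert (Hle : RInt (fun s => lam (g s) * Cmod (dg s)) 0 1 <= RInt D 0 1).
  { apply RInt_le; [lra| |eexists; exact HI|].
    - apply (ex_RInt_continuous (V := R_CompleteNormedModule)). intros s Hs.
      rewrite Rmin_left, Rmax_right in Hs by lra.
      apply length_integrand_continuous; [exact Hg|].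
      apply (density_of_regular Omega); [exact Hreg|apply HOg, Hs].
    - intros s Hs. assert (Hl : 0 < lam (g s)).
      { apply (density_of_regular Omega); [exact Hreg|apply HOg; lra]. }
      assert (Ed : Cmod (dg s) = Rabs d * exp (tau s)).
      { unfold dg. change (d * exp (tau s), 0) with (RtoC (d * exp (tau s))).
        rewrite Cmod_R, Rabs_mult, (Rabs_pos_eq (exp _)) by (left; apply exp_pos). reflexivity. }
      rewrite Ed. unfold D.
      replace (lam (g s) * (Rabs d * exp (tau s))) with (Rabs d * (lam (g s) * exp (tau s))) by ring.
      apply Rmult_le_compat_l; [apply Rabs_pos|].
      rewrite <- (exp_ln (lam (g s)) Hl), <- exp_plus. apply exp_le.
      rewrite Eg. apply (HU (tau s)), Htau. lra. }
  rewrite (is_RInt_unique _ _ _ _ HI), Etau0, Etau1 in Hle.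
  eapply Rle_trans; [exact Hle|].
  assert (P1 : 0 < exp (k * t1 + B) / k) by (apply Rdiv_lt_0_compat; [apply exp_pos|lra]).
  assert (P2 : 0 < exp (k * t2 + B) / k) by (apply Rdiv_lt_0_compat; [apply exp_pos|lra]).
  unfold Rdiv in *. rewrite !Rmult_assoc. nra.
Qed.

Lemma ray_divergent_of_locally_complete Omega lam T :
  Defs.domain Omega -> regular_metric Omega lam ->
  (forall t theta, t < T -> Omega (cexp t theta)) ->
  locally_complete_at Omega lam (RtoC 0) -> ray_divergent (log_density lam).
Proof.
  intros Hdom Hreg HO (z0 & Hz0 & Hlc) k B tau Hk HU.
  set (T' := Rmin T tau).
  assert (HT : T' <= T /\ T' <= tau) by (split; [apply Rmin_l|apply Rmin_r]).
  assert (HL := ray_length Omega lam T' k B Hreg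
    (fun t theta Ht => HO t theta ltac:(lra)) Hk (fun t Ht => HU t ltac:(lra))).
  set (t1 := T' - 1).
  destruct (curve_connected Omega lam z0 (cexp t1 0) Hdom Hz0 (HO t1 0 ltac:(unfold t1; lra)))
    as [l0 Hl0].
  set (E1 := exp (k * t1 + B) / k).
  specialize (Hlc (l0 + (E1 + E1))). apply locally_C_square in Hlc. destruct Hlc as [d Hd].
  pose proof (cond_pos d) as Hd0.
  set (t2 := Rmin t1 (ln d - 1)).
  assert (Ht2 : t2 <= t1 /\ t2 <= ln d - 1) by (split; [apply Rmin_l|apply Rmin_r]).
  destruct (HL t1 t2 ltac:(unfold t1; lra) ltac:(unfold t1 in *; lra)) as (l & Hl1 & Hl2).
  assert (Hexp : exp t2 < d).
  { rewrite <- (exp_ln d Hd0). apply exp_increasing. lra. }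
  destruct (Rabs_cexp_lt t2 0 d Hexp) as [A1 A2].
  assert (Hbig : Rbar_lt (l0 + (E1 + E1)) (metric_dist Omega lam z0 (cexp t2 0))).
  { apply (Hd (exp t2 * cos 0) (exp t2 * sin 0)).
    - change (Rabs (exp t2 * cos 0 - 0) < d). rewrite Rminus_0_r. exact A1.
    - change (Rabs (exp t2 * sin 0 - 0) < d). rewrite Rminus_0_r. exact A2.
    - apply HO. unfold t1 in *. lra. }
  apply (Rbar_lt_not_le _ _ Hbig).
  eapply Rbar_le_trans;
    [apply metric_dist_le, (curve_concat _ _ _ _ _ _ _ Hl0 Hl1)|].
  simpl. assert (exp (k * t2 + B) / k <= E1); [|unfold E1 in *; lra].
  unfold E1, Rdiv. apply Rmult_le_compat_r; [left; apply Rinv_0_lt_compat; lra|].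
  apply exp_le. nra.
Qed.

(** A curve from [z] to a point away from [z] has to carry the bump at [z] down
    to zero. *)
Lemma metric_dist_away Omega lam z r :
  regular_metric Omega lam -> Omega z -> 0 < r ->
  exists r' c, 0 < r' <= r /\ 0 < c /\ forall w,
    r' * r' <= (Re w - Re z) * (Re w - Re z) + (Im w - Im z) * (Im w - Im z) ->
    Rbar_le c (metric_dist Omega lam z w).
Proof.
  intros Hreg Hz Hr.
  destruct (density_of_regular Omega lam z Hreg Hz) as [Hl Hc].
  assert (Hl2 : 0 < lam z / 2) by lra.
  destruct (Hc (mkposreal _ Hl2)) as [d Hd]. cbn [pos] in Hd.
  pose proof (cond_pos d) as Hd0.
  set (r' := Rmin r (d / 2)).
  assert (Hr' : 0 < r') by (apply Rmin_glb_lt; lra).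
  assert (Hr2 : r' <= r /\ r' <= d / 2) by (split; [apply Rmin_l|apply Rmin_r]).
  set (K := 4 * (r' * r' * r') / (lam z / 2)).
  assert (Hr3 : 0 < r' * r' * r') by (repeat apply Rmult_lt_0_compat; lra).
  assert (HK : 0 < K) by (apply Rdiv_lt_0_compat; lra).
  set (c0 := (r' * r') * (r' * r')).
  assert (Hc0 : 0 < c0) by (unfold c0; repeat apply Rmult_lt_0_compat; lra).
  exists r', (c0 / K). split; [lra|]. split; [apply Rdiv_lt_0_compat; lra|].
  intros w Hw. apply metric_dist_ge. intros l Hlen.
  assert (HC := bump_change_le Omega lam z r' (lam z / 2) Hr' Hl2
    (fun w => density_of_regular Omega lam w Hreg)).
  assert (Hlow : forall w, Omega w ->
     (Re w - Re z) * (Re w - Re z) + (Im w - Im z) * (Im w - Im z) <= r' * r' -> lam z / 2 <= lam w).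
  { intros v _ Hv. apply Rabs_le_of_sum_sqr in Hv; [|lra].
    specialize (Hd (Re v) (Im v) ltac:(lra) ltac:(lra)). cbv beta in Hd.
    replace (Re v, Im v) with v in Hd by apply surjective_pairing.
    replace (Re z, Im z) with z in Hd by apply surjective_pairing.
    apply Rabs_def2 in Hd. lra. }
  specialize (HC Hlow z w l Hlen). fold K in HC.
  assert (Ew : bump z r' w = 0).
  { unfold bump. rewrite Rmax_left by lra. ring. }
  assert (Ez : bump z r' z = c0).
  { unfold bump. rewrite !Rminus_diag, Rmax_right by nra. unfold c0. ring. }
  rewrite Ew, Ez, Rminus_0_l, Rabs_Ropp, Rabs_pos_eq in HC by lra.
  apply (Rmult_le_reg_l K); [exact HK|]. replace (K * (c0 / K)) with c0 by (field; lra). exact HC.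
Qed.

(** If the ray had finite length, the points [exp (T' - 1 - n)] would form a
    Cauchy sequence for the distance, but they stay away from every point of
    [Omega]. *)
Lemma ray_divergent_of_complete Omega lam T :
  ~ Omega (RtoC 0) -> regular_metric Omega lam ->
  (forall t theta, t < T -> Omega (cexp t theta)) ->
  complete_metric Omega lam -> ray_divergent (log_density lam).
Proof.
  intros H0 Hreg HO Hcomp k B tau Hk HU.
  set (T' := Rmin T tau).
  assert (HT : T' <= T /\ T' <= tau) by (split; [apply Rmin_l|apply Rmin_r]).
  assert (HL := ray_length Omega lam T' k B Hreg
    (fun t theta Ht => HO t theta ltac:(lra)) Hk (fun t Ht => HU t ltac:(lra))).
  assert (Hfar : forall tau', exists N, forall n, (N <= n)%nat -> T' - 1 - INR n < tau').
  { intro tau'. destruct (nfloor_ex (Rmax 0 (T' - tau')) (Rmax_l _ _)) as [N [_ HN]].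
    exists (S N). intros n Hn. apply le_INR in Hn. rewrite S_INR in Hn.
    pose proof (Rmax_r 0 (T' - tau')). lra. }
  assert (HuT : forall n, T' - 1 - INR n < T') by (intro n; pose proof (pos_INR n); lra).
  set (u := fun n : nat => cexp (T' - 1 - INR n) 0).
  destruct (Hcomp u) as (z & Hz & Hlim).
  - intro n. apply HO. specialize (HuT n). lra.
  - intro eps.
    destruct (exp_small k B Hk (eps / 2) ltac:(pose proof (cond_pos eps); lra)) as [tau' Htau'].
    destruct (Hfar tau') as [N HN]. exists N. intros n m Hn Hm.
    destruct (HL _ _ (HuT n) (HuT m)) as (l & Hl1 & Hl2).
    eapply Rbar_le_lt_trans; [apply metric_dist_le, Hl1|]. simpl.
    pose proof (Htau' _ (HN n Hn)). pose proof (Htau' _ (HN m Hm)). lra.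
  - assert (Hzn : z <> RtoC 0) by (intros ->; exact (H0 Hz)).
    pose proof (proj1 (Cmod_gt_0 z) Hzn) as Hzm.
    destruct (metric_dist_away Omega lam z (Cmod z / 2) Hreg Hz ltac:(lra))
      as (r & c & Hr & Hc & Haway).
    destruct (Hlim (mkposreal c Hc)) as [N1 HN1].
    destruct (Hfar (ln (Cmod z / 2))) as [N2 HN2].
    set (n := Nat.max N1 N2).
    apply (Rbar_lt_not_le _ _ (HN1 n (Nat.le_max_l _ _))). apply Haway.
    assert (Hun : Cmod (u n) < Cmod z / 2).
    { unfold u. rewrite Cmod_cexp. rewrite <- (exp_ln (Cmod z / 2)) by lra.
      apply exp_increasing, HN2, Nat.le_max_r. }
    assert (Hdist : Cmod z / 2 <= Cmod (u n - z)).
    { pose proof (Cmod_triangle (u n) (- (u n - z))) as Htr. rewrite Cmod_opp in Htr.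
      replace (u n + - (u n - z))%C with z in Htr by ring. lra. }
    assert (Esq : Cmod (u n - z) * Cmod (u n - z) =
       (Re (u n) - Re z) * (Re (u n) - Re z) + (Im (u n) - Im z) * (Im (u n) - Im z)).
    { unfold Cmod. rewrite sqrt_sqrt.
      - unfold Re, Im. simpl. ring.
      - apply Rplus_le_le_0_compat; apply pow2_ge_0. }
    rewrite <- Esq. apply Rmult_le_compat; lra.
Qed.

(** * Connection and Schwarzian in the logarithmic coordinate *)

Lemma jet2_exp_cos t theta :
  jet2 (fun u v => exp u * cos v) t theta
    (exp t * cos theta) (- (exp t * sin theta)) (exp t * cos theta) (- (exp t * sin theta))
    (- (exp t * sin theta)) (- (exp t * cos theta)).
Proof.
  assert (De : forall u v, differentiable_pt_lim (fun u _ => exp u) u v (exp u) 0).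
  { intros. apply (differentiable_pt_lim_fst exp). auto_derive; auto; ring. }
  assert (Dc : forall u v, differentiable_pt_lim (fun _ v => cos v) u v 0 (- sin v)).
  { intros. apply (differentiable_pt_lim_snd cos). auto_derive; auto; ring. }
  assert (Ds : forall u v, differentiable_pt_lim (fun _ v => - sin v) u v 0 (- cos v)).
  { intros. apply (differentiable_pt_lim_snd (fun v => - sin v)). auto_derive; auto; ring. }
  assert (DC : forall u v, differentiable_pt_lim (fun u v => exp u * cos v) u v
             (exp u * cos v) (exp u * - sin v)).
  { intros u v. pose proof (differentiable_pt_lim_mul _ _ _ _ _ _ _ _ (De u v) (Dc u v)) as D.
    cbv beta in D. rewrite Rmult_0_r, Rmult_0_l, Rplus_0_r, Rplus_0_l in D. exact D. }
  assert (DS : forall u v, differentiable_pt_lim (fun u v => exp u * - sin v) u v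
             (exp u * - sin v) (exp u * - cos v)).
  { intros u v. pose proof (differentiable_pt_lim_mul _ _ _ _ _ _ _ _ (De u v) (Ds u v)) as D.
    cbv beta in D. rewrite Rmult_0_r, Rmult_0_l, Rplus_0_r, Rplus_0_l in D. exact D. }
  rewrite <- !Ropp_mult_distr_r_reverse.
  exists (fun u v => exp u * cos v), (fun u v => exp u * - sin v). repeat split.
  - apply locally_2d_forall. exact DC.
  - apply DC.
  - apply DS.
Qed.

Lemma jet2_exp_sin t theta :
  jet2 (fun u v => exp u * sin v) t theta
    (exp t * sin theta) (exp t * cos theta) (exp t * sin theta) (exp t * cos theta)
    (exp t * cos theta) (- (exp t * sin theta)).
Proof.
  pose proof (jet2_exp_cos t (theta - PI / 2)) as J.
  assert (Ec : forall v, cos (v - PI / 2) = sin v).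
  { intro v. rewrite cos_minus, cos_PI2, sin_PI2. ring. }
  assert (Es : forall v, sin (v - PI / 2) = - cos v).
  { intro v. rewrite sin_minus, cos_PI2, sin_PI2. ring. }
  apply (jet2_affine_change _ (fun u v => exp u * sin v) 1 0 0 0 1 (- (PI / 2)) t theta _ _ _ _ _ _ _ _
    (exp t * sin theta) (exp t * cos theta) (exp t * sin theta) (exp t * cos theta)
    (exp t * cos theta) (- (exp t * sin theta))) in J; rewrite ?Ec, ?Es; try ring.
  - exact J.
  - intros u v. replace (0 * u + 1 * v + - (PI / 2)) with (v - PI / 2) by ring.
    rewrite Ec. f_equal. f_equal. ring.
Qed.

(** Class [C^2] on the open set [Omega] gives Frechet jets of [lam], to which
    the chain rule applies. *)
Lemma jet2_log_density_plane Omega lam z :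
  open Omega -> regular_metric Omega lam -> Omega z ->
  exists p r a b c d, jet2 (fun x y => ln (lam (x, y))) (Re z) (Im z) p r a b c d.
Proof.
  intros Hopen Hreg Hz.
  assert (HC2 : locally_2d (fun u v => ex_diff_n (fun x y => lam (x, y)) 2 u v) (Re z) (Im z)).
  { generalize (proj1 (locally_C_square Omega z) (Hopen z Hz)).
    apply locally_2d_impl, locally_2d_forall. intros u v H. apply (Hreg (u, v) H). }
  destruct (jet2_of_C2 _ _ _ HC2) as (p & r & a & b & c & d & J).
  assert (Hl : 0 < lam (Re z, Im z)).
  { rewrite <- surjective_pairing. apply (Hreg z Hz). }
  assert (JL : jet2 (fun u _ => ln u) (lam (Re z, Im z)) 0
     (/ lam (Re z, Im z)) 0 (- / (lam (Re z, Im z) * lam (Re z, Im z))) 0 0 0).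
  { apply (jet2_fst ln (fun x => / x)).
    - exists (mkposreal _ Hl). intros u Hu.
      change (Rabs (u - lam (Re z, Im z)) < lam (Re z, Im z)) in Hu. apply Rabs_def2 in Hu.
      auto_derive; [lra|]. field. lra.
    - auto_derive; [lra|]. field. lra. }
  assert (J0 : jet2 (fun _ _ => 0) (Re z) (Im z) 0 0 0 0 0 0).
  { generalize (jet2_affine 0 0 0 (Re z) (Im z)). apply jet2_ext, locally_2d_forall.
    intros. ring. }
  pose proof (jet2_comp _ _ _ _ _ _ _ _ _ _ _ _ _ _ _ _ _ _ _ _ _ _ _ JL J J0) as JC.
  do 6 eexists. exact JC.
Qed.

(** The chain rule for [exp], which is holomorphic: this gives [U_t - i U_theta
    = z (u_x - i u_y) + 1] and the factor [exp (2 t)] in the Laplacian. *)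
Lemma log_density_jet lam t theta p r a b c d X Y :
  X = exp t * cos theta -> Y = exp t * sin theta ->
  jet2 (fun x y => ln (lam (x, y))) X Y p r a b c d ->
  jet2 (log_density lam) t theta (p * X + r * Y + 1) (r * X - p * Y)
    (a * X * X + (b + c) * X * Y + d * Y * Y + p * X + r * Y)
    (b * X * X + (d - a) * X * Y - c * Y * Y + r * X - p * Y)
    (c * X * X + (d - a) * X * Y - b * Y * Y + r * X - p * Y)
    (d * X * X - (b + c) * X * Y + a * Y * Y - p * X - r * Y).
Proof.
  intros EX EY J. rewrite EX, EY in J.
  pose proof (jet2_comp _ _ _ _ _ _ _ _ _ _ _ _ _ _ _ _ _ _ _ _ _ _ _ J
    (jet2_exp_cos t theta) (jet2_exp_sin t theta)) as JC.
  pose proof (jet2_plus _ _ _ _ _ _ _ _ _ _ _ _ _ _ _ _ JC (jet2_affine 1 0 0 t theta)) as JP.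
  rewrite <- EX, <- EY in JP.
  eapply jet2_ext; [apply locally_2d_forall|]; cycle 1.
  - match type of JP with jet2 _ _ _ ?e1 ?e2 ?e3 ?e4 ?e5 ?e6 =>
      replace (p * X + r * Y + 1) with e1 by ring;
      replace (r * X - p * Y) with e2 by ring;
      replace (a * X * X + (b + c) * X * Y + d * Y * Y + p * X + r * Y) with e3 by ring end.
    match type of JP with jet2 _ _ _ ?e1 ?e2 ?e3 ?e4 ?e5 ?e6 =>
      assert (E4 : e4 = b * X * X + (d - a) * X * Y - c * Y * Y + r * X - p * Y) by ring;
      assert (E5 : e5 = c * X * X + (d - a) * X * Y - b * Y * Y + r * X - p * Y) by ring;
      assert (E6 : e6 = d * X * X - (b + c) * X * Y + a * Y * Y - p * X - r * Y) by ring end.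
    rewrite E4, E5, E6 in JP. exact JP.
  - intros u v. unfold log_density, cexp. ring.
Qed.

Lemma partials_of_jet (f : C -> R) (z : C) p r a b c d :
  jet2 (fun x y => f (x, y)) (Re z) (Im z) p r a b c d ->
  dx f z = p /\ dy f z = r /\ dx (dx f) z = a /\ dy (dx f) z = b /\
  dx (dy f) z = c /\ dy (dy f) z = d.
Proof.
  intros (P & Q & HL & <- & <- & HP & HQ).
  assert (HLx : locally_2d (fun u v => P u v = dx f (u, v)) (Re z) (Im z)).
  { revert HL. apply locally_2d_impl, locally_2d_forall. intros u v H.
    apply differentiable_pt_lim_unique in H. symmetry. apply H. }
  assert (HLy : locally_2d (fun u v => Q u v = dy f (u, v)) (Re z) (Im z)).
  { revert HL. apply locally_2d_impl, locally_2d_forall. intros u v H.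
    apply differentiable_pt_lim_unique in H. symmetry. apply H. }
  pose proof (differentiable_pt_lim_unique _ _ _ _ _ (locally_2d_singleton _ _ _ HL)) as [U1 U2].
  pose proof (differentiable_pt_lim_unique _ _ _ _ _ HP) as [U3 U4].
  pose proof (differentiable_pt_lim_unique _ _ _ _ _ HQ) as [U5 U6].
  repeat split.
  - exact U1.
  - exact U2.
  - rewrite <- U3. symmetry. apply Derive_ext_loc. exact (locally_2d_1d_const_y _ _ _ HLx).
  - rewrite <- U4. symmetry. apply Derive_ext_loc. exact (locally_2d_1d_const_x _ _ _ HLx).
  - rewrite <- U5. symmetry. apply Derive_ext_loc. exact (locally_2d_1d_const_y _ _ _ HLy).
  - rewrite <- U6. symmetry. apply Derive_ext_loc. exact (locally_2d_1d_const_x _ _ _ HLy).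
Qed.

Lemma connection_eq (lam : C -> R) (z : C) :
  connection lam z = (dx (fun w => ln (lam w)) z, - dy (fun w => ln (lam w)) z).
Proof.
  unfold connection, wirtinger, Cdx, Cdy.
  assert (E1 : dx (fun w => Im (RtoC (ln (lam w)))) z = 0) by exact (Derive_const 0 (Re z)).
  assert (E2 : dy (fun w => Im (RtoC (ln (lam w)))) z = 0) by exact (Derive_const 0 (Im z)).
  rewrite E1, E2.
  change (fun w => Re (RtoC (ln (lam w)))) with (fun w => ln (lam w)).
  set (A := dx (fun w => ln (lam w)) z). set (B := dy (fun w => ln (lam w)) z).
  unfold Cmult, Cminus, Cplus, Copp, Cinv, RtoC, Ci; simpl. f_equal; field.
Qed.

Lemma schwarzian_eq (lam : C -> R) (z : C) p r a b c d :
  jet2 (fun x y => ln (lam (x, y))) (Re z) (Im z) p r a b c d ->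
  connection lam z = (p, - r) /\
  schwarzian lam z = (/ 2 * (a - d) - / 2 * (p * p - r * r), - / 2 * (b + c) + p * r).
Proof.
  intro J. destruct (partials_of_jet (fun w => ln (lam w)) z _ _ _ _ _ _ J)
    as (E1 & E2 & E3 & E4 & E5 & E6).
  assert (EG : connection lam z = (p, - r)) by (rewrite connection_eq, E1, E2; reflexivity).
  split; [exact EG|].
  unfold schwarzian. rewrite EG. unfold wirtinger, Cdx, Cdy.
  assert (Rx : dx (fun w => Re (connection lam w)) z = a).
  { rewrite <- E3. apply Derive_ext. intro x. rewrite connection_eq. reflexivity. }
  assert (Ry : dy (fun w => Re (connection lam w)) z = b).
  { rewrite <- E4. apply Derive_ext. intro x. rewrite connection_eq. reflexivity. }
  assert (Ix : dx (fun w => Im (connection lam w)) z = - c).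
  { rewrite <- E5. unfold dx at 2. rewrite <- Derive_opp. apply Derive_ext. intro x.
    rewrite connection_eq. reflexivity. }
  assert (Iy : dy (fun w => Im (connection lam w)) z = - d).
  { rewrite <- E6. unfold dy at 2. rewrite <- Derive_opp. apply Derive_ext. intro x.
    rewrite connection_eq. reflexivity. }
  rewrite Rx, Ry, Ix, Iy.
  unfold Cmult, Cminus, Cplus, Copp, Cinv, RtoC, Ci; simpl. f_equal; field.
Qed.

Lemma log_density_cylinder_solution Omega lam kappa T :
  open Omega -> regular_metric Omega lam ->
  (forall t theta, t < T -> Omega (cexp t theta)) ->
  (forall z, Omega z -> kappa z = curvature lam z) ->
  cylinder_solution (log_density lam) (fun t theta => - kappa (cexp t theta)) T.
Proof.
  intros Hopen Hreg HO Hk. split.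
  - intros t theta Ht. specialize (HO t theta Ht).
    destruct (jet2_log_density_plane Omega lam _ Hopen Hreg HO) as (p & r & a & b & c & d & J).
    destruct (partials_of_jet (fun w => ln (lam w)) _ _ _ _ _ _ _ J) as (_ & _ & E1 & _ & _ & E2).
    do 6 eexists. split.
    { apply (log_density_jet lam t theta p r a b c d _ _ eq_refl eq_refl J). }
    rewrite Hk by exact HO. unfold curvature, laplacian. rewrite E1, E2.
    assert (Hl : 0 < lam (cexp t theta)) by apply (Hreg _ HO).
    unfold log_density.
    replace (2 * (ln (lam (cexp t theta)) + t)) with
      (ln (lam (cexp t theta)) + ln (lam (cexp t theta)) + (t + t)) by ring.
    rewrite !exp_plus, !exp_ln by exact Hl.
    replace (- (- (a + d) / lam (cexp t theta) ^ 2) *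
       (lam (cexp t theta) * lam (cexp t theta) * (exp t * exp t)))
      with ((a + d) * (exp t * exp t)) by (field; lra).
    pose proof (sin2_cos2 theta) as Hsc. unfold Rsqr in Hsc.
    replace ((a + d) * (exp t * exp t)) with
      ((a + d) * (exp t * exp t) * (sin theta * sin theta + cos theta * cos theta))
      by (rewrite Hsc; ring).
    ring.
  - intros t theta. unfold log_density, cexp. rewrite cos_plus, sin_plus.
    rewrite cos_2PI, sin_2PI.
    replace (cos theta * 1 - sin theta * 0) with (cos theta) by ring.
    replace (sin theta * 1 + cos theta * 0) with (sin theta) by ring. reflexivity.
Qed.

(** * Transfer of the curvature hypotheses *)

Lemma Cmod_le_sum (x y : R) : Cmod (x, y) <= Rabs x + Rabs y.
Proof.
  replace ((x, y) : C) with (RtoC x + Ci * RtoC y)%C.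
  - eapply Rle_trans; [apply Cmod_triangle|].
    rewrite Cmod_mult, !Cmod_R. assert (E : Cmod Ci = 1).
    { unfold Cmod, Ci; cbn [fst snd]. replace (0 ^ 2 + 1 ^ 2) with 1 by ring. apply sqrt_1. }
    rewrite E. lra.
  - unfold Cmult, Cplus, RtoC, Ci; simpl. f_equal; ring.
Qed.

Lemma sin_cos_lipschitz a b :
  Rabs (cos a - cos b) <= Rabs (a - b) /\ Rabs (sin a - sin b) <= Rabs (a - b).
Proof.
  split.
  - destruct (MVT_abs cos (fun x => - sin x) b a) as (c & E & _).
    + intros c _. apply derivable_pt_lim_cos.
    + rewrite E, Rabs_Ropp. pose proof (SIN_bound c).
      rewrite <- (Rmult_1_l (Rabs (a - b))) at 2.
      apply Rmult_le_compat_r; [apply Rabs_pos|apply Rabs_le; lra].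
  - destruct (MVT_abs sin cos b a) as (c & E & _).
    + intros c _. apply derivable_pt_lim_sin.
    + rewrite E. pose proof (COS_bound c).
      rewrite <- (Rmult_1_l (Rabs (a - b))) at 2.
      apply Rmult_le_compat_r; [apply Rabs_pos|apply Rabs_le; lra].
Qed.

(** The factor [exp m] is what makes Hoelder bounds decay towards the puncture. *)
Lemma cexp_lipschitz t1 t2 th1 th2 m : t1 <= m -> t2 <= m ->
  Cmod (cexp t1 th1 - cexp t2 th2) <= 2 * exp m * (Rabs (t1 - t2) + Rabs (th1 - th2)).
Proof.
  intros H1 H2.
  pose proof (exp_difference_le t1 t2 m H1 H2) as HE.
  pose proof (exp_le t2 m H2) as Hm. pose proof (exp_pos t2) as Hp.
  destruct (sin_cos_lipschitz th1 th2) as [HC HS].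
  assert (Hgen : forall u v, Rabs u <= 1 -> Rabs (u - v) <= Rabs (th1 - th2) ->
     Rabs (exp t1 * u - exp t2 * v) <= exp m * (Rabs (t1 - t2) + Rabs (th1 - th2))).
  { intros u v Hu Huv.
    replace (exp t1 * u - exp t2 * v) with ((exp t1 - exp t2) * u + exp t2 * (u - v)) by ring.
    eapply Rle_trans; [apply Rabs_triang|]. rewrite !Rabs_mult, (Rabs_pos_eq (exp t2)) by lra.
    rewrite Rmult_plus_distr_l. apply Rplus_le_compat.
    - rewrite <- (Rmult_1_r (exp m * Rabs (t1 - t2))).
      apply Rmult_le_compat; try apply Rabs_pos; assumption.
    - apply Rmult_le_compat; try apply Rabs_pos; lra. }
  assert (EC : (cexp t1 th1 - cexp t2 th2)%C =
     (exp t1 * cos th1 - exp t2 * cos th2, exp t1 * sin th1 - exp t2 * sin th2)).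
  { unfold cexp, Cminus, Cplus, Copp; simpl. reflexivity. }
  rewrite EC. eapply Rle_trans; [apply Cmod_le_sum|].
  pose proof (COS_bound th1); pose proof (SIN_bound th1).
  pose proof (Hgen (cos th1) (cos th2) ltac:(apply Rabs_le; lra) HC).
  pose proof (Hgen (sin th1) (sin th2) ltac:(apply Rabs_le; lra) HS). lra.
Qed.

(** A displacement of size [D] near the circle [t] moves [z] by at most a
    multiple of [exp t D], so the Hoelder constant of the curvature acquires the
    factor [exp (alpha t)]. *)
Lemma holder_on_cylinder Omega kappa T :
  (forall t theta, t < T -> Omega (cexp t theta)) ->
  holder_continuous_on (fun z => Omega z \/ z = RtoC 0) kappa ->
  kappa (RtoC 0) = - 4 ->
  uniform_limit (fun t theta => - kappa (cexp t theta)) 4 /\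
  exists alpha, 0 < alpha <= 1 /\ forall eps, 0 < eps ->
    eventually_left (axis_holder (fun t theta => - kappa (cexp t theta)) alpha eps).
Proof.
  intros HO (alpha & K & Ha & HK) H0.
  set (K' := Rabs K + 1).
  assert (HK'0 : 0 < K') by (unfold K'; pose proof (Rabs_pos K); lra).
  assert (HK' : forall z w, Omega z \/ z = RtoC 0 -> Omega w \/ w = RtoC 0 -> z <> w ->
     Rabs (kappa z - kappa w) <= K' * Rpower (Cmod (z - w)) alpha).
  { intros z w Hz Hw Hzw. eapply Rle_trans; [apply HK; assumption|].
    apply Rmult_le_compat_r; [left; apply Rpower_pos|].
    unfold K'. pose proof (Rle_abs K). lra. }
  split.
  - intros eps Heps.
    destruct (exp_small alpha 0 (proj1 Ha) (eps / (K' * alpha))) as [tau Htau].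
    { apply Rdiv_lt_0_compat; [exact Heps|nra]. }
    exists (Rmin tau T). intros t theta Ht.
    Rmin_bounds tau T.
    replace (- kappa (cexp t theta) - 4) with (- (kappa (cexp t theta) - kappa (RtoC 0)))
      by (rewrite H0; ring).
    rewrite Rabs_Ropp. eapply Rle_trans; [apply HK'|].
    + left. apply HO. lra.
    + right; reflexivity.
    + intro E. pose proof (Cmod_cexp t theta) as EM. rewrite E, Cmod_0 in EM.
      pose proof (exp_pos t). lra.
    + replace (cexp t theta - RtoC 0)%C with (cexp t theta) by ring.
      rewrite Cmod_cexp. unfold Rpower. rewrite ln_exp.
      specialize (Htau t ltac:(lra)). rewrite Rplus_0_r in Htau.
      apply (Rmult_lt_compat_l (K' * alpha)) in Htau; [|nra].
      replace (K' * alpha * (exp (alpha * t) / alpha)) with (K' * exp (alpha * t)) in Htau by (field; lra).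
      replace (K' * alpha * (eps / (K' * alpha))) with eps in Htau by (field; lra). lra.
  - exists alpha. split; [exact Ha|]. intros eps Heps.
    destruct (exp_small alpha (alpha * (ln 2 + 3)) (proj1 Ha) (eps / (K' * alpha))) as [tau Htau].
    { apply Rdiv_lt_0_compat; [exact Heps|nra]. }
    exists (Rmin tau (T - 3)). intros t Ht.
    pose proof (Rmin_l tau (T - 3)) as M1; pose proof (Rmin_r tau (T - 3)) as M2.
    specialize (Htau t ltac:(lra)).
    assert (Hsmall : K' * Rpower (2 * exp (t + 3)) alpha <= eps).
    { apply (Rmult_lt_compat_l (K' * alpha)) in Htau; [|nra].
      replace (K' * alpha * (eps / (K' * alpha))) with eps in Htau by (field; lra).
      replace (Rpower (2 * exp (t + 3)) alpha) with (exp (alpha * t + alpha * (ln 2 + 3))).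
      - replace (K' * alpha * (exp (alpha * t + alpha * (ln 2 + 3)) / alpha)) with
          (K' * exp (alpha * t + alpha * (ln 2 + 3))) in Htau by (field; lra). lra.
      - unfold Rpower. rewrite ln_mult, ln_exp by (lra || apply exp_pos). f_equal. ring. }
    assert (Hgen : forall t1 t2 th1 th2 D, Rabs (t1 - t) <= 3 -> Rabs (t2 - t) <= 3 -> 0 < D ->
       Rabs (t1 - t2) + Rabs (th1 - th2) = D ->
       Rabs (- kappa (cexp t1 th1) - - kappa (cexp t2 th2)) <= eps * Rpower D alpha).
    { intros t1 t2 th1 th2 D H1 H2 HD ED. apply Rabs_le_between in H1, H2.
      pose proof (cexp_lipschitz t1 t2 th1 th2 (t + 3) ltac:(lra) ltac:(lra)) as HL.
      rewrite ED in HL.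
      replace (- kappa (cexp t1 th1) - - kappa (cexp t2 th2)) with
        (- (kappa (cexp t1 th1) - kappa (cexp t2 th2))) by ring. rewrite Rabs_Ropp.
      destruct (classic (cexp t1 th1 = cexp t2 th2)) as [E|E].
      { rewrite E, Rminus_diag, Rabs_R0. apply Rmult_le_pos; [lra|left; apply Rpower_pos]. }
      eapply Rle_trans; [apply HK'; [left; apply HO; lra|left; apply HO; lra|exact E]|].
      pose proof (exp_pos (t + 3)).
      apply Rle_trans with (K' * (Rpower (2 * exp (t + 3)) alpha * Rpower D alpha)).
      - apply Rmult_le_compat_l; [lra|]. rewrite Rpower_mult_distr by lra.
        apply Rle_Rpower_l; [lra|]. split; [|exact HL].
        apply Cmod_gt_0. intro E0. apply E.
        replace (cexp t1 th1) with (cexp t1 th1 - cexp t2 th2 + cexp t2 th2)%C by ring.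
        rewrite E0. ring.
      - rewrite <- Rmult_assoc. apply Rmult_le_compat_r; [left; apply Rpower_pos|exact Hsmall]. }
    split.
    + intros t1 t2 theta H1 H2 Hne _. apply Hgen; auto.
      * apply Rabs_pos_lt. lra.
      * rewrite Rminus_diag, Rabs_R0. ring.
    + intros t1 th1 th2 H1 Hne _. apply Hgen; auto.
      * apply Rabs_pos_lt. lra.
      * rewrite Rminus_diag, Rabs_R0. ring.
Qed.

(** * The theorem *)

(** With [v = U_t - i U_theta] and [h = U_tt - U_thth - i (U_tth + U_tht)], where
    [th] stands for [theta], algebra gives [z Gamma = v - 1] and
    [2 z^2 S = 1 + h - v^2]; both [v] and [h] tend to [0]. *)
Lemma puncture_asymptotics Omega lam kappa T :
  open Omega -> regular_metric Omega lam ->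
  (forall t theta, t < T -> Omega (cexp t theta)) ->
  (forall z, Omega z -> kappa z = curvature lam z) ->
  holder_continuous_on (fun z => Omega z \/ z = RtoC 0) kappa ->
  kappa (RtoC 0) = - 4 -> ray_divergent (log_density lam) ->
  forall eps, 0 < eps -> eventually_left (fun t => forall theta,
    let z := cexp t theta in
    Rabs (log_density lam t theta + ln (- 2 * t)) <= eps /\
    Cmod (z * connection lam z - RtoC (-1)) <= eps /\
    Cmod (z * z * schwarzian lam z - RtoC (/ 2)) <= eps).
Proof.
  intros Hopen Hreg HO Hk Hh H0 Hray eps Heps.
  pose proof (log_density_cylinder_solution Omega lam kappa T Hopen Hreg HO Hk) as HU.
  destruct (holder_on_cylinder Omega kappa T HO Hh H0) as (Hq & alpha & Ha & Hqh).
  pose proof (cylinder_asymptotics _ _ _ HU Hray Hq) as HL.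
  set (e := Rmin (eps / 4) (/ 2)).
  assert (He : 0 < e) by (apply Rmin_glb_lt; lra).
  assert (He' : e <= eps / 4 /\ e <= / 2) by (split; [apply Rmin_l|apply Rmin_r]).
  destruct (HL e He) as [T1 HT1].
  destruct (eventually_left_and _ _ (gradient_vanishes _ _ _ HU HL Hq e He)
    (hessian_vanishes _ _ _ alpha HU Ha HL Hq Hqh e He)) as [T2 HT2].
  exists (Rmin T (Rmin T1 T2)). intros t Ht theta z.
  Rmin_bounds T (Rmin T1 T2).
  Rmin_bounds T1 T2.
  specialize (HT1 t theta ltac:(lra)). rewrite Rminus_0_r in HT1.
  destruct (HT2 t ltac:(lra)) as [Hgrad Hhess].
  destruct (jet2_log_density_plane Omega lam z Hopen Hreg (HO t theta ltac:(lra)))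
    as (p & r & a & b & c & d & J).
  destruct (schwarzian_eq lam z p r a b c d J) as [EG ES].
  pose proof (log_density_jet lam t theta p r a b c d _ _ eq_refl eq_refl J) as JU.
  destruct (Hgrad _ _ _ _ _ _ _ JU) as [G1 G2].
  destruct (Hhess _ _ _ _ _ _ _ JU) as [G3 G4].
  assert (Ez : z = (Re z, Im z)) by reflexivity.
  change (exp t * cos theta) with (Re z) in G1, G2, G3, G4.
  change (exp t * sin theta) with (Im z) in G1, G2, G3, G4.
  set (X := Re z) in *. set (Y := Im z) in *.
  set (U1 := p * X + r * Y + 1) in *. set (U2 := r * X - p * Y) in *.
  set (V := (U1, - U2) : C).
  assert (EV : (z * connection lam z - RtoC (-1))%C = V).
  { rewrite EG, Ez. unfold V, U1, U2, Cmult, Cminus, Cplus, Copp, RtoC; simpl. f_equal; ring. }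
  assert (HV : Cmod V <= 2 * e).
  { eapply Rle_trans; [apply Cmod_le_sum|]. rewrite Rabs_Ropp. lra. }
  rewrite EV. split; [lra|]. split; [lra|].
  match type of G3 with Rabs ?x <= _ => set (H12 := x) in * end.
  match type of G4 with Rabs ?x <= _ => set (H11 := x) in * end.
  set (W := (H11, - H12) : C).
  assert (EW : (z * z * schwarzian lam z - RtoC (/ 2))%C = (RtoC (/ 2) * (W - V * V))%C).
  { rewrite ES, Ez. unfold V, W, U1, U2, H11, H12, Cmult, Cminus, Cplus, Copp, RtoC; simpl.
    f_equal; field. }
  rewrite EW, Cmod_mult, Cmod_R, (Rabs_pos_eq (/ 2)) by lra.
  assert (HW : Cmod W <= 2 * e).
  { eapply Rle_trans; [apply Cmod_le_sum|]. rewrite Rabs_Ropp. lra. }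
  pose proof (Cmod_triangle W (- (V * V))) as Htr.
  rewrite Cmod_opp, Cmod_mult in Htr. change (W + - (V * V))%C with (W - V * V)%C in Htr.
  pose proof (Cmod_ge_0 V).
  assert (Cmod V * Cmod V <= 2 * e * (2 * e)) by (apply Rmult_le_compat; lra).
  assert (2 * e * (2 * e) <= 2 * e) by nra.
  lra.
Qed.

Lemma filter_at_puncture Omega (P : C -> Prop) :
  ~ Omega (RtoC 0) -> eventually_left (fun t => forall theta, P (cexp t theta)) ->
  within Omega (locally (RtoC 0)) P.
Proof.
  intros H0 [tau Htau]. unfold within.
  apply locally_C_square.
  assert (Hd : 0 < exp tau / 2) by (pose proof (exp_pos tau); lra).
  exists (mkposreal _ Hd). cbn [pos]. intros u v Hu Hv HO.
  change (Rabs (u - 0) < exp tau / 2) in Hu. change (Rabs (v - 0) < exp tau / 2) in Hv.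
  rewrite Rminus_0_r in Hu, Hv.
  destruct (cexp_surjective (u, v)) as (t & theta & E); [intro E; rewrite E in HO; exact (H0 HO)|].
  rewrite E. apply Htau. apply exp_lt_inv. rewrite <- (Cmod_cexp t theta), <- E.
  eapply Rle_lt_trans; [apply Cmod_le_sum|]. lra.
Qed.

Lemma quotient_near_1 (A B : C) (l e : R) :
  / 2 <= Rabs l -> e <= / 4 -> Cmod (A - RtoC l) <= e -> Cmod (B - RtoC l) <= e ->
  B <> RtoC 0 /\ Cmod (A / B - RtoC 1) <= 8 * e.
Proof.
  intros Hl He HA HB.
  assert (HBm : / 4 <= Cmod B).
  { pose proof (Cmod_triangle B (- (B - RtoC l))) as Htr. rewrite Cmod_opp in Htr.
    replace (B + - (B - RtoC l))%C with (RtoC l) in Htr by ring. rewrite Cmod_R in Htr. lra. }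
  assert (HB0 : B <> RtoC 0) by (intro E; rewrite E, Cmod_0 in HBm; lra).
  split; [exact HB0|].
  replace (A / B - RtoC 1)%C with ((A - B) / B)%C by (field; exact HB0).
  rewrite Cmod_div by exact HB0.
  assert (HAB : Cmod (A - B) <= 2 * e).
  { pose proof (Cmod_triangle (A - RtoC l) (- (B - RtoC l))) as Htr. rewrite Cmod_opp in Htr.
    replace (A - RtoC l + - (B - RtoC l))%C with (A - B)%C in Htr by ring. lra. }
  unfold Rdiv. replace (8 * e) with (2 * e * 4) by ring.
  apply Rmult_le_compat; [apply Cmod_ge_0|left; apply Rinv_0_lt_compat; lra|exact HAB|].
  rewrite <- (Rinv_inv 4). apply Rinv_le_contravar; lra.
Qed.

(** Multiplying both functions by [m] makes them tend to the same nonzero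
    limit [l]; the factor cancels in the quotient. *)
Lemma quotient_limit_at_puncture Omega (f g m : C -> C) (l : R) :
  ~ Omega (RtoC 0) -> / 2 <= Rabs l -> (forall z, z <> RtoC 0 -> m z <> RtoC 0) ->
  (forall eps, 0 < eps -> eventually_left (fun t => forall theta,
     let z := cexp t theta in Cmod (m z * f z - RtoC l) <= eps)) ->
  (forall eps, 0 < eps -> eventually_left (fun t => forall theta,
     let z := cexp t theta in Cmod (m z * g z - RtoC l) <= eps)) ->
  filterlim (fun z => (f z / g z)%C) (within Omega (locally (RtoC 0))) (locally (RtoC 1)).
Proof.
  intros H0 Hl Hm Hf Hg. apply filterlim_locally. intro eps.
  apply filter_at_puncture; [exact H0|].
  set (e := Rmin (/ 4) (eps / 9)). pose proof (cond_pos eps).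
  assert (He : 0 < e) by (apply Rmin_glb_lt; lra).
  assert (He' : e <= / 4 /\ e <= eps / 9) by (split; [apply Rmin_l|apply Rmin_r]).
  destruct (eventually_left_and _ _ (Hf e He) (Hg e He)) as [tau Htau].
  exists tau. intros t Ht theta. destruct (Htau t Ht) as [A B].
  assert (Hz : cexp t theta <> RtoC 0).
  { intro E. pose proof (Cmod_cexp t theta) as EM. rewrite E, Cmod_0 in EM.
    pose proof (exp_pos t). lra. }
  set (z := cexp t theta) in *. specialize (A theta). specialize (B theta). fold z in A, B.
  destruct (quotient_near_1 _ _ l e Hl (proj1 He') A B) as [HB HQ].
  apply C_NormedModule_mixin_compat1. change (Cmod (f z / g z - RtoC 1)%C < eps).
  replace (f z / g z)%C with (m z * f z / (m z * g z))%C; [lra|].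
  field. split; [|exact (Hm z Hz)]. intro E. apply HB. rewrite E. ring.
Qed.

Theorem theorem1p4 :
  forall (Omega : C -> Prop) (lamO lam kappa : C -> R),
    hyperbolic_domain Omega ->
    isolated_boundary_point Omega (RtoC 0) ->
    is_hyperbolic_metric Omega lamO ->
    regular_metric Omega lam ->
    locally_complete_at Omega lam (RtoC 0) ->
    (forall z, Omega z -> kappa z = curvature lam z) ->
    holder_continuous_on (fun z => Omega z \/ z = RtoC 0) kappa ->
    kappa (RtoC 0) = - 4 ->
    filterlim (fun z => lam z / lamO z)
      (within Omega (locally (RtoC 0))) (locally 1) /\
    filterlim (fun z => (connection lam z / connection lamO z)%C)
      (within Omega (locally (RtoC 0))) (locally (RtoC 1)) /\
    filterlim (fun z => (schwarzian lam z / schwarzian lamO z)%C)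
      (within Omega (locally (RtoC 0))) (locally (RtoC 1)).
Proof.
  intros Omega lamO lam kappa [Hdom _] Hiso (HregO & HcompO & HcurvO) Hreg Hlc Hk Hh H0.
  pose proof (proj1 (proj2 Hdom)) as Hopen.
  assert (HO0 : ~ Omega (RtoC 0)).
  { intro HO0. destruct (proj1 Hiso Omega (Hopen _ HO0)) as [_ (w & H1 & H2)]. exact (H2 H1). }
  destruct (punctured_neighbourhood Omega Hopen Hiso) as [T HT].
  pose proof (ray_divergent_of_locally_complete Omega lam T Hdom Hreg HT Hlc) as Hray.
  pose proof (ray_divergent_of_complete Omega lamO T HO0 HregO HT HcompO) as HrayO.
  pose proof (puncture_asymptotics Omega lam kappa T Hopen Hreg HT Hk Hh H0 Hray) as HA.
  assert (HhO : holder_continuous_on (fun z => Omega z \/ z = RtoC 0) (fun _ => - 4)).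
  { exists 1, 0. split; [lra|]. intros z w _ _ _. rewrite Rminus_diag, Rabs_R0. lra. }
  pose proof (puncture_asymptotics Omega lamO (fun _ => - 4) T Hopen HregO HT
    (fun z Hz => eq_sym (HcurvO z Hz)) HhO eq_refl HrayO) as HB.
  split; [|split].
  - apply filterlim_locally. intro eps. apply filter_at_puncture; [exact HO0|].
    set (e := Rmin (/ 2) (eps / 8)). pose proof (cond_pos eps).
    assert (He : 0 < e) by (apply Rmin_glb_lt; lra).
    assert (He' : e <= / 2 /\ e <= eps / 8) by (split; [apply Rmin_l|apply Rmin_r]).
    destruct (eventually_left_and _ _ (HA e He) (HB e He)) as [tau Htau].
    exists (Rmin tau T). intros t Ht theta. Rmin_bounds tau T.
    destruct (Htau t ltac:(lra)) as [A B].
    destruct (A theta) as [A1 _]. destruct (B theta) as [B1 _].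
    assert (L1 : 0 < lam (cexp t theta)) by (apply (Hreg _ (HT t theta ltac:(lra)))).
    assert (L2 : 0 < lamO (cexp t theta)) by (apply (HregO _ (HT t theta ltac:(lra)))).
    change (Rabs (lam (cexp t theta) / lamO (cexp t theta) - 1) < eps).
    set (x := log_density lam t theta - log_density lamO t theta).
    assert (E : lam (cexp t theta) / lamO (cexp t theta) = exp x).
    { unfold x, log_density.
      replace (ln (lam (cexp t theta)) + t - (ln (lamO (cexp t theta)) + t)) with
        (ln (lam (cexp t theta)) + - ln (lamO (cexp t theta))) by ring.
      rewrite exp_plus, exp_Ropp, !exp_ln by assumption. reflexivity. }
    rewrite E, <- exp_0. apply Rabs_le_between in A1, B1.
    assert (Hx : Rabs x <= 2 * e) by (unfold x; apply Rabs_le; lra).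
    pose proof Hx as Hx'. apply Rabs_le_between in Hx'.
    pose proof (exp_difference_le x 0 1 ltac:(lra) ltac:(lra)) as HX.
    rewrite Rminus_0_r in HX. pose proof exp_le_3. pose proof (exp_pos 1).
    pose proof (Rabs_pos x). nra.
  - apply (quotient_limit_at_puncture Omega _ _ (fun z => z) (-1)); auto.
    + rewrite Rabs_left; lra.
    + intros eps He. destruct (HA eps He) as [tau Htau].
      exists tau. intros t Ht theta. apply (Htau t Ht theta).
    + intros eps He. destruct (HB eps He) as [tau Htau].
      exists tau. intros t Ht theta. apply (Htau t Ht theta).
  - apply (quotient_limit_at_puncture Omega _ _ (fun z => (z * z)%C) (/ 2)); auto.
    + rewrite Rabs_pos_eq; lra.
    + intros z Hz. apply Cmult_neq_0; exact Hz.
    + intros eps He. destruct (HA eps He) as [tau Htau].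
      exists tau. intros t Ht theta. apply (Htau t Ht theta).
    + intros eps He. destruct (HB eps He) as [tau Htau].
      exists tau. intros t Ht theta. apply (Htau t Ht theta).
Qed.
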